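(* Fix $s>1$, $\gamma<3$ and $M>0$, and let $\omega=(\omega_1,\omega_2)\in\mathbb{R}^2_+$ be irrational. Then there exists $\varepsilon_{s,M,\omega,\gamma}>0$ such that for every $\psi_0\in C^\infty(\mathbb{T}^2_\omega)$ with $\|\psi_0\|_s=\varepsilon$, $0<\varepsilon<\varepsilon_{s,M,\omega,\gamma}$, and $\operatorname{supp}\hat\psi_0\subset Q_M$, the Cauchy problem $$i\partial_t\psi=\Delta\psi-|\psi|^2\psi,\qquad \psi(0)=\psi_0,\qquad x\in\mathbb{T}^2_\omega,$$ has a unique solution $\psi\in C([0,1/\varepsilon^2];H^s(\mathbb{T}^2_\omega))$, and this solution satisfies $$|\hat\psi_j(t)|<\varepsilon^\gamma$$ for all $t\in[0,1/\varepsilon^2]$ and all $j\in\mathbb{Z}^2\setminus Q_M$.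
   Context: A vector $\omega=(\omega_1,\omega_2)$ with positive real entries is called irrational if $\omega\cdot m\neq 0$ for every $m\in\mathbb{Z}^2\setminus\{0\}$. The problem on the torus $\mathbb{T}^2_\omega$ is normalized so that the geometry is carried by the Laplacian only. The functions $\psi$ are complex-valued functions on $\mathbb{T}^2=(\mathbb{R}/\mathbb{Z})^2$, with Fourier coefficients $\hat\psi_k=\hat\psi(k)=\int_{\mathbb{T}^2}\psi(x)e^{2\pi i\langle x,k\rangle}\,dx$, $k=(k^{(1)},k^{(2)})\in\mathbb{Z}^2$. The operator $\Delta$ is the Fourier multiplier $\widehat{\Delta\psi}(k)=-\lambda_k\hat\psi_k$ with $\lambda_k=\omega_1(k^{(1)})^2+\omega_2(k^{(2)})^2$. Thus in Fourier variables the equation reads $i\frac{d}{dt}\hat\psi_k=-\lambda_k\hat\psi_k-\sum_{k_1+k_2=k_3+k}\hat\psi_{k_1}\hat\psi_{k_2}\overline{\hat\psi_{k_3}}$. The norm of $H^s(\mathbb{T}^2_\omega)$ is $\|\psi\|_s=\big(\sum_{k\in\mathbb{Z}^2}|\hat\psi_k|^2\langle k\rangle^{2s}\big)^{1/2}$ with $\langle k\rangle=\sqrt{|k|^2+1}$. Also $Q_M=\{k\in\mathbb{Z}^2:\|k\|_\infty\le M\}$. *)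

(* Defs.v *)
From HB Require Import structures.
From mathcomp Require Import all_boot all_order all_algebra.
From mathcomp Require Import all_classical all_reals all_analysis.
From mathcomp Require Import complex.

Set Implicit Arguments.
Unset Strict Implicit.
Unset Printing Implicit Defensive.

Import Order.TTheory GRing.Theory Num.Theory.
Import numFieldNormedType.Exports.

Local Open Scope classical_set_scope.
Local Open Scope ring_scope.
Local Open Scope complex_scope.

(* Functions on the torus T^2 = (R/Z)^2 are functions on R^2 that are
   1-periodic in each variable; they are integrated over the fundamental
   domain [0,1]^2. *)
Definition periodic2 (R : realType) (f : R * R -> R[i]) : Prop :=
  forall x : R * R, f (x.1 + 1, x.2) = f x /\ f (x.1, x.2 + 1) = f x.

(* measurableTypeR R is the copy of R on which lebesgue_measure lives. *)
Notation plane R := (measurableTypeR R * measurableTypeR R)%type.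

Definition unit_square (R : realType) : set (plane R) :=
  [set x | 0 <= x.1 <= 1 /\ 0 <= x.2 <= 1].

Definition leb2 (R : realType) : {measure set (plane R) -> \bar R} :=
  (@lebesgue_measure R \x @lebesgue_measure R)%E.

Definition torus_ae_eq (R : realType) (f g : R * R -> R[i]) : Prop :=
  {ae @leb2 R, forall x, @unit_square R x -> f x = g x}.

Definition torus_integral (R : realType) (f : R * R -> R[i]) : R[i] :=
  Rintegral (@leb2 R) (@unit_square R) (fun x => complex.Re (f x)) +i*
  Rintegral (@leb2 R) (@unit_square R) (fun x => complex.Im (f x)).

Definition L2_torus (R : realType) (f : R * R -> R[i]) : Prop :=
  [/\ periodic2 f,
      measurable_fun (@unit_square R) (fun x : plane R => complex.Re (f x)),
      measurable_fun (@unit_square R) (fun x : plane R => complex.Im (f x)) &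
      (\int[@leb2 R]_(x in @unit_square R) ((Normc.normc (f x)) ^+ 2)%:E
        < +oo)%E].

Fixpoint class_C (R : realType) (n : nat) (f : R * R -> R) : Prop :=
  continuous f /\
  if n is m.+1 then
    [/\ forall x, derivable f x (1, 0), forall x, derivable f x (0, 1),
        class_C m ('D_(1, 0) f) & class_C m ('D_(0, 1) f)]
  else True.

Definition smooth_torus (R : realType) (f : R * R -> R[i]) : Prop :=
  periodic2 f /\
  forall n, class_C n (fun x => complex.Re (f x)) /\
            class_C n (fun x => complex.Im (f x)).

Definition character2 (R : realType) (k : int * int) (x : R * R) : R[i] :=
  let theta := 2 * pi * (x.1 * k.1%:~R + x.2 * k.2%:~R) in
  cos theta +i* sin theta.

(* Convention: the exponent is +2 pi i <x, k>. *)
Definition fourier (R : realType) (f : R * R -> R[i]) (k : int * int) : R[i] :=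
  torus_integral (fun x => f x * character2 k x).

Definition japanese (R : realType) (k : int * int) : R :=
  Num.sqrt (k.1%:~R ^+ 2 + k.2%:~R ^+ 2 + 1).

Definition sobolev_norm (R : realType) (s : R) (f : R * R -> R[i]) : \bar R :=
  ((\esum_(k in [set: int * int])
      ((Normc.normc (fourier f k)) ^+ 2 * (japanese R k) `^ (2 * s))%:E)
    `^ (2^-1))%E.

(* Elements of H^s are represented by functions, identified up to torus_ae_eq;
   L2_torus makes all Fourier coefficients genuine integrals. *)
Definition in_sobolev (R : realType) (s : R) (f : R * R -> R[i]) : Prop :=
  L2_torus f /\ (sobolev_norm s f < +oo)%E.

Definition continuous_in_sobolev (R : realType) (s T : R)
    (psi : R -> R * R -> R[i]) : Prop :=
  (forall t, 0 <= t <= T -> in_sobolev s (psi t)) /\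
  (forall t, 0 <= t <= T ->
     sobolev_norm s (psi u \- psi t) @[u --> within `[0, T] (nbhs t)]
       --> (0 : \bar R)%E).

Definition is_cderive (R : realType) (c : R -> R[i]) (t : R) (d : R[i]) : Prop :=
  is_derive t 1 (fun u => complex.Re (c u)) (complex.Re d) /\
  is_derive t 1 (fun u => complex.Im (c u)) (complex.Im d).

Definition eigenvalue2 (R : realType) (omega : R * R) (k : int * int) : R :=
  omega.1 * k.1%:~R ^+ 2 + omega.2 * k.2%:~R ^+ 2.

(* i d/dt psi = Delta psi - |psi|^2 psi at time t, where Delta is the Fourier
   multiplier -eigenvalue2: the equation is tested against each Fourier mode,
   i.e. it holds in the sense of distributions on the torus. *)
Definition nls_at (R : realType) (omega : R * R) (psi : R -> R * R -> R[i])
    (t : R) : Prop :=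
  forall k : int * int, exists2 d : R[i],
    is_cderive (fun u => fourier (psi u) k) t d &
    'i%C * d =
      - (eigenvalue2 omega k)%:C * fourier (psi t) k
      - fourier (fun x => ((Normc.normc (psi t x)) ^+ 2)%:C * psi t x) k.

(* psi is a solution in C([0,T]; H^s); at the end points of [0,T] the one-sided
   time derivatives follow from continuity up to the boundary. *)
Definition nls_solution (R : realType) (omega : R * R) (s T : R)
    (psi0 : R * R -> R[i]) (psi : R -> R * R -> R[i]) : Prop :=
  [/\ continuous_in_sobolev s T psi,
      torus_ae_eq (psi 0) psi0 &
      forall t, 0 < t < T -> nls_at omega psi t].

Definition irrational_vector (R : realType) (omega : R * R) : Prop :=
  [/\ 0 < omega.1, 0 < omega.2 &
      forall m : int * int, m <> (0, 0) ->
        omega.1 * m.1%:~R + omega.2 * m.2%:~R != 0].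

Definition Qbox (R : realType) (M : R) : set (int * int) :=
  [set k | (Num.max `|k.1| `|k.2|)%:~R <= M].

(* Main.v *)
Require Import Defs.
From mathcomp Require Import all_boot all_order all_algebra.
From mathcomp Require Import all_classical all_reals all_analysis.
From mathcomp Require Import measurable_realfun complex.
From mathcomp Require Import zify ring lra.
Import Order.TTheory GRing.Theory Num.Theory.
Import numFieldNormedType.Exports.

Local Open Scope classical_set_scope.
Local Open Scope ring_scope.

(** Write [c k] for the Fourier coefficients of a solution and pass to the
interaction picture [a t k = expi (- (lam k * t)) * c t k], where [lam] is
[eigenvalue2 omega]. The linear part disappears and the equation becomes
[a' = vfield t a], a cubic field in which a triple [(k1, k2, k3)] forces the
mode [k1 + k2 - k3] with the oscillating factor [expi (freq k1 k2 k3 * t)].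

The decisive point is arithmetic. With [k = k1 + k2 - k3] the frequency is
[- 2 (omega.1 p + omega.2 q)], where [p] and [q] are the integers
[(k1 - k3)(k2 - k3)] computed in the first and in the second coordinate. As
[omega] is irrational, a resonance forces [p = q = 0]: the four modes are the
corners of a rectangle with sides parallel to the axes. Three such corners in a
centred square leave no room for the fourth outside of it, so a mode outside the
square is only forced nonresonantly by triples of modes inside it
([freq_neq0]). There are finitely many such triples, so the divisors are bounded
away from zero.

For a solution of size [eps], the forcing of the high modes (those outside the
square) by the low ones has order [eps ^ 3] and a nonzero frequency. One
integration by parts in time replaces it by a correction of size [eps ^ 3] and a
remainder of size [eps ^ 5]; the other terms are bounded by [eps ^ 2] times the
high part. Gronwall's inequality ([seq_gronwall]) up to time [1 / eps ^ 2] keeps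
the high part of size [eps ^ 3] ([high_estimate]), and
[C * eps ^ 3 < eps ^ gamma] for small [eps] since [gamma < 3]. The low modes
interact among themselves without changing their energy, because the integral of
[|P| ^ 4] is real for a trigonometric polynomial [P] ([fcub_energy]); the energy
therefore varies at rate
[eps ^ 3 * eps ^ 3], that is by [eps ^ 4] in total ([energy_estimate]). Both
bounds together let a continuity argument run up to time [1 / eps ^ 2]
([long_time_solution]).

All this takes place in weighted l^1 spaces of coefficients. The weights [wt n]
are submultiplicative, so the cubic term is locally Lipschitz there
([nonlin_lip]) and, once cut off outside a ball, Picard iteration solves the
equation for all times ([picard], [truncated_solution]). Trigonometric data lie
in all these spaces, and a large power of the weight dominates the H^s norm
([sobolev_norm_wt]), whence a solution in C([0,T]; H^s)
([synthesized_continuous], [synthesized_nls]). Conversely, for [s > 1] the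
coefficients of an H^s function are summable ([sobolev_l1]), so that any two
solutions live in the plain l^1 space and coincide by Gronwall's inequality
([nls_unique]).

The translation between functions and coefficients rests on the fact that an
integrable function with vanishing Fourier coefficients vanishes almost
everywhere. The bounded functions that integrate to zero against it form a class
stable under linear combinations and bounded limits ([annih_bounded_closed]).
This class contains the products of powers of shifted cosines in the two
variables, then the indicators of products of their sublevel sets
([bounded_closed_level]), which are rectangles, and then the indicators of all
measurable sets ([null_on_measurable]). *)

Set Implicit Arguments.
Unset Strict Implicit.
Unset Printing Implicit Defensive.

Notation normc := Normc.normc.
Notation Re := complex.Re.
Notation Im := complex.Im.
Notation lattice := (int * int)%type.

(** * Complex numbers and their modulus *)

Lemma eq_ler (R : numDomainType) (x y : R) : x = y -> x <= y. Proof. by move->. Qed.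

Section Modulus.
Variable R : realType.
Implicit Types z w : R[i].

Lemma ReD z w : Re (z + w) = Re z + Re w. Proof. by case: z w => [a b] []. Qed.
Lemma ImD z w : Im (z + w) = Im z + Im w. Proof. by case: z w => [a b] []. Qed.
Lemma ReN z : Re (- z) = - Re z. Proof. by case: z. Qed.
Lemma ImN z : Im (- z) = - Im z. Proof. by case: z. Qed.
Lemma ReB z w : Re (z - w) = Re z - Re w. Proof. by rewrite ReD ReN. Qed.
Lemma ImB z w : Im (z - w) = Im z - Im w. Proof. by rewrite ImD ImN. Qed.
Lemma ReM z w : Re (z * w) = Re z * Re w - Im z * Im w.
Proof. by case: z w => [a b] []. Qed.
Lemma ImM z w : Im (z * w) = Re z * Im w + Im z * Re w.
Proof. by case: z w => [a b] []. Qed.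
Lemma ReJ z : Re (z^*)%C = Re z. Proof. by case: z. Qed.
Lemma ImJ z : Im (z^*)%C = - Im z. Proof. by case: z. Qed.
Lemma Re_sum (I : Type) (s : seq I) (P : pred I) (F : I -> R[i]) :
  Re (\sum_(i <- s | P i) F i) = \sum_(i <- s | P i) Re (F i).
Proof. by apply: (big_morph (fun z => Re z) ReD). Qed.
Lemma ReZ (x : R) z : Re ((x%:C)%C * z) = x * Re z.
Proof. by case: z => a b /=; rewrite mul0r subr0. Qed.
Lemma ImZ (x : R) z : Im ((x%:C)%C * z) = x * Im z.
Proof. by case: z => a b /=; rewrite mul0r addr0. Qed.
Lemma conjcM z w : (z * w)^*%C = z^*%C * w^*%C.
Proof. exact: rmorphM. Qed.
Lemma conjcB z w : (z - w)^*%C = z^*%C - w^*%C.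
Proof. exact: rmorphB. Qed.
Lemma conjc_sum (I : Type) (s : seq I) (P : pred I) (F : I -> R[i]) :
  (\sum_(i <- s | P i) F i)^*%C = \sum_(i <- s | P i) (F i)^*%C.
Proof. exact: rmorph_sum. Qed.

Lemma complex_ext z w : Re z = Re w -> Im z = Im w -> z = w.
Proof. by case: z w => [a b] [c d] /= -> ->. Qed.

Lemma normc_ge0 z : 0 <= normc z.
Proof. by case: z => a b; exact: sqrtr_ge0. Qed.

Lemma normcE z : normc z = Num.sqrt (Re z ^+ 2 + Im z ^+ 2).
Proof. by case: z. Qed.

Lemma sqr_normc z : normc z ^+ 2 = Re z ^+ 2 + Im z ^+ 2.
Proof. by rewrite normcE sqr_sqrtr// addr_ge0// sqr_ge0. Qed.

Lemma ler_normcD z w : normc (z + w) <= normc z + normc w.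
Proof. exact: (@le_normcD R). Qed.

Lemma normcN' z : normc (- z) = normc z.
Proof. by rewrite !normcE ReN ImN !sqrrN. Qed.

Lemma normcBC z w : normc (z - w) = normc (w - z).
Proof. by rewrite -normcN' opprB. Qed.

Lemma ler_normcB z w : normc (z - w) <= normc z + normc w.
Proof. by rewrite -(normcN' w) ler_normcD. Qed.

Lemma normcJ z : normc (z^*)%C = normc z.
Proof. by rewrite !normcE ReJ ImJ sqrrN. Qed.

Lemma normc_conjM z : (z^* * z = (normc z ^+ 2)%:C)%C.
Proof.
by apply: complex_ext; rewrite ?ReM ?ImM ReJ ImJ /= ?sqr_normc; ring.
Qed.

Lemma ler_Re_normc z : `|Re z| <= normc z.
Proof. by rewrite normcE -sqrtr_sqr ler_wsqrtr// lerDl sqr_ge0. Qed.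

Lemma ler_Im_normc z : `|Im z| <= normc z.
Proof. by rewrite normcE -sqrtr_sqr ler_wsqrtr// lerDr sqr_ge0. Qed.

Lemma normc_le_ReIm z : normc z <= `|Re z| + `|Im z|.
Proof.
rewrite normcE -(@ger0_norm _ (`|Re z| + `|Im z|)) ?addr_ge0// -sqrtr_sqr.
rewrite ler_wsqrtr// sqrrD !real_normK ?num_real//.
by rewrite lerD2r lerDl mulrn_wge0// mulr_ge0.
Qed.

Lemma normc_real (x : R) : normc (x%:C)%C = `|x|.
Proof. by rewrite normcE /= expr0n addr0 sqrtr_sqr. Qed.

Lemma normci : normc ('i : R[i])%C = 1.
Proof. by rewrite /= expr0n /= expr1n add0r sqrtr1. Qed.

Lemma normc_eq0 z : (normc z == 0) = (z == 0).
Proof.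
by apply/eqP/eqP => [/Normc.eq0_normc//|->]; rewrite Normc.normc0.
Qed.

Lemma ler_normc_sum (I : Type) (s : seq I) (P : pred I) (F : I -> R[i]) :
  normc (\sum_(i <- s | P i) F i) <= \sum_(i <- s | P i) normc (F i).
Proof.
elim/big_rec2 : _ => [|i y1 y2 _ le]; first by rewrite Normc.normc0.
by rewrite (le_trans (ler_normcD _ _))// lerD2l.
Qed.

Definition expi (x : R) : R[i] := (cos x +i* sin x)%C.

Lemma expiD x y : expi (x + y) = expi x * expi y.
Proof. by apply: complex_ext; rewrite ?ReM ?ImM /= ?cosD ?sinD//; ring. Qed.

Lemma expiJ x : ((expi x)^*)%C = expi (- x).
Proof. by apply: complex_ext; rewrite /= ?cosN ?sinN. Qed.

Lemma expi0 : expi 0 = 1.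
Proof. by rewrite /expi cos0 sin0. Qed.

Lemma expiNK x : expi (- x) * expi x = 1.
Proof. by rewrite -expiD addNr expi0. Qed.

Lemma normc_expi x : normc (expi x) = 1.
Proof. by rewrite normcE /= cos2Dsin2 sqrtr1. Qed.

Lemma expi_lip x y : normc (expi x - expi y) <= 2 * `|x - y|.
Proof.
have lip (f df : R -> R) : (forall x, is_derive (x : R) (1 : R) f (df x)) ->
    (forall x, `|df x| <= 1) -> `|f x - f y| <= `|x - y|.
  move=> fdf df1.
  wlog xy : x y / y <= x.
    by move=> h; case: (leP y x) => [|/ltW] /h//; rewrite distrC (distrC x).
  have [|c _ ->] := @MVT_segment R f df y x xy (fun x _ => fdf x).
    apply/continuous_subspaceT => z.
    by apply/differentiable_continuous/derivable1_diffP; case: (fdf z).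
  by rewrite normrM ler_piMl.
have hc : `|cos x - cos y| <= `|x - y|.
  by apply: (lip cos (fun u : R => - sin u)) => u; rewrite normrN sin_max.
have hs : `|sin x - sin y| <= `|x - y|.
  by apply: (lip sin cos) => u; rewrite cos_max.
by apply: le_trans (normc_le_ReIm _) _; rewrite ReB ImB /=; lra.
Qed.

End Modulus.

(** * Calculus of complex-valued functions of time *)

Section Calculus.
Variable R : realType.
Implicit Types (c d : R -> R[i]) (f g : R -> R).

Lemma is_deriveDf f g (t a b : R) : is_derive t (1 : R) f a ->
  is_derive t (1 : R) g b -> is_derive t (1 : R) (fun u => f u + g u) (a + b).
Proof. by move=> hf hg; exact: (@is_deriveD R R R f g t 1 a b hf hg). Qed.

Lemma is_deriveZf (k : R) f (t a : R) : is_derive t (1 : R) f a ->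
  is_derive t (1 : R) (fun u => k * f u) (k * a).
Proof. by move=> hf; exact: (@is_deriveZ R R R f k t 1 a hf). Qed.

Lemma is_cderive_eq c t a b : is_cderive c t a -> a = b -> is_cderive c t b.
Proof. by move=> ? <-. Qed.

Lemma is_cderive_cst (a : R[i]) t : is_cderive (fun=> a) t 0.
Proof. by split; exact: is_derive_cst. Qed.

Lemma is_cderiveD c d t a b : is_cderive c t a -> is_cderive d t b ->
  is_cderive (fun u => c u + d u) t (a + b).
Proof.
move=> [c1 c2] [d1 d2]; split.
- rewrite ReD (_ : (fun u => _) = (fun u => Re (c u)) + (fun u => Re (d u))).
    exact: is_deriveD.
  by apply/funext => u; rewrite ReD.
- rewrite ImD (_ : (fun u => _) = (fun u => Im (c u)) + (fun u => Im (d u))).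
    exact: is_deriveD.
  by apply/funext => u; rewrite ImD.
Qed.

Lemma is_cderiveM c d t a b : is_cderive c t a -> is_cderive d t b ->
  is_cderive (fun u => c u * d u) t (a * d t + c t * b).
Proof.
move=> [c1 c2] [d1 d2]; split.
- rewrite (_ : (fun u => _) = (fun u => Re (c u)) * (fun u => Re (d u))
      - (fun u => Im (c u)) * (fun u => Im (d u))).
    apply: is_derive_eq; rewrite ReD !ReM /= /GRing.scale /=; ring.
  by apply/funext => u; rewrite ReM.
- rewrite (_ : (fun u => _) = (fun u => Re (c u)) * (fun u => Im (d u))
      + (fun u => Im (c u)) * (fun u => Re (d u))).
    apply: is_derive_eq; rewrite ImD !ImM /= /GRing.scale /=; ring.
  by apply/funext => u; rewrite ImM.
Qed.

Lemma is_cderiveN c t a : is_cderive c t a -> is_cderive (fun u => - c u) t (- a).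
Proof.
move=> [c1 c2]; split.
- rewrite ReN (_ : (fun u => _) = - (fun u => Re (c u))); first exact: is_deriveN.
  by apply/funext => u; rewrite ReN.
- rewrite ImN (_ : (fun u => _) = - (fun u => Im (c u))); first exact: is_deriveN.
  by apply/funext => u; rewrite ImN.
Qed.

Lemma is_cderiveB c d t a b : is_cderive c t a -> is_cderive d t b ->
  is_cderive (fun u => c u - d u) t (a - b).
Proof. by move=> hc hd; apply: is_cderiveD => //; exact: is_cderiveN. Qed.

Lemma is_cderiveJ c t a : is_cderive c t a ->
  is_cderive (fun u => (c u)^*)%C t (a^*)%C.
Proof.
move=> [c1 c2]; split.
- by rewrite ReJ (_ : (fun u => _) = (fun u => Re (c u)))//;
    apply/funext => u; rewrite ReJ.
- rewrite ImJ (_ : (fun u => _) = - (fun u => Im (c u))); first exact: is_deriveN.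
  by apply/funext => u; rewrite ImJ.
Qed.

Lemma is_cderive_sum (I : Type) (s : seq I) (F : I -> R -> R[i])
    (dF : I -> R[i]) t : (forall i, is_cderive (F i) t (dF i)) ->
  is_cderive (fun u => \sum_(i <- s) F i u) t (\sum_(i <- s) dF i).
Proof.
move=> h; elim: s => [|i s IH].
  rewrite big_nil; under eq_fun do rewrite big_nil; exact: is_cderive_cst.
rewrite big_cons; under eq_fun do rewrite big_cons; exact: is_cderiveD.
Qed.

Lemma is_cderive_expi (a t : R) :
  is_cderive (fun u => expi (a * u)) t ('i%C * (a%:C)%C * expi (a * t)).
Proof.
have da : is_derive t (1 : R) (fun u : R => a * u) a.
  by rewrite -[X in is_derive _ _ _ X]mulr1; exact: is_deriveZf.
by split => /=; apply: is_derive_eq; rewrite ?ReM ?ImM /=; ring.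
Qed.

Definition ccontinuous (c : R -> R[i]) (A : set R) : Prop :=
  {within A, continuous (fun u => Re (c u))} /\
  {within A, continuous (fun u => Im (c u))}.

Lemma ccontinuousD c d A : ccontinuous c A -> ccontinuous d A ->
  ccontinuous (fun u => c u + d u) A.
Proof.
move=> [c1 c2] [d1 d2]; split => x.
- under eq_fun do rewrite ReD; apply: cvgD; [exact: c1|exact: d1].
- under eq_fun do rewrite ImD; apply: cvgD; [exact: c2|exact: d2].
Qed.

Lemma ccontinuousB c d A : ccontinuous c A -> ccontinuous d A ->
  ccontinuous (fun u => c u - d u) A.
Proof.
move=> [c1 c2] [d1 d2]; split => x.
- under eq_fun do rewrite ReB; apply: cvgB; [exact: c1|exact: d1].
- under eq_fun do rewrite ImB; apply: cvgB; [exact: c2|exact: d2].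
Qed.

Lemma ccontinuousM c d A : ccontinuous c A -> ccontinuous d A ->
  ccontinuous (fun u => c u * d u) A.
Proof.
move=> [c1 c2] [d1 d2]; split => x.
- under eq_fun do rewrite ReM.
  by apply: cvgB; apply: cvgM; [exact: c1|exact: d1|exact: c2|exact: d2].
- under eq_fun do rewrite ImM.
  by apply: cvgD; apply: cvgM; [exact: c1|exact: d2|exact: c2|exact: d1].
Qed.

Lemma ccontinuousJ c A : ccontinuous c A -> ccontinuous (fun u => (c u)^*%C) A.
Proof.
move=> [c1 c2]; split => x; first by under eq_fun do rewrite ReJ; exact: c1.
by under eq_fun do rewrite ImJ; apply: cvgN; exact: c2.
Qed.

Lemma ccontinuous_cst (z : R[i]) A : ccontinuous (fun=> z) A.
Proof. by split; apply: continuous_subspaceT => x; exact: cvg_cst. Qed.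

Lemma ccontinuous_sum (I : Type) (s : seq I) (F : I -> R -> R[i]) A :
  (forall i, ccontinuous (F i) A) -> ccontinuous (fun u => \sum_(i <- s) F i u) A.
Proof.
move=> h; elim: s => [|i s IH].
  by under eq_fun do rewrite big_nil; exact: ccontinuous_cst.
by under eq_fun do rewrite big_cons; exact: ccontinuousD.
Qed.

Lemma is_cderive_ccontinuous c dc A : (forall t, is_cderive c t (dc t)) ->
  ccontinuous c A.
Proof.
move=> h; split; apply: continuous_subspaceT => t;
  apply/differentiable_continuous/derivable1_diffP; case: (h t) => -[h1 _] [h2 _];
  by [exact: h1|exact: h2].
Qed.

Lemma derive_le_increment f df g dg (a b : R) : a <= b ->
  (forall x, a < x < b -> is_derive x (1 : R) f (df x)) ->
  (forall x, a < x < b -> is_derive x (1 : R) g (dg x)) ->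
  {within `[a, b], continuous f} -> {within `[a, b], continuous g} ->
  (forall x, a < x < b -> df x <= dg x) ->
  f b - f a <= g b - g a.
Proof.
rewrite le_eqVlt => /predU1P[->|ab] hf hg cf cg le; first by rewrite !subrr.
have [||c cab E] := @MVT R (g - f) (fun x => dg x - df x) a b ab.
- move=> x; rewrite in_itv/= => xab.
  have := hf x xab; have := hg x xab => ? ?; exact: is_deriveB.
- by move=> x; apply: cvgB; [exact: cg|exact: cf].
rewrite -subr_ge0.
have -> : g b - g a - (f b - f a) = (g - f) b - (g - f) a.
  by rewrite !fctE; ring.
by rewrite E mulr_ge0 ?subr_ge0 ?le ?(ltW ab)//; move: cab; rewrite in_itv.
Qed.

End Calculus.

(** * Weighted l^1 families of complex numbers *)

Section WeightedL1.
Variables (R : realType) (I : eqType).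
Implicit Types (w : I -> R) (a b : I -> R[i]) (A : seq I) (B C e : R).

Definition wsum w a A : R := \sum_(i <- A) w i * normc (a i).

(** The norm is mostly handled through its upper bounds on finite families, which
make sense before summability is known. *)
Definition wbounded w a B : Prop := forall A, uniq A -> wsum w a A <= B.

Definition wl1 w a : Prop := exists B, wbounded w a B.

Definition wnorm w a : R := sup [set x | exists2 A, uniq A & x = wsum w a A].

Lemma wbounded_ge0 w a B : wbounded w a B -> 0 <= B.
Proof. by move=> /(_ [::] isT); rewrite /wsum big_nil. Qed.

Lemma wbounded_le w a B C : B <= C -> wbounded w a B -> wbounded w a C.
Proof. by move=> BC h A uA; exact: le_trans (h A uA) BC. Qed.

Lemma wbounded_wl1 w a B : wbounded w a B -> wl1 w a.
Proof. by exists B. Qed.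

Lemma wnorm_le w a B : wbounded w a B -> wnorm w a <= B.
Proof.
move=> h; apply: ge_sup; first by exists 0, [::] => //; rewrite /wsum big_nil.
by move=> _ [A uA ->]; exact: h.
Qed.

Lemma wbounded_wnorm w a : wl1 w a -> wbounded w a (wnorm w a).
Proof.
move=> [B h] A uA; apply: ub_le_sup; last by exists A.
by exists B => _ [C uC ->]; exact: h.
Qed.

Lemma wnorm_ge0 w a : wl1 w a -> 0 <= wnorm w a.
Proof. by move=> /wbounded_wnorm/wbounded_ge0. Qed.

Lemma wbounded_term w a B i : wbounded w a B -> w i * normc (a i) <= B.
Proof. by move=> /(_ [:: i] isT); rewrite /wsum big_seq1. Qed.

Section NonnegWeight.
Variable w : I -> R.
Hypothesis w0 : forall i, 0 <= w i.

Lemma wbounded_dom a b B : (forall i, normc (a i) <= normc (b i)) ->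
  wbounded w b B -> wbounded w a B.
Proof.
move=> ab h A uA; apply: le_trans (h A uA).
by apply: ler_sum => i _; rewrite ler_wpM2l.
Qed.

Lemma wboundedD a b B C : wbounded w a B -> wbounded w b C ->
  wbounded w (fun i => a i + b i) (B + C).
Proof.
move=> ha hb A uA; apply: le_trans (lerD (ha A uA) (hb A uA)).
rewrite /wsum -big_split/=; apply: ler_sum => i _.
by rewrite -mulrDr ler_wpM2l// ler_normcD.
Qed.

Lemma wboundedN a B : wbounded w a B -> wbounded w (fun i => - a i) B.
Proof. by apply: wbounded_dom => i; rewrite normcN'. Qed.

Lemma wboundedB a b B C : wbounded w a B -> wbounded w b C ->
  wbounded w (fun i => a i - b i) (B + C).
Proof. by move=> ha /wboundedN; exact: wboundedD. Qed.

Lemma wboundedC a b B : wbounded w (fun i => a i - b i) B ->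
  wbounded w (fun i => b i - a i) B.
Proof. by apply: wbounded_dom => i; rewrite normcBC. Qed.

Lemma wboundedZ (z : R[i]) a B : wbounded w a B ->
  wbounded w (fun i => z * a i) (normc z * B).
Proof.
move=> h A uA; apply: le_trans (ler_wpM2l (normc_ge0 z) (h A uA)).
rewrite /wsum mulr_sumr; apply: ler_sum => i _.
by rewrite Normc.normcM mulrCA.
Qed.

Lemma wbounded0 : wbounded w (fun=> 0) 0.
Proof.
by move=> A _; rewrite /wsum big1// => i _; rewrite Normc.normc0 mulr0.
Qed.

Lemma wl1B a b : wl1 w a -> wl1 w b -> wl1 w (fun i => a i - b i).
Proof. by move=> [B ha] [C hb]; exists (B + C); exact: wboundedB. Qed.

Lemma wnorm_le_dist a b e : wl1 w b -> wbounded w (fun i => a i - b i) e ->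
  wnorm w a <= wnorm w b + e.
Proof.
move=> hb he; apply: wnorm_le => A uA.
have := wboundedD he (wbounded_wnorm hb) uA.
by rewrite addrC /wsum; under eq_bigr do rewrite subrK.
Qed.

End NonnegWeight.
End WeightedL1.

(** * Limits along fast Cauchy sequences *)

(** The limit is the supremum of the lower bounds [x n - rho n]. *)
Lemma fast_cauchy (R : realType) (x rho : nat -> R) :
  (forall n m, (n <= m)%N -> `|x m - x n| <= rho n) ->
  exists l, forall n, `|l - x n| <= rho n.
Proof.
move=> h; pose E := [set y | exists n, y = x n - rho n].
have rho0 n : 0 <= rho n by have := h n n (leqnn n); rewrite subrr normr0.
have ub m : ubound E (x m + rho m).
  move=> _ [n ->]; have := rho0 n; have := rho0 m.
  by case/orP : (leq_total n m) => /h; rewrite ler_norml => /andP[? ?]; lra.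
exists (sup E) => n; have h1 : sup E <= x n + rho n.
  by apply: ge_sup => //; exists (x 0%N - rho 0%N), 0%N.
have h2 : x n - rho n <= sup E.
  by apply: ub_le_sup; [exists (x 0%N + rho 0%N)|exists n].
by rewrite ler_norml; apply/andP; split; lra.
Qed.

Lemma fast_ccauchy (R : realType) (x : nat -> R[i]) (rho : nat -> R) :
  (forall n m, (n <= m)%N -> normc (x m - x n) <= rho n) ->
  exists l, forall n, normc (l - x n) <= 2 * rho n.
Proof.
move=> h.
have [|a ha] := @fast_cauchy R (fun n => Re (x n)) rho.
  by move=> n m nm; rewrite -ReB (le_trans (ler_Re_normc _))// h.
have [|b hb] := @fast_cauchy R (fun n => Im (x n)) rho.
  by move=> n m nm; rewrite -ImB (le_trans (ler_Im_normc _))// h.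
exists (a +i* b)%C => n; apply: le_trans (normc_le_ReIm _) _.
by rewrite ReB ImB /=; have := ha n; have := hb n; lra.
Qed.

Lemma le0_of_halves (R : realType) (x D : R) :
  (forall n, x <= D / 2 ^+ n) -> x <= 0.
Proof.
move=> h; rewrite leNgt; apply/negP => x0.
have D0 : 0 < D by have := h 0%N; rewrite expr0 divr1; exact: lt_le_trans.
pose n := Num.truncn (D / x).
have := truncnS_gt (D / x); rewrite -/n => Dn.
have := h n.+1; rewrite ler_pdivlMr ?exprn_gt0//.
apply/negP; rewrite -ltNge mulrC -ltr_pdivrMr//.
apply: lt_le_trans Dn _.
by rewrite -natrX ler_nat ltnW// ltn_expl.
Qed.

(** * Continuity on a time interval in the epsilon-delta form *)

Section TimeInterval.
Variables (R : realType) (I : eqType).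
Implicit Types (T t : R) (u v : R -> R) (z : R -> I -> R[i]) (w : I -> R).

Definition ctn T u := forall t, 0 <= t <= T -> forall e, 0 < e ->
  exists2 d, 0 < d & forall r, 0 <= r <= T -> `|r - t| < d -> `|u r - u t| <= e.

Definition wctn w T z := forall t, 0 <= t <= T -> forall e, 0 < e ->
  exists2 d, 0 < d & forall r, 0 <= r <= T -> `|r - t| < d ->
    wbounded w (fun i => z r i - z t i) e.

Lemma ctn_within T u : ctn T u <-> {within `[0, T], continuous u}.
Proof.
split => [h|/subspace_continuousP h t tT e e0].
  apply/subspace_continuousP => t /=; rewrite in_itv/= => tT.
  apply/cvgrPdist_le => e e0; have [d d0 H] := h t tT e e0.
  apply/nbhs_ballP; exists d => //= r tr; rewrite in_itv/= => rT.
  by rewrite distrC; apply: H => //; rewrite distrC.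
have := h t; rewrite /= in_itv/= => /(_ tT)/cvgrPdist_le/(_ e e0).
move=> /nbhs_ballP[d /= d0 H]; exists d => // r rT rt; rewrite distrC.
by apply: (H r); rewrite /= ?in_itv// /ball/= distrC.
Qed.

Lemma ctnB T u v : ctn T u -> ctn T v -> ctn T (fun t => v t - u t).
Proof. by move=> /ctn_within hu /ctn_within hv; apply/ctn_within => x; apply: cvgB; [exact: hv|exact: hu]. Qed.

(** At the infimum of the times where the inequality fails it still holds by
hypothesis, hence also shortly afterwards by continuity: a contradiction. *)
Lemma continuity_bootstrap T u v : ctn T u -> ctn T v ->
  (forall t, 0 <= t <= T -> (forall r, 0 <= r < t -> u r <= v r) -> u t < v t) ->
  forall t, 0 <= t <= T -> u t < v t.
Proof.
move=> cu cv step t0 t0T; rewrite ltNge; apply/negP => bad.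
pose S := [set t | 0 <= t <= T /\ v t <= u t]; pose m := inf S.
have S0 : S t0 by [].
have lbS : lbound S 0 by move=> t [/andP[]].
have m0 : 0 <= m by apply: lb_le_inf => //; exists t0.
have mt0 : m <= t0 by apply: ge_inf => //; exists 0.
have mT : 0 <= m <= T by rewrite m0 (le_trans mt0)//; case/andP: t0T.
have um : u m < v m.
  apply: step => // r /andP[r0 rm]; rewrite leNgt; apply/negP => vu.
  have : m <= r.
    apply: ge_inf; first by exists 0.
    by split; [case/andP : mT => _; rewrite r0/=; apply: le_trans; exact: ltW|exact: ltW].
  by rewrite leNgt rm.
have [|d d0 H] := ctnB cu cv mT (e := (v m - u m) / 2).
  by rewrite divr_gt0// subr_gt0.
have [|t [tT vt] tm] := @inf_adherent _ S d d0.
  by split; [exists t0|exists 0].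
have mt : m <= t by apply: ge_inf => //; exists 0.
have := H t tT; rewrite ger0_norm ?subr_ge0// ltrBlDl => /(_ tm).
by rewrite ler_norml => /andP[h1 h2]; lra.
Qed.

Lemma ctn_of_derive T u du : (forall t, is_derive t (1 : R) u (du t)) -> ctn T u.
Proof.
move=> h; apply/ctn_within/continuous_subspaceT => t.
by apply/differentiable_continuous/derivable1_diffP; case: (h t).
Qed.

Lemma wctn_wnorm w T z : (forall i, 0 <= w i) ->
  (forall t, 0 <= t <= T -> wl1 w (z t)) -> wctn w T z ->
  ctn T (fun t => wnorm w (z t)).
Proof.
move=> w0 hz cz t tT e e0; have [d d0 H] := cz t tT e e0.
exists d => // r rT rt; have := H r rT rt => zz.
have h1 := wnorm_le_dist w0 (hz t tT) zz.
have h2 := wnorm_le_dist w0 (hz r rT) (wboundedC w0 zz).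
by rewrite ler_norml; apply/andP; split; lra.
Qed.

End TimeInterval.

(** * Gronwall inequality in weighted l^1 *)

Section Gronwall.
Variables (R : realType) (I : eqType) (w : I -> R).
Hypothesis w0 : forall i, 0 <= w i.
Implicit Types (y r z G : R -> I -> R[i]) (g dg : R -> R) (A : seq I).

(** Multiplying each component by the constant phase that makes its increment over
[s, t] real turns the sum of the moduli into the increment of one real function,
whose derivative is at most [dg]. *)
Lemma wsum_increment A y r g dg (s t : R) : s <= t ->
  (forall i u, s < u < t -> is_cderive (fun v => y v i) u (r u i)) ->
  (forall i, ccontinuous (fun v => y v i) `[s, t]) ->
  (forall u, s < u < t -> is_derive u (1 : R) g (dg u)) ->
  {within `[s, t], continuous g} ->
  (forall u, s < u < t -> wsum w (r u) A <= dg u) ->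
  wsum w (fun i => y t i - y s i) A <= g t - g s.
Proof.
move=> st hy cy hg cg le.
pose ph i : R[i] := if y t i - y s i == 0 then 0
  else ((y t i - y s i)^* / (normc (y t i - y s i))%:C)%C.
have phE i : Re (ph i * (y t i - y s i)) = normc (y t i - y s i).
  rewrite /ph; case: eqVneq => [->|n0]; first by rewrite mulr0 Normc.normc0.
  rewrite mulrAC normc_conjM -rmorphV ?unitfE ?normc_eq0// -rmorphM/=.
  by rewrite expr2 mulfK// normc_eq0.
have ph1 i : normc (ph i) <= 1.
  rewrite /ph; case: eqVneq => [_|n0]; first by rewrite Normc.normc0.
  rewrite Normc.normcM normcJ Normc.normcV normc_real ger0_norm ?normc_ge0//.
  by rewrite mulfV// normc_eq0.
pose F u := \sum_(i <- A) ((w i)%:C * ph i)%C * y u i.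
pose dF u := \sum_(i <- A) ((w i)%:C * ph i)%C * r u i.
have ReF u v : Re (F u) - Re (F v) = \sum_(i <- A) w i * Re (ph i * (y u i - y v i)).
  rewrite -ReB /F -sumrB Re_sum; apply: eq_bigr => i _.
  by rewrite -mulrBr -mulrA ReZ.
have -> : wsum w (fun i => y t i - y s i) A = Re (F t) - Re (F s).
  by rewrite ReF; apply: eq_bigr => i _; rewrite phE.
apply: (@derive_le_increment R (fun u => Re (F u)) (fun u => Re (dF u)) g dg) => //.
- move=> u ust; have : is_cderive F u (dF u); last by case.
  apply: is_cderive_sum => i.
  apply: is_cderive_eq.
    exact: is_cderiveM (is_cderive_cst _ _) (hy i u ust).
  by rewrite mul0r add0r.
- have : ccontinuous F `[s, t]; last by case.
  rewrite /F; elim: {F dF ReF le} A => [|i A IH].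
    under eq_fun do rewrite big_nil.
    exact: is_cderive_ccontinuous (is_cderive_cst _).
  under eq_fun do rewrite big_cons.
  apply: ccontinuousD => //; apply: ccontinuousM => //.
  exact: is_cderive_ccontinuous (is_cderive_cst _).
- move=> u ust; apply: le_trans (le u ust).
  rewrite /dF Re_sum; apply: ler_sum => i _.
  rewrite -mulrA ReZ ler_wpM2l//.
  apply: le_trans (ler_norm _) _; apply: le_trans (ler_Re_normc _) _.
  by rewrite Normc.normcM ler_piMl ?normc_ge0.
Qed.

Lemma is_derive_expRM (L u : R) :
  is_derive u (1 : R) (fun v => expR (L * v)) (L * expR (L * u)).
Proof.
have dL : is_derive u (1 : R) (fun v : R => L * v) L.
  by rewrite -[X in is_derive _ _ _ X]mulr1; exact: is_deriveZf.
by apply: is_derive_eq; rewrite mulrC.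
Qed.

(** Here [G] is an oscillating forcing already integrated in time: its size enters
the bound, that of its derivative does not. The proof compares the norm with the
strictly larger [v], so that the continuity argument applies. *)
Lemma seq_gronwall z G r (L be ga T : R) : 0 <= L -> 0 <= be -> 0 <= ga ->
  ctn T (fun t => wnorm w (z t)) ->
  (forall i, z 0 i = 0) ->
  (forall i t, 0 < t < T -> is_cderive (fun u => z u i - G u i) t (r t i)) ->
  (forall i, ccontinuous (fun u => z u i - G u i) `[0, T]) ->
  (forall t, 0 <= t <= T -> wbounded w (G t) ga) ->
  (forall t, 0 < t < T -> wbounded w (r t) (L * wnorm w (z t) + be)) ->
  forall t, 0 <= t <= T -> wnorm w (z t) <= (2 * ga + be * T) * expR (L * t).
Proof.
move=> L0 be0 ga0 cz z0 dz ccz hG hr t tT.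
have T0 : 0 <= T by case/andP: tT; exact: le_trans.
apply/ler_addgt0Pr => e e0.
pose d := e / expR (L * T).
have d0 : 0 < d by rewrite divr_gt0// expR_gt0.
pose v (u : R) := (2 * ga + be * T + d) * expR (L * u).
have vE u : 0 <= u <= T -> (2 * ga + be * T) * expR (L * u) <= v u
    <= (2 * ga + be * T) * expR (L * u) + e.
  move=> /andP[u0 uT]; rewrite /v [(_ + d) * _]mulrDl lerD2l lerDl.
  rewrite mulr_ge0 ?expR_ge0 ?(ltW d0)//= /d mulrAC ler_pdivrMr ?expR_gt0//.
  by rewrite ler_wpM2l ?(ltW e0)// ler_expR ler_wpM2l.
suff lt : wnorm w (z t) < v t.
  by apply: le_trans (ltW lt) _; case/andP: (vE t tT).
move: t tT; apply: (@continuity_bootstrap R T (fun t => wnorm w (z t)) v).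
- exact: cz.
- apply: (@ctn_of_derive R T v (fun u => (2 * ga + be * T + d) * (L * expR (L * u)))).
  by move=> u; apply: is_deriveZf; exact: is_derive_expRM.
move=> t tT IH; have /andP[t0 tT'] := tT.
pose g u := v u + be * u.
pose dg u := L * v u + be.
have dgg u : is_derive u (1 : R) g (dg u).
  have h1 : is_derive u (1 : R) v ((2 * ga + be * T + d) * (L * expR (L * u))).
    by apply: is_deriveZf; exact: is_derive_expRM.
  have h2 : is_derive u (1 : R) (fun u : R => be * u) (be * 1).
    exact: is_deriveZf.
  have -> : dg u = (2 * ga + be * T + d) * (L * expR (L * u)) + be * 1.
    by rewrite /dg /v; ring.
  exact: is_deriveDf.
suff h : wnorm w (z t) <= v t - d by apply: le_lt_trans h _; rewrite ltrBlDr ltrDl.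
apply: wnorm_le => A uA.
have inc : wsum w (fun i => (z t i - G t i) - (z 0 i - G 0 i)) A <= g t - g 0.
  apply: (@wsum_increment A (fun u i => z u i - G u i) r g dg) => //.
  - by move=> i u /andP[u0 ut]; apply: dz; rewrite u0 (lt_le_trans ut).
  - move=> i; have [c1 c2] := ccz i.
    by split; [apply: continuous_subspaceW c1|apply: continuous_subspaceW c2];
      apply: subset_itvl; rewrite bnd_simp.
  - apply/continuous_subspaceT => u.
    by apply/differentiable_continuous/derivable1_diffP; case: (dgg u).
  - move=> u /andP[u0 ut]; have uT : 0 < u < T by rewrite u0 (lt_le_trans ut).
    apply: le_trans (hr u uT A uA) _.
    by rewrite lerD2r ler_wpM2l// IH// ut ltW.
have hGt := hG t tT A uA.
have hG0 := hG 0 _ A uA; rewrite lexx T0 in hG0; have {}hG0 := hG0 isT.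
have tri : wsum w (z t) A <= wsum w (fun i => (z t i - G t i) - (z 0 i - G 0 i)) A
    + wsum w (G t) A + wsum w (G 0) A.
  rewrite /wsum -!big_split/=; apply: ler_sum => i _; rewrite -!mulrDr ler_wpM2l// z0.
  have {1}-> : z t i = z t i - G t i - (0 - G 0 i) + G t i + (- G 0 i) by ring.
  rewrite -(normcN' (G 0 i)).
  by apply: le_trans (ler_normcD _ _) _; rewrite lerD2r ler_normcD.
have gE : g t - g 0 <= v t - (2 * ga + be * T + d) + be * T.
  rewrite /g /v !mulr0 expR0 mulr1 addr0.
  have := ler_wpM2l be0 tT'; lra.
by apply: le_trans tri _; lra.
Qed.

End Gronwall.

(** * Picard iteration for globally Lipschitz vector fields *)

Lemma primitive (R : realType) (f : R -> R) : continuous f ->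
  exists P : R -> R, forall t : R, 0 <= t -> is_derive t (1 : R) P (f t).
Proof.
move=> cf; pose P x := (\int[@lebesgue_measure R]_(t in `[-1, x]) f t)%R.
exists P => t t0.
have fint : (@lebesgue_measure R).-integrable `[-1, t + 1] (EFin \o f).
  by apply: continuous_compact_integrable;
    [exact: segment_compact|exact: continuous_subspaceT].
have [||dP PE] := continuous_FTC1_closed _ fint (x := t) _ (cf t).
- by rewrite ltrDl ltr01.
- by apply: lt_le_trans t0; rewrite ltrN10.
by apply: DeriveDef; [exact: dP|rewrite -derive1E; exact: PE].
Qed.

(** The Picard map has to choose primitives of functions whose continuity is only
known along the iteration. *)
Lemma primitive_operator (R : realType) : exists P : (R -> R) -> R -> R,
  forall f, continuous f -> forall t : R, 0 <= t -> is_derive t (1 : R) (P f) (f t).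
Proof.
suff /choice[P HP] : forall f : R -> R, exists P : R -> R, continuous f ->
    forall t : R, 0 <= t -> is_derive t (1 : R) P (f t) by exists P.
move=> f; have [/primitive[P HP]|nf] := pselect (continuous f); first by exists P.
by exists f.
Qed.

Section Picard.
Variables (R : realType) (I : eqType) (w : I -> R).
Variables (F : R -> (I -> R[i]) -> I -> R[i]) (L Mb : R) (a0 : I -> R[i]).
Hypothesis w_gt0 : forall i, 0 < w i.
Hypothesis L_gt0 : 0 < L.
Hypothesis F_bounded : forall t a, wl1 w a -> wbounded w (F t a) Mb.
Hypothesis F_lip : forall t a b D, wl1 w a -> wl1 w b ->
  wbounded w (fun i => a i - b i) D ->
  wbounded w (fun i => F t a i - F t b i) (L * D).
Hypothesis F_continuous : forall (a : R -> I -> R[i]) C, (forall t, wl1 w (a t)) ->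
  (forall t u, wbounded w (fun i => a t i - a u i) (C * `|t - u|)) ->
  forall i, continuous (fun t => Re (F t (a t) i)) /\
            continuous (fun t => Im (F t (a t) i)).
Hypothesis a0_l1 : wl1 w a0.

Let w_ge0 i : 0 <= w i. Proof. exact: ltW. Qed.

(** Uniform Lipschitz continuity in time is what makes the components of the field
continuous along an iterate, so that they have primitives. *)
Let invariant (x : R -> I -> R[i]) : Prop := (forall t, wl1 w (x t)) /\
  (forall t u, wbounded w (fun i => x t i - x u i) (Mb * `|t - u|)).

(** In the norm weighted by [expR (- (2 * L * t))] the integral equation is a
contraction with ratio 1/2 for all times at once, which gives a global solution. *)
Lemma picard : exists a : R -> I -> R[i],
  [/\ forall i, a 0 i = a0 i, forall t, wl1 w (a t),
      forall t u, wbounded w (fun i => a t i - a u i) (Mb * `|t - u|) &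
      forall (t : R) i, 0 < t -> is_cderive (fun u => a u i) t (F t (a t) i)].
Proof.
have [P HP] := primitive_operator R.
have Mb0 : 0 <= Mb := wbounded_ge0 (F_bounded 0 a0_l1).
pose Pc (c : R -> R[i]) t : R[i] :=
  ((P (fun u => Re (c u)) t - P (fun u => Re (c u)) 0)
   +i* (P (fun u => Im (c u)) t - P (fun u => Im (c u)) 0))%C.
(* primitives are available for nonnegative times, so the iterates are made
   constant for negative ones *)
pose Phi x t i := a0 i + Pc (fun u => F u (x u) i) (Num.max 0 t).
have Pc0 c : Pc c 0 = 0 by apply: complex_ext; rewrite /= subrr.
have dPc x i t : invariant x -> 0 <= t ->
    is_cderive (Pc (fun u => F u (x u) i)) t (F t (x t) i).
  move=> [x1 x2] t0; have [c1 c2] := F_continuous x1 x2 i.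
  have := HP _ c1 t t0; have := HP _ c2 t t0 => h1 h2.
  split => /=; rewrite -[X in is_derive _ _ _ X]addr0; apply: is_deriveDf => //;
    exact: is_derive_cst.
have cPc x i s t : invariant x -> 0 <= s ->
    ccontinuous (Pc (fun u => F u (x u) i)) `[s, t].
  move=> ix s0; split; apply/subspace_continuousP => u /=; rewrite in_itv/= => /andP[su _];
    have [h1 h2] := dPc x i u ix (le_trans s0 su);
    apply: cvg_within_filter; apply/differentiable_continuous/derivable1_diffP;
    [by case: h1|by case: h2].
have incr x s t : invariant x -> 0 <= s -> s <= t -> wbounded w (fun i =>
    Pc (fun u => F u (x u) i) t - Pc (fun u => F u (x u) i) s) (Mb * (t - s)).
  move=> ix s0 st A uA; rewrite mulrBr.
  apply: (wsum_increment w_ge0 (y := fun t i => Pc (fun u => F u (x u) i) t)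
    (r := fun t => F t (x t)) (g := fun t => Mb * t) (dg := fun=> Mb * 1)) => //.
  - by move=> i u /andP[su _]; apply: dPc => //; rewrite (le_trans s0)// ltW.
  - by move=> i; exact: cPc.
  - apply/continuous_subspaceT => u; apply: cvgM; [exact: cvg_cst|exact: cvg_id].
  - by move=> u _; rewrite mulr1; apply: F_bounded => //; case: ix.
have max_lip (s t : R) : `|Num.max 0 s - Num.max 0 t| <= `|s - t|.
  have := ler_norm (s - t); have := ler_norm (t - s); rewrite (distrC t) => h1 h2.
  have h3 : 0 <= `|s - t| by [].
  by case: (leP 0 s) => h4; case: (leP 0 t) => h5; rewrite ler_norml;
    apply/andP; split; lra.
have PhiI x : invariant x -> invariant (Phi x).
  move=> ix.
  have lip t u : wbounded w (fun i => Phi x t i - Phi x u i) (Mb * `|t - u|).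
    wlog tu : t u / Num.max 0 u <= Num.max 0 t.
      move=> h; case/orP: (le_total (Num.max 0 u) (Num.max 0 t)) => /h// H.
      by rewrite distrC; exact: wboundedC.
    have := incr x _ _ ix _ tu; rewrite le_max lexx => /(_ isT).
    move=> /(wbounded_le (C := Mb * `|t - u|)) h.
    have {}h := h (ler_wpM2l Mb0 (le_trans (ler_norm _) (max_lip t u))).
    apply: wbounded_dom h => // i; rewrite /Phi.
    by rewrite [a0 i + _]addrC addrKA.
  split=> [t|]; last exact: lip.
  have [B hB] := a0_l1; exists (Mb * `|t - 0| + B) => A uA.
  have := wboundedD w_ge0 (lip t 0) hB uA; congr (_ <= _); apply: eq_bigr => i _.
  by rewrite [Phi x 0 i]/Phi maxxx Pc0 addr0 subrK.
pose E t := expR (2 * L * t).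
have dE (t : R) : is_derive t (1 : R) E (2 * L * E t) by exact: is_derive_expRM.
have contract x x' D : invariant x -> invariant x' ->
    (forall t, 0 <= t -> wbounded w (fun i => x t i - x' t i) (D * E t)) ->
    forall t, 0 <= t -> wbounded w (fun i => Phi x t i - Phi x' t i) (D / 2 * E t).
  move=> ix ix' hD t t0 A uA.
  have D0 : 0 <= D.
    by have := wbounded_ge0 (hD 0 (lexx 0)); rewrite /E mulr0 expR0 mulr1.
  have := @wsum_increment R I w w_ge0 A (fun t i => Pc (fun u => F u (x u) i) t -
    Pc (fun u => F u (x' u) i) t) (fun t i => F t (x t) i - F t (x' t) i)
    (fun t => D / 2 * E t) (fun t => D / 2 * (2 * L * E t)) 0 t t0.
  have -> : wsum w (fun i => Phi x t i - Phi x' t i) A =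
     wsum w (fun i => Pc (fun u => F u (x u) i) t - Pc (fun u => F u (x' u) i) t -
       (Pc (fun u => F u (x u) i) 0 - Pc (fun u => F u (x' u) i) 0)) A.
    apply: eq_bigr => i _; rewrite /Phi (max_idPr t0) [a0 i + _]addrC addrKA.
    by rewrite !Pc0 subrr subr0.
  move=> h; apply: le_trans (h _ _ _ _ _) _.
  - by move=> i u /andP[/ltW u0 _]; apply: is_cderiveB; exact: dPc.
  - by move=> i; apply: ccontinuousB; exact: cPc.
  - apply/continuous_subspaceT => u; apply: cvgM; first exact: cvg_cst.
    by apply/differentiable_continuous/derivable1_diffP; case: (dE u).
  - move=> u /andP[/ltW u0 _].
    have := F_lip u (ix.1 u) (ix'.1 u) (hD u u0) uA.
    by congr (_ <= _); field.
  - by rewrite lerBlDr lerDl mulr_ge0 ?divr_ge0// expR_ge0.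
pose X n := iter n Phi (fun=> a0).
have XI n : invariant (X n).
  elim: n => [|n IH]; last exact: PhiI.
  split => [//|t u]; apply: wbounded_le (mulr_ge0 Mb0 (normr_ge0 _)) _.
  by have := wbounded0 w; apply: wbounded_dom => // i; rewrite /= subrr.
pose D0 := Mb / (2 * L).
have D00 : 0 <= D0 by rewrite divr_ge0// mulr_ge0// ltW.
have E0 t : 0 <= E t by exact: expR_ge0.
have step n : forall t, 0 <= t ->
    wbounded w (fun i => X n.+1 t i - X n t i) (D0 / 2 ^+ n * E t).
  elim: n => [|n IH] t t0.
    rewrite expr0 divr1.
    have -> : (fun i => X 1%N t i - X 0%N t i) = (fun i =>
       Pc (fun u => F u (X 0%N u) i) t - Pc (fun u => F u (X 0%N u) i) 0).
      apply/funext => i; rewrite /= /Phi (max_idPr t0) Pc0.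
      by rewrite addrAC subrr add0r subr0.
    apply: wbounded_le (incr _ _ _ (XI 0%N) (lexx 0) t0).
    rewrite subr0 /D0 mulrAC ler_pdivlMr ?mulr_gt0// -mulrA ler_wpM2l//.
    by rewrite /E; have := expR_ge1Dx (2 * L * t); lra.
  have -> : D0 / 2 ^+ n.+1 = D0 / 2 ^+ n / 2 by rewrite exprSr invfM mulrA.
  exact: contract (XI n.+1) (XI n) IH t t0.
have tail n m t : (n <= m)%N -> 0 <= t ->
    wbounded w (fun i => X m t i - X n t i) (2 * D0 / 2 ^+ n * E t).
  move=> nm t0; suff h : wbounded w (fun i => X m t i - X n t i)
      ((2 * D0 / 2 ^+ n - 2 * D0 / 2 ^+ m) * E t).
    apply: wbounded_le h; rewrite ler_wpM2r// lerBlDr lerDl.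
    by rewrite divr_ge0// mulr_ge0.
  elim: m nm => [|m IH]; rewrite leq_eqVlt => /predU1P[->//|].
  - by rewrite subrr mul0r => A uA; rewrite /wsum big1// => i _;
      rewrite subrr Normc.normc0 mulr0.
  - by rewrite ltn0.
  - by rewrite subrr mul0r => A uA; rewrite /wsum big1// => i _;
      rewrite subrr Normc.normc0 mulr0.
  move=> nm A uA; have := wboundedD w_ge0 (step m t t0) (IH nm) uA.
  have -> : D0 / 2 ^+ m * E t + (2 * D0 / 2 ^+ n - 2 * D0 / 2 ^+ m) * E t =
      (2 * D0 / 2 ^+ n - 2 * D0 / 2 ^+ m.+1) * E t.
    by rewrite exprS; field; rewrite ?expf_neq0.
  by congr (_ <= _); apply: eq_bigr => i _; rewrite addrA subrK.
have /choice[Xl HX] : forall ti : R * I, exists l, forall n,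
    normc (l - X n (Num.max 0 ti.1) ti.2) <=
    2 * (2 * D0 / 2 ^+ n * E (Num.max 0 ti.1) / w ti.2).
  move=> [t i] /=; apply: fast_ccauchy => n m nm.
  rewrite ler_pdivlMr// mulrC.
  by apply: (wbounded_term i (tail _ _ _ nm _)); rewrite le_max lexx.
pose Y t i := Xl (t, i).
have max0 (t : R) : 0 <= Num.max 0 t by rewrite le_max lexx.
(* a finite sum of errors tends to zero, whence the bound for the limit *)
have near_limit A t : exists K, forall m : nat,
    wsum w (fun i => Y t i - X m (Num.max 0 t) i) A <= K / 2 ^+ m.
  exists (\sum_(i <- A) 4 * D0 * E (Num.max 0 t)) => k.
  rewrite mulr_suml; apply: ler_sum => i _.
  have := HX (t, i) k; rewrite /= -/(Y t i) => h.
  apply: le_trans (ler_wpM2l (w_ge0 i) h) _.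
  apply: eq_ler; field.
  by rewrite expf_neq0//= gt_eqF.
have YX n t : wbounded w (fun i => Y t i - X n (Num.max 0 t) i)
    (2 * D0 / 2 ^+ n * E (Num.max 0 t)).
  move=> A uA; rewrite -subr_le0.
  have [K HK] := near_limit A t; apply: (le0_of_halves (D := K)) => m.
  rewrite lerBlDr; apply: (@le_trans _ _ (K / 2 ^+ (n + m) + 2 * D0 / 2 ^+ n * E (Num.max 0 t))).
    apply: le_trans (lerD (HK (n + m)%N) (tail n (n + m)%N _ (leq_addr _ _) (max0 t) A uA)).
    rewrite /wsum -big_split/=; apply: ler_sum => i _; rewrite -mulrDr ler_wpM2l//.
    by apply: le_trans (ler_normcD _ _); rewrite addrA subrK.
  have K0 : 0 <= K.
    have := HK 0%N; rewrite expr0 divr1; apply: le_trans.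
    by apply: sumr_ge0 => i _; rewrite mulr_ge0// normc_ge0.
  rewrite lerD2r ler_wpM2l// lef_pV2 ?posrE ?exprn_gt0//.
  by rewrite ler_eXn2l ?leq_addl// ltr1n.
have XM n t i : X n (Num.max 0 t) i = X n t i.
  by case: n => [//|n]; rewrite /= /Phi (max_idPr (max0 t)).
have YI : invariant Y.
  split=> [t|t u].
    have [B hB] := (XI 0%N).1 (Num.max 0 t).
    exists (2 * D0 / 2 ^+ 0 * E (Num.max 0 t) + B) => A uA.
    have := wboundedD w_ge0 (YX 0%N t) hB uA.
    by congr (_ <= _); apply: eq_bigr => i _; rewrite subrK.
  move=> A uA; rewrite -subr_le0.
  apply: (le0_of_halves (D := 2 * D0 * E (Num.max 0 t) + 2 * D0 * E (Num.max 0 u))) => n.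
  have h := wboundedD w_ge0 (wboundedB w_ge0 (YX n t) (YX n u)) ((XI n).2 t u).
  rewrite lerBlDr; apply: le_trans (_ : _ <= _) (le_trans (h A uA) _).
    apply: eq_ler; apply: eq_bigr => i _.
    by rewrite !XM; congr (_ * normc _); ring.
  by rewrite lerD2r; apply: eq_ler; field; rewrite ?expf_neq0.
have YPhi : Y = Phi Y.
  apply/funext => t; apply/funext => i; apply/eqP.
  rewrite -subr_eq0 -normc_eq0 eq_le normc_ge0 andbT.
  rewrite -(ler_pM2l (w_gt0 i)) mulr0.
  apply: (le0_of_halves (D := 2 * D0 * E (Num.max 0 t))) => n.
  have h2 := contract Y (X n) (2 * D0 / 2 ^+ n) YI (XI n) _ (Num.max 0 t) (max0 t).
  have {}h2 := h2 _.
  have h3 : wbounded w (fun j => Phi Y (Num.max 0 t) j - X n.+1 (Num.max 0 t) j)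
      (2 * D0 / 2 ^+ n / 2 * E (Num.max 0 t)).
    apply: h2 => u u0; have := YX n u; by rewrite (max_idPr u0).
  have := wbounded_term i (wboundedB w_ge0 (YX n.+1 t) h3).
  have -> : Phi Y (Num.max 0 t) i = Phi Y t i by rewrite /Phi (max_idPr (max0 t)).
  have -> : Y t i - X n.+1 (Num.max 0 t) i - (Phi Y t i - X n.+1 (Num.max 0 t) i)
    = Y t i - Phi Y t i by ring.
  move=> h; apply: le_trans h _.
  by apply: eq_ler; rewrite exprS; field; rewrite ?expf_neq0.
exists Y; split => [i|||t i t0].
- by rewrite YPhi /Phi maxxx Pc0 addr0.
- exact: YI.1.
- exact: YI.2.
have [d1 d2] := dPc Y i t YI (ltW t0).
have E1 : \near t, Pc (fun u => F u (Y u) i) t = Y t i - a0 i.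
  near=> u; have u0 : 0 <= u by apply: ltW; near: u; exact: lt_nbhsr.
  have -> : Y u i = a0 i + Pc (fun u => F u (Y u) i) u.
    by rewrite {1}YPhi /Phi (max_idPr u0).
  by rewrite [RHS]addrC addKr.
have : is_cderive (fun u => Y u i - a0 i) t (F t (Y t) i).
  split; [apply: near_eq_is_derive d1|apply: near_eq_is_derive d2];
    by near=> u; congr (_ _); near: u.
move=> h; apply: (is_cderive_eq (c := fun u => Y u i) (a := F t (Y t) i + 0)).
  rewrite (_ : (fun u => _) = (fun u => (Y u i - a0 i) + a0 i)).
    by apply: is_cderiveD => //; exact: is_cderive_cst.
  by apply/funext => u; rewrite subrK.
by rewrite addr0.
Unshelve. all: by end_near.
Qed.
End Picard.

(** * Integration over the torus *)

Section TorusIntegral.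
Variable R : realType.
Notation mu := (@leb2 R).
Notation sq := (@unit_square R).
Implicit Types f g : plane R -> R[i].

Lemma unit_squareE : sq = `[0, 1]%classic `*` `[0, 1]%classic.
Proof.
by apply/seteqP; split => x; rewrite /unit_square /= !in_itv /=; case.
Qed.

Lemma measurable_square : measurable sq.
Proof. by rewrite unit_squareE; apply: measurableX; exact: measurable_itv. Qed.

Lemma leb2_square : mu sq = 1%E.
Proof.
rewrite unit_squareE; apply: etrans (product_measure1E _ _ _ _) _;
  [exact: measurable_itv..|].
have E1 : @lebesgue_measure R `[0, 1]%classic = 1%E.
  by rewrite lebesgue_measure_itv/= lte_fin ltr01 -EFinB subr0.
by rewrite [X in (X * X)%E]E1 mule1.
Qed.

Definition cmeasurable f : Prop :=
  measurable_fun sq (fun x => Re (f x)) /\ measurable_fun sq (fun x => Im (f x)).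

(** Bounded measurable functions: closed under products, unlike integrable ones. *)
Definition tbounded f : Prop :=
  cmeasurable f /\ exists B, forall x, sq x -> normc (f x) <= B.

Definition cintegrable f : Prop :=
  mu.-integrable sq (EFin \o (fun x => Re (f x))) /\
  mu.-integrable sq (EFin \o (fun x => Im (f x))).

Lemma cmeasurable_cst (z : R[i]) : cmeasurable (fun=> z).
Proof. by split; exact: measurable_cst. Qed.

Lemma cmeasurableD f g : cmeasurable f -> cmeasurable g ->
  cmeasurable (fun x => f x + g x).
Proof.
move=> [f1 f2] [g1 g2]; split.
  by under eq_fun do rewrite ReD; exact: measurable_funD.
by under eq_fun do rewrite ImD; exact: measurable_funD.
Qed.

Lemma cmeasurableM f g : cmeasurable f -> cmeasurable g ->
  cmeasurable (fun x => f x * g x).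
Proof.
move=> [f1 f2] [g1 g2]; split.
  by under eq_fun do rewrite ReM; apply: measurable_funB; exact: measurable_funM.
by under eq_fun do rewrite ImM; apply: measurable_funD; exact: measurable_funM.
Qed.

Lemma cmeasurableJ f : cmeasurable f -> cmeasurable (fun x => (f x)^*)%C.
Proof.
move=> [f1 f2]; split.
  by under eq_fun do rewrite ReJ.
under eq_fun do rewrite ImJ; exact: measurableT_comp.
Qed.

Lemma measurable_normc f : cmeasurable f -> measurable_fun sq (fun x => normc (f x)).
Proof.
move=> [f1 f2]; rewrite (_ : (fun x => _) =
   (fun x => Num.sqrt (Re (f x) ^+ 2 + Im (f x) ^+ 2))); last first.
  by apply/funext => x; rewrite normcE.
apply: measurableT_comp.
  by apply: continuous_measurable_fun; exact: sqrt_continuous.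
by apply: measurable_funD; exact: measurable_funX.
Qed.

Lemma tbounded_cst (z : R[i]) : tbounded (fun=> z).
Proof. by split; [exact: cmeasurable_cst|exists (normc z)]. Qed.

Lemma tboundedD f g : tbounded f -> tbounded g -> tbounded (fun x => f x + g x).
Proof.
move=> [mf [B hB]] [mg [C hC]]; split; first exact: cmeasurableD.
exists (B + C) => x sx; apply: le_trans (ler_normcD _ _) _.
by rewrite lerD ?hB ?hC.
Qed.

Lemma tboundedM f g : tbounded f -> tbounded g -> tbounded (fun x => f x * g x).
Proof.
move=> [mf [B hB]] [mg [C hC]]; split; first exact: cmeasurableM.
by exists (B * C) => x sx; rewrite Normc.normcM ler_pM ?normc_ge0 ?hB ?hC.
Qed.

Lemma tboundedJ f : tbounded f -> tbounded (fun x => (f x)^*)%C.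
Proof.
move=> [mf [B hB]]; split; first exact: cmeasurableJ.
by exists B => x sx; rewrite normcJ hB.
Qed.

Lemma tbounded_sum (I : Type) (s : seq I) (F : I -> plane R -> R[i]) :
  (forall i, tbounded (F i)) -> tbounded (fun x => \sum_(i <- s) F i x).
Proof.
move=> h; elim: s => [|i s IH].
  by under eq_fun do rewrite big_nil; exact: tbounded_cst.
by under eq_fun do rewrite big_cons; exact: tboundedD.
Qed.

Lemma bounded_integrable (h : plane R -> R) B : measurable_fun sq h ->
  (forall x, sq x -> `|h x| <= B) -> mu.-integrable sq (EFin \o h).
Proof.
move=> mh hB; apply: measurable_bounded_integrable => //.
- exact: measurable_square.
- by rewrite [ltLHS]leb2_square ltry.
- exists B; split; first exact: num_real.
  by move=> x Bx y sy /=; exact: le_trans (hB y sy) (ltW Bx).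
Qed.

Lemma tbounded_cintegrable f : tbounded f -> cintegrable f.
Proof.
move=> [[f1 f2] [B hB]].
by split; apply: (bounded_integrable (B := B)) => // x sx;
  apply: le_trans (hB x sx); rewrite ?ler_Re_normc ?ler_Im_normc.
Qed.

Lemma integrableD_fun (f g : plane R -> R) :
  mu.-integrable sq (EFin \o f) -> mu.-integrable sq (EFin \o g) ->
  mu.-integrable sq (EFin \o (fun x => f x + g x)).
Proof. by move=> hf hg; exact: (integrableD measurable_square hf hg). Qed.

Lemma integrableB_fun (f g : plane R -> R) :
  mu.-integrable sq (EFin \o f) -> mu.-integrable sq (EFin \o g) ->
  mu.-integrable sq (EFin \o (fun x => f x - g x)).
Proof. by move=> hf hg; exact: (integrableB measurable_square hf hg). Qed.

Lemma cintegrableD f g : cintegrable f -> cintegrable g ->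
  cintegrable (fun x => f x + g x).
Proof.
move=> [f1 f2] [g1 g2]; split.
  by under eq_fun do rewrite ReD; exact: integrableD_fun.
by under eq_fun do rewrite ImD; exact: integrableD_fun.
Qed.

Lemma integrableM_fun (f g : plane R -> R) B : measurable_fun sq g ->
  (forall x, sq x -> `|g x| <= B) ->
  mu.-integrable sq (EFin \o f) -> mu.-integrable sq (EFin \o (fun x => f x * g x)).
Proof.
move=> mg gB hf.
have := @integrableMl _ _ R mu sq measurable_square (EFin \o f) g hf mg.
apply; exists B; split; first exact: num_real.
by move=> x Bx y sy /=; exact: le_trans (gB y sy) (ltW Bx).
Qed.

Lemma cintegrableM f g : cintegrable f -> tbounded g ->
  cintegrable (fun x => f x * g x).
Proof.
move=> [f1 f2] [[g1 g2] [B hB]].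
have h1 x : sq x -> `|Re (g x)| <= B.
  by move=> sx; exact: le_trans (ler_Re_normc _) (hB x sx).
have h2 x : sq x -> `|Im (g x)| <= B.
  by move=> sx; exact: le_trans (ler_Im_normc _) (hB x sx).
split.
  under eq_fun do rewrite ReM.
  by apply: integrableB_fun; [exact: integrableM_fun g1 h1 f1|exact: integrableM_fun g2 h2 f2].
under eq_fun do rewrite ImM.
by apply: integrableD_fun; [exact: integrableM_fun g2 h2 f1|exact: integrableM_fun g1 h1 f2].
Qed.

Lemma torus_integralD f g : cintegrable f -> cintegrable g ->
  torus_integral (fun x => f x + g x) = torus_integral f + torus_integral g.
Proof.
move=> [f1 f2] [g1 g2]; have ms := measurable_square.
apply: complex_ext; rewrite ?ReD ?ImD /=.
  by under eq_Rintegral do rewrite ReD; rewrite RintegralD.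
by under eq_Rintegral do rewrite ImD; rewrite RintegralD.
Qed.

Lemma torus_integralZ (z : R[i]) f : cintegrable f ->
  torus_integral (fun x => z * f x) = z * torus_integral f.
Proof.
move=> [f1 f2]; have ms := measurable_square.
have hz (a : R) (h : plane R -> R) : mu.-integrable sq (EFin \o h) ->
    mu.-integrable sq (EFin \o (fun x => a * h x)).
  by move=> hi; exact: (integrableZl ms a hi).
apply: complex_ext; rewrite ?ReM ?ImM /=.
  under eq_Rintegral do rewrite ReM.
  by rewrite RintegralB//; [rewrite !RintegralZl|exact: hz..].
under eq_Rintegral do rewrite ImM.
by rewrite RintegralD//; [rewrite !RintegralZl|exact: hz..].
Qed.

Lemma torus_integral0 : torus_integral (fun _ : plane R => 0) = 0.
Proof.
by apply: complex_ext; rewrite /= /Rintegral integral0.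
Qed.

Lemma torus_integralB f g : cintegrable f -> cintegrable g ->
  torus_integral (fun x => f x - g x) = torus_integral f - torus_integral g.
Proof.
move=> hf hg.
have hN : cintegrable (fun x => (-1) * g x).
  under eq_fun do rewrite mulrC.
  by apply: cintegrableM => //; exact: tbounded_cst.
rewrite (_ : (fun x => _) = (fun x => f x + (-1) * g x)); last first.
  by apply/funext => x; rewrite mulN1r.
by rewrite torus_integralD// torus_integralZ// mulN1r.
Qed.

Lemma torus_integral_sum (I : Type) (s : seq I) (F : I -> plane R -> R[i]) :
  (forall i, tbounded (F i)) ->
  torus_integral (fun x => \sum_(i <- s) F i x) =
  \sum_(i <- s) torus_integral (F i).
Proof.
move=> h; elim: s => [|i s IH].
  by rewrite big_nil; under eq_fun do rewrite big_nil; exact: torus_integral0.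
rewrite big_cons -IH; under eq_fun do rewrite big_cons.
by rewrite torus_integralD//; apply: tbounded_cintegrable => //; exact: tbounded_sum.
Qed.

Lemma le_Rintegral_square (h : plane R -> R) B : measurable_fun sq h ->
  (forall x, sq x -> `|h x| <= B) -> `|Rintegral mu sq h| <= B.
Proof.
move=> mh hB; have hi := bounded_integrable mh hB.
apply: le_trans (le_normr_Rintegral measurable_square hi) _.
have -> : B = Rintegral mu sq (fun=> B).
  rewrite Rintegral_cst ?[mu _]leb2_square ?mulr1//; exact: measurable_square.
apply: le_Rintegral => //; first exact: measurable_square.
- apply: (bounded_integrable (B := B)) => [|x sx]; last by rewrite normr_id hB.
  exact: measurableT_comp.
- apply: (bounded_integrable (B := `|B|)) => //.
Qed.

Lemma torus_integral_bound f B : cmeasurable f ->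
  (forall x, sq x -> normc (f x) <= B) -> normc (torus_integral f) <= 2 * B.
Proof.
move=> [f1 f2] hB; apply: le_trans (normc_le_ReIm _) _ => /=.
rewrite mulr2n mulrDl !mul1r; apply: lerD; apply: le_Rintegral_square => // x sx;
  apply: le_trans (hB x sx); by rewrite ?ler_Re_normc ?ler_Im_normc.
Qed.

Lemma torus_integral_ae f g : cmeasurable f -> cmeasurable g ->
  torus_ae_eq f g -> torus_integral f = torus_integral g.
Proof.
move=> [f1 f2] [g1 g2] fg; apply: complex_ext => /=; congr fine;
  apply: ae_eq_integral; try exact: measurable_square; try exact/measurable_EFinP.
- by apply: filterS fg => x h sx /=; rewrite h.
- by apply: filterS fg => x h sx /=; rewrite h.
Qed.

Lemma L2_cmeasurable f : L2_torus f -> cmeasurable f.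
Proof. by case. Qed.

(** The torus has finite measure and |f| <= |f|^2 + 1. *)
Lemma L2_cintegrable f : L2_torus f -> cintegrable f.
Proof.
move=> [_ f1 f2 fin].
have mf : cmeasurable f by [].
have i2 : mu.-integrable sq (EFin \o (fun x => normc (f x) ^+ 2 + 1)).
  apply: integrableD_fun.
    apply/integrableP; split.
      by apply/measurable_EFinP; apply: measurable_funX; exact: measurable_normc.
    by under eq_integral do rewrite /= ger0_norm ?sqr_ge0//.
  by apply: (bounded_integrable (B := 1)) => // x _; rewrite normr1.
have le1 (x : plane R) : normc (f x) <= normc (f x) ^+ 2 + 1.
  by have := sqr_ge0 (normc (f x) - 1); have := normc_ge0 (f x); nra.
have le2 (x : plane R) : normc (f x) <= `|normc (f x) ^+ 2 + 1|.
  by rewrite (le_trans (le1 x))// ler_norm.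
split; apply: (le_integrable measurable_square _ _ i2);
  try exact/measurable_EFinP; move=> x _; rewrite /comp !abse_EFin lee_fin.
- exact: le_trans (ler_Re_normc _) (le2 x).
- exact: le_trans (ler_Im_normc _) (le2 x).
Qed.

Lemma measurable_character2 k : cmeasurable (@character2 R k).
Proof.
have mth : measurable_fun sq (fun x : plane R =>
    2 * pi * (x.1 * k.1%:~R + x.2 * k.2%:~R) : R).
  apply: measurable_funM => //; apply: measurable_funD; apply: measurable_funM => //;
    [exact: measurable_funTS measurable_fst|exact: measurable_funTS measurable_snd].
split; apply: measurableT_comp mth; apply: continuous_measurable_fun;
  [exact: continuous_cos|exact: continuous_sin].
Qed.

Lemma character2E k (x : R * R) :
  character2 k x = expi (2 * pi * (x.1 * k.1%:~R + x.2 * k.2%:~R)).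
Proof. by []. Qed.

Lemma normc_character2 k (x : R * R) : normc (character2 k x) = 1.
Proof. by rewrite character2E normc_expi. Qed.

Lemma tbounded_character2 k : tbounded (@character2 R k).
Proof.
by split; [exact: measurable_character2|exists 1 => x _; rewrite normc_character2].
Qed.

Lemma character2D k l (x : R * R) :
  character2 k x * character2 l x = character2 (k + l) x.
Proof.
rewrite !character2E -expiD; congr expi.
by rewrite /= !rmorphD /=; ring.
Qed.

Lemma character2J k (x : R * R) : ((character2 k x)^*)%C = character2 (- k) x.
Proof. by rewrite !character2E expiJ; congr expi; rewrite /= !rmorphN /=; ring. Qed.

End TorusIntegral.

(** * Orthogonality of the characters *)

Section Orthogonality.
Variable R : realType.
Notation mu := (@leb2 R).
Notation leb := (@lebesgue_measure R).
Notation sq := (@unit_square R).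
Notation I01 := (`[0, 1]%classic : set (measurableTypeR R)).

Lemma integral_square_fst (h : plane R -> R) : mu.-integrable sq (EFin \o h) ->
  (forall y, 0 <= y <= 1 -> (\int[leb]_(x in I01) (h (x, y))%:E = 0)%E) ->
  Rintegral mu sq h = 0.
Proof.
move=> hi h0; rewrite /Rintegral integral_mkcond.
have hi' := (integrable_mkcond _ (@measurable_square R)).1 hi.
have := integral21_prod_meas1 hi'; rewrite /leb2 => <-.
rewrite (eq_integral (cst 0%E)) ?integral0// => y _.
rewrite /fubini_G /=; have [y01|y01] := boolP (0 <= y <= 1).
  rewrite -[RHS](h0 y y01) [RHS]integral_mkcond; apply: eq_integral => x _.
  rewrite !patchE; case: ifPn; case: ifPn => //.
    by rewrite notin_setE => nx; rewrite inE => -[x01 _]; case: nx; rewrite /= in_itv.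
  by rewrite inE /= in_itv /= => x01; rewrite notin_setE => -[]; split.
apply: integral0_eq => x _; rewrite patchE ifF//; apply/negP; rewrite inE => -[_].
exact/negP.
Qed.

Lemma integral_square_snd (h : plane R -> R) : mu.-integrable sq (EFin \o h) ->
  (forall x, 0 <= x <= 1 -> (\int[leb]_(y in I01) (h (x, y))%:E = 0)%E) ->
  Rintegral mu sq h = 0.
Proof.
move=> hi h0; rewrite /Rintegral integral_mkcond.
have hi' := (integrable_mkcond _ (@measurable_square R)).1 hi.
have := integral12_prod_meas1 hi'; rewrite /leb2 => <-.
rewrite (eq_integral (cst 0%E)) ?integral0// => x _.
rewrite /fubini_F /=; have [x01|x01] := boolP (0 <= x <= 1).
  rewrite -[RHS](h0 x x01) [RHS]integral_mkcond; apply: eq_integral => y _.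
  rewrite !patchE; case: ifPn; case: ifPn => //.
    by rewrite notin_setE => ny; rewrite inE => -[_ y01]; case: ny; rewrite /= in_itv.
  by rewrite inE /= in_itv /= => y01; rewrite notin_setE => -[]; split.
apply: integral0_eq => y _; rewrite patchE ifF//; apply/negP; rewrite inE => -[+ _].
exact/negP.
Qed.

Lemma sinD2piz (a : R) (k : int) : sin (a + 2 * pi * k%:~R) = sin a.
Proof.
case: k => n.
  rewrite -(periodicn (@sinD2pi R) n a); congr sin.
  by rewrite -pmulrn -[pi *+ 2]mulr_natl -[_ *+ n in RHS]mulr_natr; ring.
have {2}-> : a = a + 2 * pi * (Negz n)%:~R + (pi *+ 2) *+ n.+1.
  rewrite NegzE rmorphN /= -pmulrn -[pi *+ 2]mulr_natl -[_ *+ n.+1 in RHS]mulr_natr.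
  by ring.
by rewrite (periodicn (@sinD2pi R)).
Qed.

Lemma cosD2piz (a : R) (k : int) : cos (a + 2 * pi * k%:~R) = cos a.
Proof. by rewrite -!sinDpihalf addrAC sinD2piz. Qed.

Lemma is_derive_affine_comp (f : R -> R) (df a b x : R) :
  is_derive (a * x + b) (1 : R) f df ->
  is_derive x (1 : R) (fun y => f (a * y + b)) (a * df).
Proof.
move=> hf; have hg : is_derive x (1 : R) (fun y => a * y + b) (a * 1 + 0).
  exact: is_deriveDf (is_deriveZf a (is_derive_id x 1)) (is_derive_cst b x 1).
have := @is_derive1_comp R f (fun y => a * y + b) x df (a * 1 + 0) hf hg.
by rewrite mulr1 addr0 mulrC.
Qed.

Lemma integral_over_period (F f : R -> R) (k : int) (b : R) : k != 0 ->
  (forall x, is_derive x (1 : R) F (f x)) -> continuous f ->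
  F (2 * pi * k%:~R * 1 + b) = F b ->
  (\int[leb]_(x in I01) (f (2 * pi * k%:~R * x + b))%:E = 0)%E.
Proof.
move=> k0 dF cf per; pose a := 2 * pi * k%:~R : R.
have a0 : a != 0.
  apply: mulf_neq0; last by rewrite intr_eq0.
  by apply: mulf_neq0; [rewrite pnatr_eq0|rewrite gt_eqF// pi_gt0].
pose G x := a^-1 * F (a * x + b).
have dG (x : R) : is_derive x (1 : R) G (f (a * x + b)).
  have := is_deriveZf a^-1 (is_derive_affine_comp (dF (a * x + b))).
  by rewrite mulrA mulVf// mul1r.
have cG (x : R) : {for x, continuous G}.
  by apply/differentiable_continuous/derivable1_diffP; case: (dG x).
rewrite (@continuous_FTC2 R (fun x => f (a * x + b)) G 0 1)//.
- by rewrite /G [F (a * 1 + b)]per mulr0 add0r subee.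
- apply: continuous_subspaceT => x; apply: continuous_comp; last exact: cf.
  by apply: cvgD; [apply: cvgM; [exact: cvg_cst|exact: cvg_id]|exact: cvg_cst].
- split; first by move=> x _; case: (dG x).
  + by apply: cvg_at_right_filter; exact: cG.
  + by apply: cvg_at_left_filter; exact: cG.
- by move=> x _; rewrite derive1E; case: (dG x).
Qed.

Lemma torus_integral_character k : k != 0 -> torus_integral (@character2 R k) = 0.
Proof.
move=> k0; have [h1 h2] := tbounded_cintegrable (tbounded_character2 R k).
have dsin x : is_derive x (1 : R) sin (cos x) by exact: is_derive_sin.
have dcos (x : R) : is_derive x (1 : R) (fun y => - cos y) (sin x).
  by have := is_deriveZf (-1) (is_derive_cos x); rewrite mulrNN mul1r;
    under eq_fun do rewrite mulN1r.
have [k1|k1] := eqVneq k.1 0.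
  have k2 : k.2 != 0 by apply: contraNneq k0 => k2; rewrite (surjective_pairing k) k1 k2.
  apply: complex_ext => /=; apply: integral_square_snd => // x _ /=; rewrite k1.
  - have := integral_over_period (b := 0) k2 dsin (@continuous_cos R).
    rewrite mulr1 addrC sinD2piz => /(_ erefl) <-; apply: eq_integral => y _.
    by congr (cos _)%:E; ring.
  - have := integral_over_period (b := 0) k2 dcos (@continuous_sin R).
    rewrite mulr1 addrC cosD2piz => /(_ erefl) <-; apply: eq_integral => y _.
    by congr (sin _)%:E; ring.
apply: complex_ext => /=; apply: integral_square_fst => // y _ /=.
- have := integral_over_period (b := 2 * pi * (y * k.2%:~R)) k1 dsin (@continuous_cos R).
  rewrite mulr1 addrC sinD2piz => /(_ erefl) <-; apply: eq_integral => x _.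
  by congr (cos _)%:E; ring.
- have := integral_over_period (b := 2 * pi * (y * k.2%:~R)) k1 dcos (@continuous_sin R).
  rewrite mulr1 addrC cosD2piz => /(_ erefl) <-; apply: eq_integral => x _.
  by congr (sin _)%:E; ring.
Qed.

Lemma character2_0 (x : R * R) : character2 0 x = 1.
Proof. by rewrite character2E /= !mulr0 addr0 mulr0 expi0. Qed.

Lemma torus_integral_characterE k :
  torus_integral (@character2 R k) = (k == 0)%:R.
Proof.
have [->|k0] := eqVneq k 0; last exact: torus_integral_character.
rewrite (_ : character2 0 = fun=> 1); last by apply/funext => x; rewrite character2_0.
have RI (a : R) : Rintegral (@leb2 R) (@unit_square R) (fun=> a) = a.
  rewrite Rintegral_cst; last exact: measurable_square.
  transitivity (a * fine 1%E); last by rewrite mulr1.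
  congr (a * fine _); exact: leb2_square.
by apply: complex_ext; rewrite /= RI.
Qed.

End Orthogonality.

(** * Uniqueness of Fourier coefficients *)

Section BoundedClosure.
Variable R : realType.
Notation sq := (@unit_square R).

(** The closure properties that dominated convergence gives to the functions
integrating to zero against a fixed integrable function. *)
Definition bounded_closed (H : (plane R -> R) -> Prop) : Prop :=
  (forall a h g, H h -> H g -> H (fun x => a * h x + g x)) /\
  (forall (h_ : nat -> plane R -> R) h B, (forall n, H (h_ n)) ->
     (forall n x, sq x -> `|h_ n x| <= B) ->
     (forall x, sq x -> h_ n x @[n --> \oo] --> h x) -> H h).

Lemma bounded_closed_sum H (I : Type) (s : seq I) (a : I -> R) (h : I -> plane R -> R) :
  bounded_closed H -> H (fun=> 0) -> (forall i, H (h i)) ->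
  H (fun x => \sum_(i <- s) a i * h i x).
Proof.
move=> [lin _] H0 Hh; elim: s => [|i s IH].
  by under eq_fun do rewrite big_nil.
by under eq_fun do rewrite big_cons; exact: lin.
Qed.

(** The exponential series of a bounded function converges boundedly. *)
Lemma bounded_closed_exp H (v : plane R -> R) (M a : R) : bounded_closed H ->
  H (fun=> 0) -> (forall x, sq x -> `|v x| <= M) ->
  (forall n, H (fun x => v x ^+ n)) -> H (fun x => expR (a * v x)).
Proof.
move=> cl H0 vM Hv; have [lin lim] := cl.
pose p n x := \sum_(i <- index_iota 0 n) (a ^+ i / i`!%:R) * v x ^+ i.
have pE n x : p n x = series (exp_coeff (a * v x)) n.
  by rewrite /p /series /=; apply: eq_bigr => i _; rewrite /exp_coeff /= exprMn; ring.
apply: (lim p _ (expR (`|a| * M))).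
- by move=> n; exact: bounded_closed_sum.
- move=> n x sx; rewrite pE /series /=; apply: le_trans (ler_norm_sum _ _ _) _.
  apply: (@le_trans _ _ (series (exp_coeff (`|a| * M)) n)).
    apply: ler_sum => i _; rewrite /exp_coeff /= normrM [`|_^-1|]ger0_norm ?invr_ge0//.
    rewrite ler_wpM2r ?invr_ge0// normrX normrM.
    by apply: lerXn2r; rewrite ?nnegrE ?mulr_ge0 ?(le_trans _ (vM x sx))// ler_wpM2l ?vM.
  rewrite /expR; apply: nondecreasing_cvgn_le; last exact: is_cvg_series_exp_coeff.
  apply: nondecreasing_series => i _ _; rewrite /exp_coeff /= divr_ge0// exprn_ge0//.
  by rewrite mulr_ge0// (le_trans _ (vM x sx)).
- move=> x sx; under eq_fun do rewrite pE; exact: is_cvg_series_exp_coeff.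
Qed.

(** The functions [exp (- exp (n^2 (u - c) + n))] tend to the indicator of
[u < c] everywhere, including on the level set [u = c]. *)
Lemma bounded_closed_level H (u : plane R -> R) (c : R) : bounded_closed H ->
  H (fun=> 0) -> (forall x, sq x -> `|u x| <= 1) ->
  (forall n, H (fun x => u x ^+ n)) -> H (fun x => ((u x < c)%R)%:R).
Proof.
move=> cl H0 u1 Hu; have [lin lim] := cl.
pose e (n : nat) x := n%:R ^+ 2 * (u x - c) + n%:R : R.
apply: (lim (fun n x => expR (- expR (e n x))) _ 1).
- move=> n; pose v x := expR (n%:R ^+ 2 * u x).
  have -> : (fun x => expR (- expR (e n x))) =
      (fun x => expR (- expR (n%:R - n%:R ^+ 2 * c) * v x)).
    apply/funext => x; rewrite /v mulNr -expRD; congr (expR (- expR _)).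
    by rewrite /e; ring.
  apply: (@bounded_closed_exp H v (expR (n%:R ^+ 2))) => //.
    move=> x sx; rewrite /v ger0_norm ?expR_ge0// ler_expR ler_piMr//.
    exact: le_trans (ler_norm _) (u1 x sx).
  move=> m; have -> : (fun x => v x ^+ m) = (fun x => expR ((m%:R * n%:R ^+ 2) * u x)).
    by apply/funext => x; rewrite /v -expRM_natl; congr expR; rewrite mulrA.
  exact: (@bounded_closed_exp H u 1).
- by move=> n x _; rewrite ger0_norm ?expR_ge0// -[leRHS]expR0 ler_expR oppr_le0 expR_ge0.
move=> x sx; apply/cvgrPdist_le => d d0.
have inv (n : nat) : expR (- (n%:R : R)) <= n.+1%:R^-1.
  rewrite expRN lef_pV2 ?posrE ?expR_gt0// -natr1 addrC; exact: expR_ge1Dx.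
have [uc|cu] := ltP (u x) c.
  near=> n; rewrite ger0_norm ?subr_ge0; last first.
    by rewrite -[leRHS]expR0 ler_expR oppr_le0 expR_ge0.
  have h1 := expR_ge1Dx (- expR (e n x)).
  have en : e n x <= - n%:R.
    have big : 2 <= n%:R * (c - u x).
      rewrite -ler_pdivrMr ?subr_gt0//; near: n; exact: nbhs_infty_ger.
    rewrite /e; have := ler_wpM2l (ler0n R n) big; rewrite expr2; lra.
  have h2 : expR (e n x) <= n.+1%:R^-1 by apply: le_trans (inv n); rewrite ler_expR.
  have h3 : n.+1%:R^-1 <= d by apply: ltW; near: n; exact: near_infty_natSinv_lt (PosNum d0).
  by apply: le_trans h3; apply: le_trans h2; rewrite mulr1n lerBlDr -lerBlDl.
near=> n; rewrite sub0r normrN ger0_norm ?expR_ge0//.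
have en : n%:R <= expR (e n x).
  have e1 : n%:R <= e n x by rewrite /e lerDr mulr_ge0 ?sqr_ge0 ?subr_ge0.
  by apply: le_trans e1 _; apply: le_trans (expR_ge1Dx _); rewrite lerDr.
apply: (@le_trans _ _ (expR (- n%:R))); first by rewrite ler_expR lerN2.
by apply: le_trans (inv n) _; apply: ltW; near: n; exact: near_infty_natSinv_lt (PosNum d0).
Unshelve. all: by end_near.
Qed.

End BoundedClosure.

Section Annihilator.
Variables (R : realType) (f : plane R -> R).
Notation mu := (@leb2 R).
Notation sq := (@unit_square R).
Hypothesis f_int : mu.-integrable sq (EFin \o f).

Definition annih (h : plane R -> R) : Prop :=
  [/\ measurable_fun sq h, exists B, forall x, sq x -> `|h x| <= B &
      Rintegral mu sq (fun x => f x * h x) = 0].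

Let ms := @measurable_square R.

Lemma annih_eq h g : annih h -> h =1 g -> annih g.
Proof. by move=> hh /funext <-. Qed.

Lemma annih_int h : annih h -> mu.-integrable sq (EFin \o (fun x => f x * h x)).
Proof. by move=> [mh [B hB] _]; exact: integrableM_fun mh hB f_int. Qed.

(** Bounded limits are handled by dominated convergence, with [B |f|] as dominating
function. *)
Lemma annih_bounded_closed : bounded_closed annih.
Proof.
split=> [a h g Hh Hg|h_ h B Hh hB hl].
  have [mh [B hB] ih] := Hh; have [mg [C hC] ig] := Hg; split.
  - by apply: measurable_funD => //; apply: measurable_funM.
  - exists (`|a| * B + C) => x sx; apply: le_trans (ler_normD _ _) _.
    by rewrite lerD ?hC// normrM ler_wpM2l// hB.
  - rewrite (_ : (fun x => _) = (fun x => a * (f x * h x) + f x * g x)); last first.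
      by apply/funext => x; ring.
    have i1 := annih_int Hh; have i2 := annih_int Hg.
    rewrite RintegralD//; last exact: (integrableZl ms a i1).
    by rewrite RintegralZl// ih ig mulr0 addr0.
have mh : measurable_fun sq h.
  by apply: (measurable_fun_cvg (h := h_)) => // n; case: (Hh n).
have Bh x : sq x -> `|h x| <= B.
  move=> sx; have hx : `|h_ n x| @[n --> \oo] --> `|h x| by apply: cvg_norm; exact: hl.
  by apply: (cvgr_to_le hx); apply: nearW => n; exact: hB.
split => //; first by exists B.
pose g x := (`|f x| * B)%:E.
have ig : mu.-integrable sq g.
  apply: (integrableM_fun (f := fun x => `|f x|) (g := fun=> B) (B := `|B|)) => //.
  exact: integrable_norm.
have cf : {ae mu, forall x, sq x ->
    (fun n => (f x * h_ n x)%:E) n @[n --> \oo] --> (f x * h x)%:E}.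
  apply: aeW => x sx; apply: cvg_EFin; first exact: nearW.
  by apply: cvgM; [exact: cvg_cst|exact: hl].
have df : {ae mu, forall x n, sq x -> (`|(f x * h_ n x)%:E| <= g x)%E}.
  by apply: aeW => x n sx; rewrite abse_EFin lee_fin normrM ler_wpM2l// hB.
have [_ _ H] := dominated_convergence ms
  (fun n => measurable_int _ (annih_int (Hh n)))
  (measurable_int _ (integrableM_fun mh Bh f_int)) cf ig df.
have lim0 : (\int[mu]_(x in sq) (f x * h x)%:E = 0)%E ->
    Rintegral mu sq (fun x => f x * h x) = 0 by rewrite /Rintegral => ->.
have int0 n : (\int[mu]_(x in sq) (f x * h_ n x)%:E = 0)%E.
  have [_ _] := Hh n; rewrite /Rintegral => /eqP.
  rewrite fine_eq0; last exact: integrable_fin_num (annih_int (Hh n)).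
  by move/eqP.
apply: lim0; apply/esym; apply: (cvg_unique _ _ H); first exact: ereal_hausdorff.
rewrite (_ : [sequence _]_n = cst 0%E); first exact: cvg_cst.
by apply/funext => n /=; exact: int0.
Qed.

Lemma annih_ae (h g : plane R -> R) : annih h -> measurable_fun sq g ->
  {ae mu, forall x, sq x -> h x = g x} ->
  (exists B, forall x, sq x -> `|g x| <= B) -> annih g.
Proof.
move=> [mh Bh ih] mg hg Bg; split => //; rewrite -ih /Rintegral; congr fine.
have mf := measurable_int _ f_int.
apply: ae_eq_integral => //.
- by apply/measurable_EFinP; apply: measurable_funM => //; apply/measurable_EFinP.
- by apply/measurable_EFinP; apply: measurable_funM => //; apply/measurable_EFinP.
- by apply: filterS hg => x hx sx /=; rewrite hx.
Qed.

Definition null_on (E : set (plane R)) : Prop := measurable E /\ annih (\1_E).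

Lemma annih0 : annih (fun=> 0).
Proof.
split; [exact: measurable_cst|by exists 0 => x _; rewrite normr0|].
by under eq_Rintegral do rewrite mulr0; rewrite /Rintegral integral0.
Qed.

Lemma indic_setD (T : Type) (A B : set T) : B `<=` A ->
  \1_(A `\` B) = (fun x => -1 * \1_B x + \1_A x) :> (T -> R).
Proof.
move=> BA; apply/funext => x; rewrite !indicE.
have [xB|xB] := boolP (x \in B).
  have xA : x \in A by move: xB; rewrite !inE; exact: BA.
  by rewrite xA [x \in _ `\` _]in_setD xA xB /= mulr1 addNr.
by rewrite in_setD xB andbT mulr0 add0r.
Qed.

(** The sets in question form a Dynkin system: complements in [W] come from linearity
and countable disjoint unions from bounded limits. The projection [p] allows one
coordinate to be treated at a time. *)
Lemma dynkin_null d (T : measurableType d) (p : plane R -> T) (W : set (plane R))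
    (G : set (set T)) : measurable_fun setT p -> null_on W ->
  @measurable _ T = <<s G >> -> setI_closed G ->
  (forall A, G A -> null_on (W `&` p @^-1` A)) ->
  forall A, measurable A -> null_on (W `&` p @^-1` A).
Proof.
move=> mp [mW nW] mG GI GN A mA.
have mpre B : measurable B -> measurable (W `&` p @^-1` B).
  by move=> mB; apply: measurableI => //; rewrite -[X in measurable X]setTI; exact: mp.
have [lin lim] := annih_bounded_closed.
have : <<s G >> A by rewrite -mG.
apply: (dynkin_induction (P := fun A => null_on (W `&` p @^-1` A))) => //.
- by rewrite preimage_setT setIT.
- move=> S mS [_ nS]; split; first by apply: mpre; exact: measurableC.
  rewrite (_ : W `&` _ = W `\` (W `&` p @^-1` S)); last first.
    apply/seteqP; split=> x [Wx nSx]; split => //; first by move=> [_].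
    by move=> Sx; apply: nSx; split.
  by rewrite indic_setD; [exact: lin|exact: subIsetl].
- move=> F mF tF nF; split; first by apply: mpre; exact: bigcupT_measurable.
  pose E i := W `&` p @^-1` F i.
  pose h_ n x : R := \sum_(i <- index_iota 0 n) 1 * \1_(E i) x.
  have val j x n : E j x -> h_ n x = (j < n)%N%:R.
    move=> [Wx Fx]; rewrite /h_; transitivity (\sum_(0 <= i < n) (if i == j then 1 else 0 : R)).
      apply: eq_bigr => i _; rewrite mul1r indicE; case: eqVneq => [->|ij].
        by rewrite mem_set.
      rewrite memNset// => -[_ Fi]; move/eqP: ij; apply.
      by apply: tF => //; exists (p x).
    by rewrite -big_mkcond/= big_nat1_eq; case: ltnP.
  have val0 x n : (forall j, ~ E j x) -> h_ n x = 0.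
    move=> nE; rewrite /h_ big1// => i _; rewrite indicE memNset ?mulr0//; exact: nE.
  apply: (lim h_ _ 1).
  + move=> n; apply: (bounded_closed_sum _ (fun=> 1) (h := fun i => \1_(E i))
      annih_bounded_closed annih0) => k; by case: (nF k).
  + move=> n x _; have [[j Ej]|nE] := pselect (exists j, E j x).
      by rewrite (val j)// normr_nat; case: (_ < _)%N.
    by rewrite val0 ?normr0// => j Ej; apply: nE; exists j.
  + move=> x _; rewrite indicE; have [[j Ej]|nE] := pselect (exists j, E j x).
      rewrite mem_set; last by case: Ej => ? ?; split => //; exists j.
      apply: cvg_near_cst; exists j.+1 => // n /= jn.
      by rewrite (val j)// jn.
    rewrite memNset; last by move=> [Wx [j _ Fj]]; apply: nE; exists j; split.
    apply: cvg_near_cst; apply: nearW => n; rewrite val0// => j Ej; apply: nE.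
    by exists j.
Qed.

Hypothesis f_char : forall k, annih (fun x => Re (character2 k x)) /\
                              annih (fun x => Im (character2 k x)).

(** Asking for the products with all characters makes the class stable under
multiplication by real and imaginary parts of characters. *)
Let trig h := forall k, annih (fun x => h x * Re (character2 k x)) /\
                        annih (fun x => h x * Im (character2 k x)).

Let annih_lin a b h g : annih h -> annih g -> annih (fun x => a * h x + b * g x).
Proof.
move=> hh hg; have [lin _] := annih_bounded_closed; apply: (lin a h _ hh).
by apply: (annih_eq (lin b g (fun=> 0) hg annih0)) => x; rewrite addr0.
Qed.

Let trig1 : trig (fun=> 1).
Proof. by move=> k; under eq_fun do rewrite mul1r; under [X in _ /\ annih X]eq_fun do rewrite mul1r; exact: f_char. Qed.

Let trig_mul h l (a b : R) : trig h -> trig (fun x =>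
  h x * (a * Re (character2 l x) + b * Im (character2 l x))).
Proof.
move=> th k; have [h1 h2] := th (k + l); have [h3 h4] := th (k - l).
have e1 x : character2 (k + l) x = character2 k x * character2 l x :> R[i].
  by rewrite character2D.
have e2 x : character2 (k - l) x = character2 k x * (character2 l x)^*%C :> R[i].
  by rewrite character2J character2D.
split.
- apply: annih_eq (annih_lin 1 1 (annih_lin (a / 2) (b / 2) h1 h2)
    (annih_lin (a / 2) (- b / 2) h3 h4)) _ => x; rewrite e1 e2 !ReM !ImM ReJ ImJ; by field.
- apply: annih_eq (annih_lin 1 1 (annih_lin (a / 2) (- b / 2) h2 h1)
    (annih_lin (a / 2) (b / 2) h4 h3)) _ => x; rewrite e1 e2 !ReM !ImM ReJ ImJ; by field.
Qed.

Let annih_trig h : trig h -> annih h.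
Proof.
move=> /(_ 0)[h0 _]; apply: (annih_eq h0) => x.
by rewrite character2_0 mulr1.
Qed.

Let U m (x : plane R) : R := - cos (2 * pi * (x.1 - m)).
Let V m (x : plane R) : R := - cos (2 * pi * (x.2 - m)).

Let trig_UV m l i j : trig (fun x => U m x ^+ i * V l x ^+ j).
Proof.
have UE x : U m x = - cos (2 * pi * m) * Re (character2 (1, 0) x)
    + - sin (2 * pi * m) * Im (character2 (1, 0) x).
  by rewrite /U /= mulr0 addr0 mulr1 mulrBr cosB; ring.
have VE x : V l x = - cos (2 * pi * l) * Re (character2 (0, 1) x)
    + - sin (2 * pi * l) * Im (character2 (0, 1) x).
  by rewrite /V /= mulr0 add0r mulr1 mulrBr cosB; ring.
elim: j => [|j IH].
  elim: i => [|i IH].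
    by rewrite (_ : (fun x => _) = fun=> 1)//; apply/funext => x; rewrite !expr0 mulr1.
  have := trig_mul (1, 0) (- cos (2 * pi * m)) (- sin (2 * pi * m)) IH; congr trig.
  by apply/funext => x; rewrite -UE !expr0 !mulr1 exprSr.
have := trig_mul (0, 1) (- cos (2 * pi * l)) (- sin (2 * pi * l)) IH; congr trig.
by apply/funext => x; rewrite -VE exprSr mulrA.
Qed.

Let mul_bounded_closed (g : plane R -> R) : measurable_fun sq g ->
  (exists B, forall x, sq x -> `|g x| <= B) ->
  bounded_closed (fun h => annih (fun x => h x * g x)).
Proof.
have [lin lim] := annih_bounded_closed.
move=> mg [B hB]; split=> [a h k hh hk|h_ h C hh hC hl].
  by apply: (annih_eq (lin a _ _ hh hk)) => x; ring.
apply: (lim _ _ (C * B) hh) => [n x sx|x sx].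
  by rewrite normrM ler_pM// ?hC ?hB.
by apply: cvgM; [exact: hl|exact: cvg_cst].
Qed.

Let U1 m x : `|U m x| <= 1. Proof. by rewrite normrN cos_max. Qed.
Let V1 m x : `|V m x| <= 1. Proof. by rewrite normrN cos_max. Qed.

Let mcos (g : plane R -> R) m : measurable_fun setT g ->
  measurable_fun sq (fun x => - cos (2 * pi * (g x - m))).
Proof.
move=> mg; apply: measurable_funTS; apply: measurable_funN.
apply: (measurableT_comp (f := cos)).
  by apply: continuous_measurable_fun; exact: continuous_cos.
by apply: measurable_funM => //; apply: measurable_funB.
Qed.

Let level_set m c l d : annih (fun x => ((U m x < c)%R)%:R * ((V l x < d)%R)%:R).
Proof.
have mU : measurable_fun sq (U m) by exact: mcos measurable_fst.
have mV : measurable_fun sq (V l) by exact: mcos measurable_snd.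
have mlev (u : plane R -> R) e : measurable_fun sq u ->
    measurable_fun sq (fun x => ((u x < e)%R)%:R : R).
  move=> mu; rewrite (_ : (fun x => _) = (fun x => if u x < e then 1 else 0)).
    by apply: measurable_fun_if => //; apply: measurable_fun_ltr.
  by apply/funext => x; case: ifP.
have step1 j : annih (fun x => ((U m x < c)%R)%:R * V l x ^+ j).
  apply: (@bounded_closed_level R (fun h => annih (fun x => h x * V l x ^+ j))) => //.
  - apply: mul_bounded_closed; first exact: measurable_funX.
    by exists 1 => x _; rewrite normrX exprn_ile1.
  - by under eq_fun do rewrite mul0r; exact: annih0.
  - by move=> n; apply: annih_trig; exact: trig_UV.
have := @bounded_closed_level R (fun h => annih (fun x => h x * ((U m x < c)%R)%:R)) (V l) d.
move=> H; under eq_fun do rewrite mulrC; apply: H => //.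
- apply: mul_bounded_closed; first exact: mlev.
  by exists 1 => x _; rewrite normr_nat; case: (_ < _).
- by under eq_fun do rewrite mul0r; exact: annih0.
- by move=> n; under eq_fun do rewrite mulrC.
Qed.

(** An open subinterval of [0,1] is the part of [0,1] where the distance to its
centre modulo 1 is small, that is, a sublevel set of minus a cosine. *)
Let itv_level (a b x : R) : 0 <= a -> a < b -> b <= 1 -> 0 <= x <= 1 ->
  (a < x < b) = (- cos (2 * pi * (x - (a + b) / 2)) < - cos (pi * (b - a))).
Proof.
move=> a0 ab b1 /andP[x0 x1]; rewrite ltrN2.
have pi0 : 0 < (pi : R) := pi_gt0 R.
pose y := `|x - (a + b) / 2|.
have -> : cos (2 * pi * (x - (a + b) / 2)) = cos (2 * pi * y).
  by rewrite /y; case: (ger0P (x - (a + b) / 2)) => // _; rewrite mulrN cosN.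
have -> : (a < x < b) = (2 * y < b - a).
  by rewrite -ltr_pdivlMl// /y ltr_norml; apply/andP/andP => -[? ?]; split; lra.
have y0 : 0 <= y by exact: normr_ge0.
have y1 : 2 * y <= 2 - (b - a).
  by rewrite -ler_pdivlMl// /y ler_norml; apply/andP; split; lra.
have pab : pi * (b - a) \in `[0, pi]%R.
  by rewrite in_itv/= mulr_ge0 ?(ltW pi0) ?subr_ge0 ?(ltW ab)//= ler_piMr ?(ltW pi0)//; lra.
have [yh|yh] := leP (2 * y) 1.
  have yin : 2 * pi * y \in `[0, pi]%R.
    rewrite in_itv/= (mulrC 2) -mulrA mulr_ge0 ?(ltW pi0) ?mulr_ge0//=.
    by rewrite ler_piMr ?(ltW pi0).
  rewrite ltr_cos//; have -> : 2 * pi * y = pi * (2 * y) by ring.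
  by rewrite ltr_pM2l.
have -> : cos (2 * pi * y) = cos (pi * (2 - 2 * y)).
  rewrite -[RHS]cosN -(periodicn (@cosD2pi R) 1 (- _)); congr cos.
  by rewrite mulr1n -mulr_natl; ring.
have yin : pi * (2 - 2 * y) \in `[0, pi]%R.
  rewrite in_itv/= mulr_ge0 ?(ltW pi0)//=; last by lra.
  by rewrite ler_piMr ?(ltW pi0)//; lra.
rewrite ltr_cos// ltr_pM2l//; apply/idP/idP => h; lra.
Qed.

Let inner_rectangle a b c d : 0 <= a -> b <= 1 -> 0 <= c -> d <= 1 ->
  annih (\1_(`]a, b[ `*` `]c, d[ : set (plane R))).
Proof.
move=> a0 b1 c0 d1; have mB : measurable (`]a, b[ `*` `]c, d[ : set (plane R)).
  by apply: measurableX; exact: measurable_itv.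
have zero : `]a, b[ `*` `]c, d[ = set0 :> set (plane R) ->
    annih (\1_(`]a, b[ `*` `]c, d[ : set (plane R))).
  by move=> ->; rewrite indic0; exact: annih0.
have [ba|ab] := leP b a.
  apply: zero; apply/seteqP; split => // x [/= + _]; rewrite in_itv/= => /andP[h1 h2].
  by have := lt_trans h1 h2; rewrite ltNge ba.
have [dc|cd] := leP d c.
  apply: zero; apply/seteqP; split => // x [/= _]; rewrite in_itv/= => /andP[h1 h2].
  by have := lt_trans h1 h2; rewrite ltNge dc.
apply: (annih_ae (level_set ((a + b) / 2) (- cos (pi * (b - a)))
    ((c + d) / 2) (- cos (pi * (d - c))))).
- exact: measurable_indic.
- apply: aeW => x [x1 x2]; rewrite /U /V -itv_level// -itv_level// indicE.
  rewrite -natrM mulnb; congr (nat_of_bool _)%:R; apply/idP/idP => h.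
    by apply/mem_set; case/andP: h => h1 h2; split; rewrite /= in_itv.
  by move/set_mem: h => -[/=]; rewrite !in_itv/= => -> ->.
- by exists 1 => x _; rewrite indicE normr_nat; case: (_ \in _).
Qed.

Let ae_coord1 a : {ae mu, forall x, sq x -> x.1 != a}.
Proof.
exists ([set a] `*` setT); split.
- by apply: measurableX; [exact: measurable_set1|exact: measurableT].
- apply: etrans (product_measure1E _ _ _ _) _; [exact: measurable_set1|exact: measurableT|].
  by rewrite [X in (X * _)%E](lebesgue_measure_set1 a) mul0e.
- by move=> x /= /not_implyP[_ /negP]; rewrite negbK => /eqP.
Qed.

Let ae_coord2 a : {ae mu, forall x, sq x -> x.2 != a}.
Proof.
exists (setT `*` [set a]); split.
- by apply: measurableX; [exact: measurableT|exact: measurable_set1].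
- apply: etrans (product_measure1E _ _ _ _) _; [exact: measurableT|exact: measurable_set1|].
  by rewrite [X in (_ * X)%E](lebesgue_measure_set1 a) mule0.
- by move=> x /= /not_implyP[_ /negP]; rewrite negbK => /eqP.
Qed.

Let indic1 (E : set (plane R)) : exists B, forall x, sq x -> `|\1_E x : R| <= B.
Proof. by exists 1 => x _; rewrite indicE normr_nat; case: (_ \in _). Qed.

Let indic_iff (E E' : set (plane R)) x : (E x <-> E' x) -> \1_E x = \1_E' x :> R.
Proof. by move=> EE; rewrite !indicE; congr (nat_of_bool _)%:R; apply/idP/idP; rewrite !inE => /EE. Qed.

Let open_rectangle a b c d : null_on (`]a, b[ `*` `]c, d[).
Proof.
have mB : measurable (`]a, b[ `*` `]c, d[ : set (plane R)).
  by apply: measurableX; exact: measurable_itv.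
split => //; have := @inner_rectangle (Num.max a 0) (Num.min b 1) (Num.max c 0) (Num.min d 1).
rewrite !le_max !ge_min !lexx !orbT => /(_ isT isT isT isT) h.
apply: (annih_ae h _ _ (indic1 _)); first exact: measurable_indic.
apply: filterS2 (filterI (ae_coord1 0) (ae_coord1 1))
  (filterI (ae_coord2 0) (ae_coord2 1)) => x [n1 n2] [n3 n4] sx.
have [/andP[x0 x1] /andP[y0 y1]] := sx; move: (n1 sx) (n2 sx) (n3 sx) (n4 sx) => {}n1 {}n2 {}n3 {}n4.
apply: indic_iff; rewrite /= !in_itv/= !gt_max !lt_min.
by rewrite ![0 < _]lt_neqAle ![_ < 1]lt_neqAle x0 x1 y0 y1 n2 n4 ![0 == _]eq_sym n1 n3 !andbT.
Qed.

Let opens_setI : setI_closed (@RGenOpens.G R).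
Proof.
move=> _ _ [a [b ->]] [c [d ->]]; exists (Num.max a c), (Num.min b d).
apply/seteqP; split => x /=; rewrite !in_itv/= gt_max lt_min.
  by move=> [/andP[-> ->] /andP[-> ->]].
by move=> /andP[/andP[-> ->] /andP[-> ->]].
Qed.

Let null_on_eq (E E' : set (plane R)) : null_on E -> measurable E' ->
  (forall x, sq x -> (E x <-> E' x)) -> null_on E'.
Proof.
move=> [mE nE] mE' EE; split => //; apply: (annih_ae nE _ _ (indic1 _)); first exact: measurable_indic.
by apply: aeW => x sx; apply: indic_iff; exact: EE.
Qed.

Let strip1 (A : set (measurableTypeR R)) c d : measurable A ->
  null_on (A `*` `]c, d[).
Proof.
move=> mA; have mW : measurable (setT `*` `]c, d[ : set (plane R)).
  by apply: measurableX; [exact: measurableT|exact: measurable_itv].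
have nW : null_on (setT `*` `]c, d[).
  apply: null_on_eq (open_rectangle (-1) 2 c d) mW _ => x [/andP[x0 x1] _] /=.
  by rewrite !in_itv/= (lt_le_trans _ x0) ?ltrN10// (le_lt_trans x1) ?ltr1n//; split => -[].
have := dynkin_null (measurable_fst) nW (RGenOpens.measurableE R) opens_setI _ mA.
rewrite (_ : _ `&` _ = A `*` `]c, d[); last first.
  by apply/seteqP; split => x /=; [move=> [[_ ?] ?]|move=> [? ?]]; split.
apply=> _ [a [b ->]].
rewrite (_ : _ `&` _ = `]a, b[ `*` `]c, d[); last first.
  by apply/seteqP; split => x /=; [move=> [[_ ?] ?]|move=> [? ?]]; split.
exact: open_rectangle.
Qed.

Let measurable_rectangle (A B : set (measurableTypeR R)) : measurable A -> measurable B ->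
  null_on (A `*` B).
Proof.
move=> mA mB; have mW : measurable (A `*` setT : set (plane R)).
  by apply: measurableX; [|exact: measurableT].
have nW : null_on (A `*` setT).
  apply: null_on_eq (strip1 (-1) 2 mA) mW _ => x [_ /andP[x0 x1]] /=.
  by rewrite !in_itv/= (lt_le_trans _ x0) ?ltrN10// (le_lt_trans x1) ?ltr1n//; split => -[].
have := dynkin_null (measurable_snd) nW (RGenOpens.measurableE R) opens_setI _ mB.
rewrite (_ : _ `&` _ = A `*` B); last first.
  by apply/seteqP; split => x /=; [move=> [[? _] ?]|move=> [? ?]]; split.
apply=> _ [c [d ->]].
rewrite (_ : _ `&` _ = A `*` `]c, d[); last first.
  by apply/seteqP; split => x /=; [move=> [[? _] ?]|move=> [? ?]]; split.
exact: strip1.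
Qed.

Lemma null_on_measurable E : measurable E -> null_on E.
Proof.
move=> mE; have nT : null_on setT.
  rewrite -setXTT; apply: measurable_rectangle; exact: measurableT.
have := @dynkin_null _ (plane R) id setT [set A `*` B | A in measurable & B in measurable]
  (@measurable_id _ _ setT) nT (measurable_prod_measurableType _ _) _ _ E mE.
rewrite setTI; apply.
  move=> _ _ [A1 mA1 [A2 mA2 <-]] [B1 mB1 [B2 mB2 <-]].
  exists (A1 `&` B1); first exact: measurableI.
  by exists (A2 `&` B2); [exact: measurableI|rewrite setXI].
by move=> _ [A mA [B mB <-]]; rewrite setTI; exact: measurable_rectangle.
Qed.

(** A function that integrates to zero over every measurable set is zero almost
everywhere. *)
Lemma annihilator_ae0 : {ae mu, forall x, sq x -> f x = 0}.
Proof.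
suff ae0 : ae_eq mu sq (EFin \o f) (cst 0%E).
  by apply: filterS ae0 => x h sx; have := h sx => /= -[].
apply: (integral_ae_eq ms f_int (measurable_cst _)) => E Esq mE.
rewrite integral0 -(setIidr Esq) integral_mkcondr.
have [_ [mh [B hB] ih]] := null_on_measurable mE.
have hi := annih_int (And3 mh (ex_intro _ B hB) ih).
move: ih => /eqP; rewrite /Rintegral fine_eq0 ?(integrable_fin_num _ hi)// => /eqP ih.
rewrite -[RHS]ih; apply: eq_integral => x _; rewrite patchE /= indicE.
by case: ifPn => xE; rewrite ?mulr1 ?mulr0.
Qed.

End Annihilator.

Section FourierUniqueness.
Variable R : realType.
Notation mu := (@leb2 R).
Notation sq := (@unit_square R).

(** The coefficients of [f] at [k] and [- k] give the integrals of [f] against the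
real and imaginary parts of the characters, and then those of [Re f] and [Im f]. *)
Lemma fourier_unique (f : plane R -> R[i]) : cintegrable f ->
  (forall k, fourier f k = 0) -> {ae mu, forall x, sq x -> f x = 0}.
Proof.
move=> fi f0; have ch k := @tbounded_character2 R k.
have fe (a b : R[i]) k : torus_integral (fun x => f x * (a * character2 k x +
    b * character2 (- k) x)) = 0.
  rewrite (_ : (fun x => _) = (fun x => a * (f x * character2 k x) +
     b * (f x * character2 (- k) x))); last by apply/funext => x; ring.
  have i1 := cintegrableM fi (ch k); have i2 := cintegrableM fi (ch (- k)).
  have cz z g : cintegrable g -> cintegrable (fun x => z * g x).
    move=> gi; under eq_fun do rewrite mulrC.
    by apply: cintegrableM => //; exact: tbounded_cst.
  rewrite torus_integralD; [|exact: cz..].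
  rewrite !torus_integralZ// [torus_integral (fun x => f x * character2 k x)]f0.
  by rewrite [torus_integral (fun x => f x * character2 (- k) x)]f0 !mulr0 addr0.
have fcos k : torus_integral (fun x => f x * (Re (character2 k x))%:C%C) = 0.
  rewrite -(fe (2^-1)%:C%C (2^-1)%:C%C k); congr torus_integral; apply/funext => x.
  congr (_ * _); rewrite -character2J.
  by apply: complex_ext; rewrite ?ReD ?ImD ?ReZ ?ImZ ?ReJ ?ImJ /=; field.
have fsin k : torus_integral (fun x => f x * (Im (character2 k x))%:C%C) = 0.
  rewrite -(fe (0 -i* 2^-1)%C (0 +i* 2^-1)%C k); congr torus_integral; apply/funext => x.
  congr (_ * _); rewrite -character2J.
  by apply: complex_ext; rewrite ?ReD ?ImD ?ReM ?ImM ?ReJ ?ImJ /=; field.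
have annihE (h g : plane R -> R) :
   mu.-integrable sq (EFin \o h) -> measurable_fun sq g -> (forall x, `|g x| <= 1) ->
   Rintegral mu sq (fun x => h x * g x) = 0 -> annih h g.
  by move=> hi mg g1 hg; split => //; exists 1.
have [fi1 fi2] := fi.
have cos1 k x : `|Re (character2 k x) : R| <= 1 by rewrite cos_max.
have sin1 k x : `|Im (character2 k x) : R| <= 1 by rewrite sin_max.
have fchar1 k : annih (fun x => Re (f x)) (fun x => Re (character2 k x)) /\
    annih (fun x => Re (f x)) (fun x => Im (character2 k x)).
  have [mc ms] := @measurable_character2 R k.
  split; apply: annihE => //.
    have := congr1 (fun z => Re z) (fcos k); rewrite /= => <-; apply: eq_Rintegral => x _.
    by rewrite ReM /= mulr0 subr0.
  have := congr1 (fun z => Re z) (fsin k); rewrite /= => <-; apply: eq_Rintegral => x _.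
  by rewrite ReM /= mulr0 subr0.
have fchar2 k : annih (fun x => Im (f x)) (fun x => Re (character2 k x)) /\
    annih (fun x => Im (f x)) (fun x => Im (character2 k x)).
  have [mc ms] := @measurable_character2 R k.
  split; apply: annihE => //.
    have := congr1 (fun z => Im z) (fcos k); rewrite /= => <-; apply: eq_Rintegral => x _.
    by rewrite ImM /= mulr0 add0r.
  have := congr1 (fun z => Im z) (fsin k); rewrite /= => <-; apply: eq_Rintegral => x _.
  by rewrite ImM /= mulr0 add0r.
apply: filterS2 (annihilator_ae0 fi1 fchar1) (annihilator_ae0 fi2 fchar2) => x h1 h2 sx.
by apply: complex_ext; rewrite ?h1 ?h2.
Qed.

Lemma fourierB (f g : plane R -> R[i]) k : cintegrable f -> cintegrable g ->
  fourier (fun x => f x - g x) k = fourier f k - fourier g k.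
Proof.
move=> hf hg; rewrite /fourier; have ch := @tbounded_character2 R k.
rewrite -torus_integralB; [|exact: cintegrableM..].
by congr torus_integral; apply/funext => x; rewrite mulrBl.
Qed.

Lemma cintegrableB (f g : plane R -> R[i]) : cintegrable f -> cintegrable g ->
  cintegrable (fun x => f x - g x).
Proof.
move=> hf hg; have := cintegrableM hg (tbounded_cst (-1)).
move/(cintegrableD hf); congr cintegrable; apply/funext => x; ring.
Qed.

Lemma fourier_inj (f g : plane R -> R[i]) : cintegrable f -> cintegrable g ->
  (forall k, fourier f k = fourier g k) -> torus_ae_eq f g.
Proof.
move=> hf hg fg; have ae0 := fourier_unique (cintegrableB hf hg) (fun k => etrans (fourierB k hf hg) (etrans (congr1 (fun z => z - _) (fg k)) (subrr _))).
by apply: filterS ae0 => x h sx; apply/eqP; rewrite -subr_eq0; apply/eqP/h.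
Qed.

Lemma fourier_ae (f g : plane R -> R[i]) k : cmeasurable f -> cmeasurable g ->
  torus_ae_eq f g -> fourier f k = fourier g k.
Proof.
move=> mf mg fg; have [mch _] := @tbounded_character2 R k.
apply: torus_integral_ae; [exact: cmeasurableM..|].
by apply: filterS fg => x h sx; rewrite h.
Qed.

End FourierUniqueness.

(** * Centred squares of the lattice *)

Definition box (n : nat) : seq lattice :=
  let r := [seq Posz m - n%:Z | m <- iota 0 (2 * n).+1] in [seq (i, j) | i <- r, j <- r].

Arguments box : simpl never.

Lemma box_uniq n : uniq (box n).
Proof.
have u : uniq [seq Posz m - n%:Z | m <- iota 0 (2 * n).+1].
  rewrite map_inj_uniq ?iota_uniq// => a b /addIr; by case.
by apply: allpairs_uniq => // -[a b] [c d].
Qed.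

Lemma mem_box n k : (k \in box n) = (Num.max `|k.1| `|k.2| <= n%:Z).
Proof.
have h (a : int) : (a \in [seq Posz m - n%:Z | m <- iota 0 (2 * n).+1]) = (`|a| <= n%:Z).
  apply/mapP/idP => [[m + ->]|an].
    rewrite mem_iota add0n /= => mn; rewrite ler_norml; lia.
  exists (absz (a + n%:Z)); last by move: an; rewrite ler_norml; lia.
  by rewrite mem_iota add0n /=; move: an; rewrite ler_norml; lia.
rewrite ge_max; apply/allpairsP/andP => [[[a b] /= [ha hb ->]]|[k1 k2]].
  by rewrite -!h.
by exists k; split; rewrite ?h//; case: k {k1 k2}.
Qed.

Lemma sub_box n m : (n <= m)%N -> {subset box n <= box m}.
Proof. by move=> nm k; rewrite !mem_box => /le_trans; apply; rewrite lez_nat. Qed.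

Lemma seq_sub_box (A : seq lattice) : exists n, {subset A <= box n}.
Proof.
elim: A => [|k A [n An]]; first by exists 0%N.
exists (maxn n (maxn (absz k.1) (absz k.2))) => j; rewrite inE => /predU1P[->|/An].
  by rewrite mem_box ge_max -!abszE !lez_nat !leq_max !leqnn !orbT.
by apply: sub_box; rewrite leq_maxl.
Qed.

(** * Synthesis of a function from summable Fourier coefficients *)

Section Synthesis.
Variable R : realType.
Notation sq := (@unit_square R).
Implicit Types (c d : lattice -> R[i]) (x : R * R).

Definition one_weight (k : lattice) : R := 1.

Definition l1 c : Prop := wl1 one_weight c.

Lemma one_weight_ge0 k : 0 <= one_weight k. Proof. exact: ler01. Qed.

Definition truncation n c k : R[i] := if k \in box n then c k else 0.

(** The size of the l^1 remainder controls the uniform convergence of the square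
partial sums. *)
Definition tail n c : R := wnorm one_weight (fun k => c k - truncation n c k).

Lemma wbounded_box (w : lattice -> R) n c : (forall k, 0 <= w k) ->
  (forall k, k \notin box n -> c k = 0) -> wbounded w c (wsum w c (box n)).
Proof.
move=> w0 hc A uA; rewrite /wsum (bigID (mem (box n)))/= [X in _ + X]big1 ?addr0; last first.
  by move=> j /hc ->; rewrite Normc.normc0 mulr0.
rewrite [leRHS](bigID (mem A))/= -[leLHS]addr0 lerD//; last first.
  by apply: sumr_ge0 => j _; rewrite mulr_ge0 ?normc_ge0.
have pe : perm_eq [seq j <- A | j \in box n] [seq j <- box n | j \in A].
  apply: uniq_perm; rewrite ?filter_uniq ?box_uniq// => j.
  by rewrite !mem_filter andbC.
by rewrite -[leLHS]big_filter -[leRHS]big_filter (perm_big _ pe).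
Qed.

Lemma tail_bounded n c : l1 c ->
  wbounded one_weight (fun k => c k - truncation n c k) (tail n c).
Proof.
move=> [B hB]; apply: wbounded_wnorm; exists B; apply: wbounded_dom hB; first exact: one_weight_ge0.
by move=> k; rewrite /truncation; case: ifP; rewrite ?subrr ?Normc.normc0 ?normc_ge0// subr0.
Qed.

(** A finite family carrying all but [e] of the norm lies in some box. *)
Lemma tail_small c e : l1 c -> 0 < e ->
  exists N, forall n, (N <= n)%N -> tail n c <= e.
Proof.
move=> lc e0; have [|_ [A uA ->] hA] := @sup_adherent _
    [set x | exists2 A, uniq A & x = wsum one_weight c A] e e0.
  split; first by exists 0, [::] => //; rewrite /wsum big_nil.
  by have [B hB] := lc; exists B => _ [A uA ->]; exact: hB.
have [N AN] := seq_sub_box A; exists N => n Nn; apply: wnorm_le => B uB.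
pose B' := [seq k <- B | k \notin box n].
have -> : wsum one_weight (fun k => c k - truncation n c k) B = wsum one_weight c B'.
  rewrite /wsum big_filter [RHS]big_mkcond /=; apply: eq_bigr => k _.
  by rewrite /truncation; case: ifP => _ /=; rewrite ?subr0// subrr Normc.normc0 mulr0.
have uAB : uniq (A ++ B').
  rewrite cat_uniq uA filter_uniq// andbT; apply/hasPn => k.
  rewrite mem_filter => /andP[kn _]; apply: contra kn => /AN.
  exact: sub_box.
have := wbounded_wnorm lc uAB; rewrite {1}/wsum big_cat/= -/(wsum _ _ _) -/(wsum _ _ _).
by move: hA; rewrite -/(wnorm one_weight c); set s1 := wsum _ _ A; set s2 := wsum _ _ B'; lra.
Qed.

Definition partial_sum n c x : R[i] := \sum_(k <- box n) c k * character2 (- k) x.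

(** The sum of the Fourier series, singled out among all complex numbers by the rate
of convergence of its partial sums. *)
Definition synthesis c x : R[i] :=
  xget 0 [set l | forall n, normc (l - partial_sum n c x) <= 2 * tail n c].

Lemma partial_sumE n m c x : (n <= m)%N -> partial_sum n c x =
  \sum_(k <- box m) truncation n c k * character2 (- k) x.
Proof.
move=> nm; rewrite [RHS](bigID (mem (box n)))/= [X in _ + X]big1 ?addr0; last first.
  by move=> k /negbTE kn; rewrite /truncation kn mul0r.
have pe : perm_eq [seq k <- box m | k \in box n] (box n).
  apply: uniq_perm; rewrite ?filter_uniq ?box_uniq// => k.
  by rewrite mem_filter; case kn : (k \in box n) => //=; rewrite (sub_box nm).
rewrite -big_filter (perm_big _ pe) /partial_sum /=.
by apply: eq_big_seq => k kn; rewrite /truncation kn.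
Qed.

Lemma normc_sum_character (A : seq lattice) c B x : uniq A ->
  wbounded one_weight c B -> normc (\sum_(k <- A) c k * character2 (- k) x) <= B.
Proof.
move=> uA hB; apply: le_trans (ler_normc_sum _ _ _) _; apply: le_trans (hB A uA).
by apply: ler_sum => k _; rewrite Normc.normcM normc_character2 mulr1 mul1r.
Qed.

Lemma synthesis_approx c n x : l1 c ->
  normc (synthesis c x - partial_sum n c x) <= 2 * tail n c.
Proof.
move=> lc; suff ex : exists l, forall n, normc (l - partial_sum n c x) <= 2 * tail n c.
  exact: (@xgetPex _ 0 [set l | forall n, normc (l - partial_sum n c x) <= 2 * tail n c] ex n).
apply: @fast_ccauchy R (fun n => partial_sum n c x) (fun n => tail n c) _ => m p mp; rewrite (partial_sumE c x (leqnn p)) (partial_sumE c x mp) -sumrB.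
  under eq_bigr do rewrite -mulrBl.
  apply: normc_sum_character (box_uniq p) _.
  apply: wbounded_dom (tail_bounded m lc); first exact: one_weight_ge0.
  move=> k; have := sub_box mp (x := k); rewrite /truncation.
  case: (k \in box p) => [_|h]; first by case: ifP => _; rewrite ?subrr.
  by case: ifP => [/h//|_]; rewrite subrr Normc.normc0 normc_ge0.
Qed.

Lemma l1_wnorm c : l1 c -> wbounded one_weight c (wnorm one_weight c).
Proof. exact: wbounded_wnorm. Qed.

Lemma tbounded_partial_sum n c : tbounded (partial_sum n c : plane R -> R[i]).
Proof.
apply: tbounded_sum => k; apply: tboundedM; first exact: tbounded_cst.
exact: tbounded_character2.
Qed.

Lemma normc_synthesis c B x : wbounded one_weight c B ->
  normc (synthesis c x) <= B.
Proof.
move=> hB; have lc : l1 c by exists B.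
apply/ler_addgt0Pr => e e0; have [|N hN] := tail_small lc (e := e / 2).
  by rewrite divr_gt0.
have h1 := synthesis_approx N x lc; have h2 := hN N (leqnn N).
have h3 : normc (partial_sum N c x) <= B by exact: normc_sum_character (box_uniq N) hB.
have := ler_normcD (synthesis c x - partial_sum N c x) (partial_sum N c x).
by rewrite subrK; lra.
Qed.

Lemma synthesis_cvg c x : l1 c ->
  Re (partial_sum n c x) @[n --> \oo] --> Re (synthesis c x) /\
  Im (partial_sum n c x) @[n --> \oo] --> Im (synthesis c x).
Proof.
move=> lc; suff H e : 0 < e -> \forall n \near \oo,
    normc (synthesis c x - partial_sum n c x) <= e.
  split; apply/cvgrPdist_le => e /H; apply: filterS => n; apply: le_trans;
    by rewrite -?ReB -?ImB ?ler_Re_normc ?ler_Im_normc.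
move=> e0; have [|N hN] := tail_small lc (e := e / 2); first by rewrite divr_gt0.
exists N => // n /= Nn; have := synthesis_approx n x lc; have := hN n Nn; lra.
Qed.

Lemma tbounded_synthesis c : l1 c -> tbounded (synthesis c : plane R -> R[i]).
Proof.
move=> lc; split; last first.
  by exists (wnorm one_weight c) => x _; exact: normc_synthesis (l1_wnorm lc).
split.
- apply: (measurable_fun_cvg (h := fun n x => Re (partial_sum n c x))) => [n|x _].
    by have [[h _] _] := tbounded_partial_sum n c.
  by have [h _] := synthesis_cvg x lc.
- apply: (measurable_fun_cvg (h := fun n x => Im (partial_sum n c x))) => [n|x _].
    by have [[_ h] _] := tbounded_partial_sum n c.
  by have [_ h] := synthesis_cvg x lc.
Qed.

Lemma character2_periodic k x : character2 k (x.1 + 1, x.2) = character2 k x /\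
  character2 k (x.1, x.2 + 1) = character2 k x.
Proof.
have per (a b : R) (m : int) : a = b + 2 * pi * m%:~R -> expi a = expi b.
  by move=> ->; rewrite /expi cosD2piz sinD2piz.
by split; rewrite !character2E /=; [apply: (per _ _ k.1)|apply: (per _ _ k.2)]; ring.
Qed.

Lemma synthesis_periodic c : periodic2 (synthesis c).
Proof.
move=> x; have ps y : (forall k, character2 k y = character2 k x) ->
    synthesis c y = synthesis c x.
  move=> yx; have pn n : partial_sum n c y = partial_sum n c x.
    by apply: eq_bigr => k _; rewrite yx.
  rewrite /synthesis; congr (xget 0 _); apply/seteqP.
  by split => l /= h n; [rewrite -pn|rewrite pn]; exact: h.
by split; apply: ps => k; have [] := character2_periodic k x.
Qed.

Lemma L2_synthesis c : l1 c -> L2_torus (synthesis c).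
Proof.
move=> lc; have [[m1 m2] _] := tbounded_synthesis lc.
split; [exact: synthesis_periodic|exact: m1|exact: m2|].
have mn : measurable_fun sq (fun x => normc (synthesis c x) ^+ 2).
  by apply: measurable_funX; apply: measurable_normc.
have bn x : sq x -> `|normc (synthesis c x) ^+ 2| <= wnorm one_weight c ^+ 2.
  move=> sx; rewrite normrX ger0_norm ?normc_ge0// lerXn2r ?nnegrE ?normc_ge0 ?wnorm_ge0//.
  exact: normc_synthesis (l1_wnorm lc).
have /integrableP[_] := bounded_integrable mn bn.
by under eq_integral do rewrite /= ger0_norm ?sqr_ge0//.
Qed.

(** The factor 2 comes from bounding real and imaginary parts separately. *)
Lemma fourier_approx (f g : plane R -> R[i]) k e : tbounded f -> tbounded g ->
  (forall x, sq x -> normc (f x - g x) <= e) ->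
  normc (fourier f k - fourier g k) <= 2 * e.
Proof.
move=> tf tg h; rewrite -fourierB; [|exact: tbounded_cintegrable..].
apply: torus_integral_bound.
  apply: cmeasurableM; last exact: measurable_character2.
  have [mf _] := tf; have [mg _] := tboundedM tg (tbounded_cst (-1)).
  have := cmeasurableD mf mg; congr cmeasurable; apply/funext => x; ring.
by move=> x sx; rewrite Normc.normcM normc_character2 mulr1 h.
Qed.

Lemma fourier_partial_sum n c k : fourier (partial_sum n c) k = truncation n c k.
Proof.
rewrite /fourier; rewrite (_ : (fun x => _) =
  (fun x => \sum_(j <- box n) c j * character2 (k - j) x)); last first.
  apply/funext => x; rewrite mulr_suml; apply: eq_bigr => j _.
  by rewrite -mulrA character2D addrC.
rewrite torus_integral_sum; last first.
  by move=> j; apply: tboundedM; [exact: tbounded_cst|exact: tbounded_character2].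
under eq_bigr => j _.
  rewrite torus_integralZ ?torus_integral_characterE; last first.
    exact/tbounded_cintegrable/tbounded_character2.
  rewrite subr_eq0; over.
rewrite /truncation; case: ifP => kn.
  rewrite (bigD1_seq k) ?box_uniq//= eqxx mulr1 big1 ?addr0// => j jk.
  by rewrite eq_sym (negbTE jk) mulr0.
rewrite big1_seq// => j /andP[_ jn]; case: eqVneq => [kj|_]; rewrite ?mulr0//.
by rewrite kj jn in kn.
Qed.

Lemma normc_le_eps (z : R[i]) : (forall e, 0 < e -> normc z <= e) -> z = 0.
Proof.
move=> h; apply/eqP; rewrite -normc_eq0 eq_le normc_ge0 andbT.
by apply/ler_addgt0Pr => e /h; rewrite add0r.
Qed.

Lemma fourier_synthesis c k : l1 c -> fourier (synthesis c) k = c k.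
Proof.
move=> lc; apply/eqP; rewrite -subr_eq0; apply/eqP/normc_le_eps => e e0.
have [|N hN] := tail_small lc (e := e / 4); first by rewrite divr_gt0.
have [M hM] := seq_sub_box [:: k].
have kin : k \in box (maxn N M).
  by apply: (sub_box (leq_maxr N M)); apply: hM; rewrite inE.
have := hN _ (leq_maxl N M) => hl.
have := fourier_approx k (tbounded_synthesis lc) (tbounded_partial_sum (maxn N M) c)
  (fun x _ => synthesis_approx (maxn N M) x lc).
by rewrite fourier_partial_sum /truncation kin; lra.
Qed.

Lemma synthesis_fourier (f : plane R -> R[i]) : cintegrable f ->
  l1 (fourier f) -> torus_ae_eq f (synthesis (fourier f)).
Proof.
move=> fi lf; apply: fourier_inj => //.
  exact/tbounded_cintegrable/tbounded_synthesis.
by move=> k; rewrite fourier_synthesis.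
Qed.

End Synthesis.

(** * The cubic nonlinearity on summable Fourier coefficients *)

Lemma wsum_delta (R : realType) (w : lattice -> R) (A : seq lattice) (t : R) j :
  (forall k, 0 <= w k) -> uniq A -> 0 <= t ->
  \sum_(k <- A) w k * (t * (j == k)%:R) <= t * w j.
Proof.
move=> w0 uA t0; have [jA|jA] := boolP (j \in A).
  rewrite (bigD1_seq j)//= eqxx mulr1 big1 ?addr0 ?[w j * t]mulrC// => k kj.
  by rewrite eq_sym (negbTE kj) !mulr0.
rewrite big1_seq ?mulr_ge0// => k /andP[_ kA].
by case: eqVneq => [jk|_]; rewrite ?mulr0//; rewrite jk kA in jA.
Qed.

Section Cubic.
Variable R : realType.
Notation sq := (@unit_square R).
Implicit Types (c d : lattice -> R[i]) (x : R * R) (z : R[i]).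

Lemma ler_normc_dist4 (a b a' b' : R[i]) :
  normc (a - b) <= normc (a' - b') + (normc (a - a') + normc (b - b')).
Proof.
have -> : a - b = (a' - b') + ((a - a') - (b - b')) by ring.
by apply: le_trans (ler_normcD _ _) _; rewrite lerD2l; exact: ler_normcB.
Qed.

Definition cub z : R[i] := ((normc z ^+ 2)%:C * z)%C.

Lemma cubE z : cub z = z * z * (z^*)%C.
Proof. by rewrite /cub -normc_conjM; ring. Qed.

Lemma cub_diff (z1 z2 z3 y1 y2 y3 : R[i]) :
  normc (z1 * z2 * z3^*%C - y1 * y2 * y3^*%C) <=
    normc (z1 - y1) * normc z2 * normc z3 +
    normc y1 * normc (z2 - y2) * normc z3 + normc y1 * normc y2 * normc (z3 - y3).
Proof.
have -> : z1 * z2 * z3^*%C - y1 * y2 * y3^*%C = (z1 - y1) * z2 * z3^*%C +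
    y1 * (z2 - y2) * z3^*%C + y1 * y2 * (z3 - y3)^*%C by rewrite conjcB; ring.
apply: le_trans (ler_normcD _ _) _; rewrite !Normc.normcM !normcJ lerD2r.
by apply: le_trans (ler_normcD _ _) _; rewrite !Normc.normcM !normcJ.
Qed.

Lemma cub_lip z y B : normc z <= B -> normc y <= B ->
  normc (cub z - cub y) <= 3 * B ^+ 2 * normc (z - y).
Proof.
move=> zB yB; rewrite !cubE; apply: le_trans (cub_diff _ _ _ _ _ _) _.
have B0 : 0 <= B by rewrite (le_trans _ zB)// normc_ge0.
have h a b : normc a <= B -> normc b <= B ->
    normc a * normc b * normc (z - y) <= B ^+ 2 * normc (z - y).
  by move=> aB bB; rewrite ler_wpM2r ?normc_ge0// expr2 ler_pM ?normc_ge0.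
have h1 := h z z zB zB; have h2 := h y z yB zB; have h3 := h y y yB yB.
have -> : normc (z - y) * normc z * normc z = normc z * normc z * normc (z - y) by ring.
have -> : normc y * normc (z - y) * normc z = normc y * normc z * normc (z - y) by ring.
lra.
Qed.

Lemma tbounded_cub (f : plane R -> R[i]) : tbounded f -> tbounded (fun x => cub (f x)).
Proof.
by move=> tf; under eq_fun do rewrite cubE; apply: tboundedM;
  [exact: tboundedM|exact: tboundedJ].
Qed.

Definition nonlin c k : R[i] := fourier (fun x => cub (synthesis c x)) k.

(** The cubic convolution restricted to modes in a box: the coefficients of [cub P]
for a trigonometric polynomial [P]. *)
Definition fcub n c k : R[i] := \sum_(k1 <- box n) \sum_(k2 <- box n)
  \sum_(k3 <- box n) c k1 * c k2 * (c k3)^*%C * (k1 + k2 - k3 == k)%:R.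

Lemma fourier_cub_partial n c k :
  fourier (fun x => cub (partial_sum n c x)) k = fcub n c k.
Proof.
pose F k1 k2 k3 (x : plane R) := c k1 * c k2 * (c k3)^*%C *
  character2 (- k1 - k2 + k3 + k) x.
have tF k1 k2 k3 : tbounded (F k1 k2 k3).
  by apply: tboundedM; [exact: tbounded_cst|exact: tbounded_character2].
have E : (fun x : plane R => cub (partial_sum n c x) * character2 k x) =
    (fun x => \sum_(k1 <- box n) \sum_(k2 <- box n) \sum_(k3 <- box n) F k1 k2 k3 x).
  apply/funext => x; rewrite cubE /partial_sum conjc_sum !mulr_suml.
  apply: eq_bigr => k1 _; rewrite mulr_sumr !mulr_suml; apply: eq_bigr => k2 _.
  rewrite mulr_sumr mulr_suml; apply: eq_bigr => k3 _.
  by rewrite conjcM character2J opprK /F -!character2D; ring.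
rewrite /fourier E torus_integral_sum; last by move=> k1; do 2 apply: tbounded_sum => ?.
apply: eq_bigr => k1 _; rewrite torus_integral_sum; last by move=> k2; apply: tbounded_sum.
apply: eq_bigr => k2 _; rewrite torus_integral_sum//; apply: eq_bigr => k3 _.
rewrite torus_integralZ ?torus_integral_characterE; last first.
  exact/tbounded_cintegrable/tbounded_character2.
congr (_ * (nat_of_bool _)%:R).
by rewrite -[in RHS]subr_eq0 -[in RHS]oppr_eq0; congr (_ == 0); ring.
Qed.

Lemma fcub_approx c B n k : wbounded (@one_weight R) c B ->
  normc (nonlin c k - fcub n c k) <= 12 * B ^+ 2 * tail n c.
Proof.
move=> cB; have lc : l1 c by exists B.
rewrite -fourier_cub_partial.
have h (x : plane R) : sq x -> normc (cub (synthesis c x) - cub (partial_sum n c x)) <=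
    3 * B ^+ 2 * (2 * tail n c).
  move=> _; apply: (le_trans (cub_lip (normc_synthesis x cB) _)).
    exact: normc_sum_character (box_uniq n) cB.
  by rewrite ler_wpM2l ?synthesis_approx// mulr_ge0// sqr_ge0.
have := fourier_approx k (tbounded_cub (tbounded_synthesis lc))
  (tbounded_cub (tbounded_partial_sum n c)) h; rewrite -/(nonlin c k); lra.
Qed.

Section Weight.
Variable w : lattice -> R.
Hypothesis w_ge1 : forall k, 1 <= w k.
Hypothesis w_mul : forall k1 k2 k3, w (k1 + k2 - k3) <= w k1 * w k2 * w k3.

Let w_ge0 k : 0 <= w k. Proof. exact: le_trans (w_ge1 k). Qed.

Lemma wbounded_one c B : wbounded w c B -> wbounded (@one_weight R) c B.
Proof.
move=> h A uA; apply: le_trans (h A uA); apply: ler_sum => k _.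
by rewrite ler_wpM2r ?normc_ge0.
Qed.

Lemma wl1_l1 c : wl1 w c -> l1 c.
Proof. by move=> [B /wbounded_one h]; exists B. Qed.

Let sum3 (s : seq lattice) (f g h : lattice -> R) :
  \sum_(k1 <- s) \sum_(k2 <- s) \sum_(k3 <- s) f k1 * g k2 * h k3 =
  (\sum_(k <- s) f k) * (\sum_(k <- s) g k) * (\sum_(k <- s) h k).
Proof.
rewrite !mulr_suml; apply: eq_bigr => k1 _; rewrite [f k1 * _]mulr_sumr mulr_suml.
by apply: eq_bigr => k2 _; rewrite mulr_sumr.
Qed.

(** The weight of the output mode [k1 + k2 - k3] is at most the product of the three
input weights, so the weighted sum factors. *)
Lemma fcub_lip n c d B e : wbounded w c B -> wbounded w d B ->
  wbounded w (fun k => c k - d k) e ->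
  wbounded w (fun k => fcub n c k - fcub n d k) (3 * B ^+ 2 * e).
Proof.
move=> hc hd he A uA.
pose T k1 k2 k3 := normc (c k1 * c k2 * (c k3)^*%C - d k1 * d k2 * (d k3)^*%C).
have T0 k1 k2 k3 : 0 <= T k1 k2 k3 by exact: normc_ge0.
have step1 k : w k * normc (fcub n c k - fcub n d k) <= \sum_(k1 <- box n)
    \sum_(k2 <- box n) \sum_(k3 <- box n) w k * (T k1 k2 k3 * (k1 + k2 - k3 == k)%:R).
  under eq_bigr do (under eq_bigr do rewrite -mulr_sumr; rewrite -mulr_sumr).
  rewrite -mulr_sumr ler_wpM2l// /fcub -sumrB.
  apply: le_trans (ler_normc_sum _ _ _) _; apply: ler_sum => k1 _; rewrite -sumrB.
  apply: le_trans (ler_normc_sum _ _ _) _; apply: ler_sum => k2 _; rewrite -sumrB.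
  apply: le_trans (ler_normc_sum _ _ _) _; apply: ler_sum => k3 _.
  rewrite -mulrBl Normc.normcM ler_wpM2l ?normc_ge0//.
  by case: (_ == _); rewrite ?Normc.normc1 ?Normc.normc0.
apply: (@le_trans _ _ (\sum_(k1 <- box n) \sum_(k2 <- box n) \sum_(k3 <- box n)
    T k1 k2 k3 * (w k1 * w k2 * w k3))).
  apply: le_trans (ler_sum _ (fun k _ => step1 k)) _.
  rewrite exchange_big; apply: ler_sum => k1 _.
  rewrite exchange_big; apply: ler_sum => k2 _.
  rewrite exchange_big; apply: ler_sum => k3 _.
  by apply: le_trans (wsum_delta _ _ _ _) _ => //; rewrite ler_wpM2l.
pose C k := w k * normc (c k); pose D k := w k * normc (d k).
pose E k := w k * normc (c k - d k).
apply: (@le_trans _ _ (\sum_(k1 <- box n) \sum_(k2 <- box n) \sum_(k3 <- box n)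
    (E k1 * C k2 * C k3 + D k1 * E k2 * C k3 + D k1 * D k2 * E k3))).
  apply: ler_sum => k1 _; apply: ler_sum => k2 _; apply: ler_sum => k3 _.
  have := ler_wpM2r (mulr_ge0 (mulr_ge0 (w_ge0 k1) (w_ge0 k2)) (w_ge0 k3))
    (cub_diff (c k1) (c k2) (c k3) (d k1) (d k2) (d k3)).
  by move/le_trans; apply; rewrite /C /D /E; apply: eq_ler; ring.
under eq_bigr do (under eq_bigr do rewrite !big_split/=; rewrite !big_split/=).
rewrite !big_split/= !sum3.
have uE := he _ (box_uniq n); have uC := hc _ (box_uniq n); have uD := hd _ (box_uniq n).
rewrite /wsum -/E in uE; rewrite /wsum -/C in uC; rewrite /wsum -/D in uD.
have pos (f : lattice -> R[i]) : 0 <= \sum_(k <- box n) w k * normc (f k).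
  by apply: sumr_ge0 => k _; rewrite mulr_ge0 ?normc_ge0.
have C0 := pos c; have D0 := pos d; have E0 := pos (fun k => c k - d k).
have B0 : 0 <= B := le_trans C0 uC; have e0 : 0 <= e := le_trans E0 uE.
have -> : 3 * B ^+ 2 * e = e * B * B + B * e * B + B * B * e by ring.
by apply: lerD; [apply: lerD|]; apply: ler_pM => //; rewrite ?mulr_ge0//; apply: ler_pM.
Qed.

(** The bound for trigonometric polynomials passes to the limit because each of the
finitely many coefficients tested is a limit of those of truncations. *)
Lemma nonlin_lip c d B e : wbounded w c B -> wbounded w d B ->
  wbounded w (fun k => c k - d k) e ->
  wbounded w (fun k => nonlin c k - nonlin d k) (3 * B ^+ 2 * e).
Proof.
move=> hc hd he A uA; apply/ler_addgt0Pr => r r0.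
have c1 := wbounded_one hc; have d1 := wbounded_one hd.
have B0 : 0 <= B := wbounded_ge0 hc.
pose W := \sum_(k <- A) w k.
have W0 : 0 <= W by apply: sumr_ge0.
pose K := 24 * B ^+ 2 * W + 1.
have K0 : 0 < K by rewrite ltr_wpDl// !mulr_ge0// sqr_ge0.
have rK : 0 < r / K by rewrite divr_gt0.
have [n1 h1] := tail_small (wbounded_wl1 c1) rK.
have [n2 h2] := tail_small (wbounded_wl1 d1) rK.
pose n := maxn n1 n2; have {}h1 := h1 n (leq_maxl _ _); have {}h2 := h2 n (leq_maxr _ _).
have main := fcub_lip n hc hd he uA.
(* replacing [nonlin] by [fcub n] costs [r] in total, by the choice of [K] *)
have err : wsum w (fun k => nonlin c k - nonlin d k) A <=
    wsum w (fun k => fcub n c k - fcub n d k) A + 2 * (12 * B ^+ 2 * (r / K)) * W.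
  rewrite /wsum /W mulr_sumr -big_split/=; apply: ler_sum => k _.
  have a1 := fcub_approx n k c1; have a2 := fcub_approx n k d1.
  have BB : 0 <= 12 * B ^+ 2 by rewrite mulr_ge0// sqr_ge0.
  have b1 := ler_wpM2l BB h1; have b2 := ler_wpM2l BB h2.
  have stp := ler_normc_dist4 (nonlin c k) (nonlin d k) (fcub n c k) (fcub n d k).
  have {}stp : normc (nonlin c k - nonlin d k) <=
      normc (fcub n c k - fcub n d k) + 2 * (12 * B ^+ 2 * (r / K)).
    apply: le_trans stp _; rewrite lerD2l mulr2n mulrDl mul1r.
    by apply: lerD; [exact: le_trans a1 b1|exact: le_trans a2 b2].
  apply: le_trans (ler_wpM2l (w_ge0 k) stp) _.
  by rewrite mulrDr lerD2l mulrC.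
apply: le_trans err (lerD main _).
have -> : 2 * (12 * B ^+ 2 * (r / K)) * W = r * (24 * B ^+ 2 * W) / K by ring.
by rewrite ler_pdivrMr// ler_pM2l// /K lerDl.
Qed.

Lemma synthesis0 x : synthesis (fun=> 0) x = 0 :> R[i].
Proof.
apply: normc_le_eps => e e0.
have := normc_synthesis x (wbounded0 (@one_weight R)); move/le_trans; apply; exact: ltW.
Qed.

Lemma nonlin0 k : nonlin (fun=> 0) k = 0.
Proof.
rewrite /nonlin /fourier (_ : (fun x => _) = fun=> 0) ?torus_integral0//.
by apply/funext => x; rewrite synthesis0 /cub mulr0 mul0r.
Qed.

Lemma nonlin_bounded c B : wbounded w c B -> wbounded w (nonlin c) (3 * B ^+ 3).
Proof.
move=> hc; have B0 := wbounded_ge0 hc.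
have := nonlin_lip hc (wbounded_le B0 (wbounded0 w)) (e := B).
rewrite -mulrA -exprSr => h A uA.
have := h _ A uA; rewrite /wsum; under eq_bigr do rewrite nonlin0 subr0.
by apply => {}A {}uA; have := hc A uA; rewrite /wsum; under [X in _ -> X <= _]eq_bigr do rewrite subr0.
Qed.

End Weight.

Lemma nonlin_box n c k : (forall j, j \notin box n -> c j = 0) ->
  nonlin c k = fcub n c k.
Proof.
move=> hc; have tr : truncation n c = c.
  by apply/funext => j; rewrite /truncation; case: ifPn => // /hc.
have lc := wbounded_box (@one_weight_ge0 R) hc.
apply/eqP; rewrite -subr_eq0; apply/eqP/normc_le_eps => e e0.
apply: le_trans (fcub_approx n k lc) _; rewrite /tail tr.
suff -> : wnorm (@one_weight R) (fun k => c k - c k) = 0 by rewrite mulr0 ltW.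
apply/eqP; rewrite eq_le wnorm_ge0; last first.
  by exists 0 => A _; rewrite /wsum big1// => j _; rewrite subrr Normc.normc0 mulr0.
rewrite andbT; apply: wnorm_le => A _.
by rewrite /wsum big1// => j _; rewrite subrr Normc.normc0 mulr0.
Qed.

(** The sum is the integral of the real function |P|^4 over the torus. *)
Lemma fcub_energy n c : Im (\sum_(k <- box n) (c k)^*%C * fcub n c k) = 0.
Proof.
pose P := partial_sum n c : plane R -> R[i].
have tP : tbounded P by exact: tbounded_partial_sum.
have tC := tbounded_cub tP.
have -> : \sum_(k <- box n) (c k)^*%C * fcub n c k =
    torus_integral (fun x => cub (P x) * (P x)^*%C).
  under eq_bigr do rewrite -fourier_cub_partial /fourier.
  under eq_bigr => k _.
    rewrite -torus_integralZ; last first.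
      by apply/tbounded_cintegrable/tboundedM => //; exact: tbounded_character2.
    over.
  rewrite -torus_integral_sum; last first.
    move=> k; apply: tboundedM; first exact: tbounded_cst.
    by apply: tboundedM => //; exact: tbounded_character2.
  congr torus_integral; apply/funext => x.
  rewrite {2}/P /partial_sum conjc_sum mulr_sumr; apply: eq_bigr => k _.
  by rewrite conjcM character2J opprK mulrCA.
rewrite /= /Rintegral integral0_eq// => x _ /=.
by rewrite /cub -mulrA [P x * _]mulrC normc_conjM -rmorphM.
Qed.

End Cubic.

(** * Polynomial weights *)

Section Weights.
Variable R : realType.
Implicit Types k : lattice.

(** A product of one-variable weights is submultiplicative and dominates <k>. *)
Definition jw k : R := (1 + `|k.1|%:~R) * (1 + `|k.2|%:~R).

Definition wt n k : R := jw k ^+ n.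

Lemma absz_ge0 (a : int) : 0 <= `|a|%:~R :> R.
Proof. by rewrite ler0z. Qed.

Lemma jw_ge1 k : 1 <= jw k.
Proof.
by rewrite /jw -[leLHS]mulr1; apply: ler_pM; rewrite // lerDl absz_ge0.
Qed.

Lemma wt_ge1 n k : 1 <= wt n k.
Proof. exact: exprn_ege1 (jw_ge1 k). Qed.

Lemma wt_gt0 n k : 0 < wt n k.
Proof. exact: lt_le_trans ltr01 (wt_ge1 n k). Qed.

Lemma wt_ge0 n k : 0 <= wt n k.
Proof. exact: ltW (wt_gt0 n k). Qed.

Lemma wt_le n m k : (n <= m)%N -> wt n k <= wt m k.
Proof. by move=> nm; apply: ler_weXn2l => //; exact: jw_ge1. Qed.

Lemma jw_mul k1 k2 k3 : jw (k1 + k2 - k3) <= jw k1 * jw k2 * jw k3.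
Proof.
have one (a b c : int) : 1 + `|a + b - c|%:~R <=
    (1 + `|a|%:~R) * (1 + `|b|%:~R) * (1 + `|c|%:~R) :> R.
  have h : `|a + b - c|%:~R <= `|a|%:~R + `|b|%:~R + `|c|%:~R :> R.
    by rewrite -!intrD ler_int; lia.
  have := absz_ge0 a; have := absz_ge0 b; have := absz_ge0 c => h1 h2 h3.
  have h4 := mulr_ge0 h3 h2; have h5 := mulr_ge0 h3 h1; have h6 := mulr_ge0 h2 h1.
  have h7 := mulr_ge0 h4 h1; nra.
have p1 := absz_ge0; rewrite /jw /=.
have -> (x1 y1 x2 y2 x3 y3 : R) : x1 * y1 * (x2 * y2) * (x3 * y3) =
  (x1 * x2 * x3) * (y1 * y2 * y3) by ring.
by apply: ler_pM; rewrite ?one ?addr_ge0.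
Qed.

Lemma wt_mul n k1 k2 k3 : wt n (k1 + k2 - k3) <= wt n k1 * wt n k2 * wt n k3.
Proof.
have j0 k : 0 <= jw k := le_trans ler01 (jw_ge1 k).
by rewrite /wt -!exprMn lerXn2r ?nnegrE ?mulr_ge0 ?jw_mul.
Qed.

Lemma sqr_abs_intr (a : int) : a%:~R ^+ 2 = `|a|%:~R ^+ 2 :> R.
Proof. by rewrite intr_norm real_normK ?num_real. Qed.

Lemma jw_sqr k : 1 + k.1%:~R ^+ 2 + k.2%:~R ^+ 2 <= jw k ^+ 2.
Proof.
rewrite (sqr_abs_intr k.1) (sqr_abs_intr k.2) /jw; move: (absz_ge0 k.1) (absz_ge0 k.2).
move: (`|k.1|%:~R : R) (`|k.2|%:~R : R) => a b a0 b0.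
have -> : ((1 + a) * (1 + b)) ^+ 2 = 1 + a ^+ 2 + b ^+ 2 +
    (2 * a + 2 * b + 4 * (a * b) + 2 * (a * b) * (a + b) + (a * b) ^+ 2) by ring.
by rewrite lerDl !(addr_ge0, mulr_ge0, sqr_ge0).
Qed.

Lemma eigenvalue2_bound (omega : R * R) k : 0 < omega.1 -> 0 < omega.2 ->
  `|eigenvalue2 omega k| <= (omega.1 + omega.2) * wt 2 k.
Proof.
move=> o1 o2; have h := jw_sqr k; rewrite -/(wt 2 k) in h.
have a2 := sqr_ge0 (k.1%:~R : R); have b2 := sqr_ge0 (k.2%:~R : R).
have p1 := ltW o1; have p2 := ltW o2.
rewrite /eigenvalue2 ger0_norm; last by rewrite addr_ge0// mulr_ge0.
by rewrite mulrDl; apply: lerD; rewrite ler_wpM2l//; lra.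
Qed.

End Weights.

(** * The truncated equation in the interaction picture *)

Section InteractionPicture.
Variables (R : realType) (omega : R * R).
Notation lam := (eigenvalue2 omega).
Implicit Types (a b c : lattice -> R[i]) (t u : R) (w : lattice -> R).

(** The linear flow of the equation in Fourier variables. *)
Definition lflow t a k : R[i] := expi (lam k * t) * a k.

Lemma normc_lflow t a k : normc (lflow t a k) = normc (a k).
Proof. by rewrite Normc.normcM normc_expi mul1r. Qed.

Lemma lflow_bounded w t a B : (forall k, 0 <= w k) ->
  wbounded w a B -> wbounded w (lflow t a) B.
Proof. by move=> w0; apply: wbounded_dom => // k; rewrite normc_lflow. Qed.

Lemma lflowB t a b k : lflow t a k - lflow t b k = lflow t (fun j => a j - b j) k.
Proof. by rewrite /lflow -mulrBr. Qed.

(** Conjugation by the unitary linear flow removes the unbounded linear part; what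
remains is as regular as the cubic term. *)
Definition vfield t a k : R[i] := 'i%C * expi (- (lam k * t)) * nonlin (lflow t a) k.

Lemma normc_vfieldB t a b k : normc (vfield t a k - vfield t b k) =
  normc (nonlin (lflow t a) k - nonlin (lflow t b) k).
Proof. by rewrite /vfield -mulrBr !Normc.normcM normci normc_expi !mul1r. Qed.

Section Weighted.
Variable w : lattice -> R.
Hypothesis w_ge1 : forall k, 1 <= w k.
Hypothesis w_mul : forall k1 k2 k3, w (k1 + k2 - k3) <= w k1 * w k2 * w k3.
Let w_ge0 k : 0 <= w k. Proof. exact: le_trans (w_ge1 k). Qed.

Lemma vfield_lip t a b B e : wbounded w a B -> wbounded w b B ->
  wbounded w (fun k => a k - b k) e ->
  wbounded w (fun k => vfield t a k - vfield t b k) (3 * B ^+ 2 * e).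
Proof.
move=> ha hb he; apply: (@wbounded_dom _ _ w w_ge0 _ (fun k => nonlin (lflow t a) k - nonlin (lflow t b) k)).
  by move=> k; rewrite normc_vfieldB.
apply: nonlin_lip => //; try exact: lflow_bounded.
by apply: wbounded_dom he => // k; rewrite lflowB normc_lflow.
Qed.

Lemma vfield_bounded t a B : wbounded w a B -> wbounded w (vfield t a) (3 * B ^+ 3).
Proof.
move=> ha; apply: (@wbounded_dom _ _ w w_ge0 _ (nonlin (lflow t a))).
  by move=> k; rewrite !Normc.normcM normci normc_expi !mul1r.
by apply: nonlin_bounded => //; exact: lflow_bounded.
Qed.
End Weighted.

(** * Truncation to a bounded, globally Lipschitz field *)

(** Equal to 1 on [[0, B]], to 0 beyond [2 B], and affine in between. *)
Definition cutoff (B r : R) : R := Num.max 0 (Num.min 1 (2 - r / B)).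

Lemma cutoff_ge0 B r : 0 <= cutoff B r.
Proof. by rewrite le_max lexx. Qed.

Lemma cutoff_le1 B r : cutoff B r <= 1.
Proof. by rewrite ge_max ler01 ge_min lexx. Qed.

Lemma cutoff1 B r : 0 < B -> r <= B -> cutoff B r = 1.
Proof.
move=> B0 rB; have : r / B <= 1 by rewrite ler_pdivrMr// mul1r.
move=> h; rewrite /cutoff (min_idPl _); last by lra.
by rewrite (max_idPr _).
Qed.

Lemma cutoff0 B r : 0 < B -> 2 * B <= r -> cutoff B r = 0.
Proof.
move=> B0 rB; have h : 2 <= r / B by rewrite ler_pdivlMr.
by apply/max_idPl; rewrite ge_min; apply/orP; right; lra.
Qed.

Lemma cutoff_lip B r q : 0 < B -> `|cutoff B r - cutoff B q| <= `|r - q| / B.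
Proof.
move=> B0; have -> : `|r - q| / B = `|r / B - q / B|.
  by rewrite -mulrBl normrM [`|B^-1|]ger0_norm// invr_ge0 ltW.
have E z : Num.max 0 (Num.min 1 (2 - z)) =
    if z <= 1 then 1 else if z <= 2 then 2 - z else 0 :> R.
  case: ifPn => [z1|]; first rewrite (_ : Num.min 1 _ = 1).
  - by apply/max_idPr.
  - by apply/min_idPl; lra.
  rewrite -ltNge => z1; rewrite (_ : Num.min 1 _ = 2 - z).
    case: ifPn => [z2|]; first by apply/max_idPr; lra.
    by rewrite -ltNge => z2; apply/max_idPl; lra.
  by apply/min_idPr; lra.
rewrite /cutoff !E; move: (r / B) (q / B) => x y.
have := ler_norm (x - y); have := ler_norm (y - x); rewrite (distrC y) => h1 h2.
have h3 : 0 <= `|x - y| by [].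
by case: (leP x 1) => ?; case: (leP x 2) => ?; case: (leP y 1) => ?;
  case: (leP y 2) => ?; rewrite ler_norml; apply/andP; split; lra.
Qed.

Section Truncated.
Variables (n : nat) (B : R).
Hypothesis B0 : 0 < B.
Notation w := (@wt R n).

Definition tfield t a k : R[i] := ((cutoff B (wnorm w a))%:C * vfield t a k)%C.

Lemma tfield_big t a k : 2 * B <= wnorm w a -> tfield t a k = 0.
Proof. by move=> h; rewrite /tfield cutoff0// mul0r. Qed.

Lemma tfield_bounded t a : wl1 w a -> wbounded w (tfield t a) (24 * B ^+ 3).
Proof.
move=> la; have w0 := @wt_ge0 R n.
have K0 : 0 <= 24 * B ^+ 3 by rewrite mulr_ge0 ?exprn_ge0 ?mulr_ge0 ?(ltW B0).
have [big|small] := leP (2 * B) (wnorm w a).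
  rewrite (_ : tfield t a = fun=> 0); first exact: wbounded_le K0 (wbounded0 w).
  by apply/funext => k; rewrite tfield_big.
have ha := wbounded_le (ltW small) (wbounded_wnorm la).
have := vfield_bounded (@wt_ge1 R n) (@wt_mul R n) t ha.
have -> : 3 * (2 * B) ^+ 3 = 24 * B ^+ 3 by ring.
apply: wbounded_dom => // k; rewrite Normc.normcM normc_real.
by rewrite ger0_norm ?cutoff_ge0// ler_piMl ?normc_ge0 ?cutoff_le1.
Qed.

(** The field vanishes outside the ball of radius [2 B], so one of the two points may
be taken inside; there the cutoff and the field are both Lipschitz. *)
Lemma tfield_lip t a b D : wl1 w a -> wl1 w b ->
  wbounded w (fun k => a k - b k) D ->
  wbounded w (fun k => tfield t a k - tfield t b k) (36 * B ^+ 2 * D).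
Proof.
have w0 := @wt_ge0 R n.
wlog small : a b / wnorm w a < 2 * B.
  move=> H la lb hD; have [sa|ba] := ltP (wnorm w a) (2 * B); first exact: H.
  have [sb|bb] := ltP (wnorm w b) (2 * B).
    by apply: wboundedC => //; apply: H => //; exact: wboundedC.
  have D0 := wbounded_ge0 hD.
  rewrite (_ : (fun k => _) = fun=> 0); last first.
    by apply/funext => k; rewrite !tfield_big// subrr.
  apply: wbounded_le (wbounded0 w).
  by rewrite !mulr_ge0 ?(ltW B0).
move=> la lb hD; have D0 := wbounded_ge0 hD.
have ha := wbounded_le (ltW small) (wbounded_wnorm la).
have va := vfield_bounded (@wt_ge1 R n) (@wt_mul R n) t ha.
pose x := (cutoff B (wnorm w a) - cutoff B (wnorm w b))%:C%C : R[i].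
pose y := (cutoff B (wnorm w b))%:C%C : R[i].
have hx : normc x <= D / B.
  rewrite normc_real; apply: le_trans (cutoff_lip _ _ B0) _.
  rewrite ler_wpM2r ?invr_ge0 ?(ltW B0)//.
  have h1 := wnorm_le_dist w0 lb hD; have h2 := wnorm_le_dist w0 la (wboundedC w0 hD).
  by rewrite ler_norml; apply/andP; split; lra.
have E k : tfield t a k - tfield t b k = x * vfield t a k +
    y * (vfield t a k - vfield t b k).
  have alg (p q u v : R[i]) : p * u - q * v = (p - q) * u + q * (u - v) by ring.
  by rewrite /tfield alg /x rmorphB.
have h1 : wbounded w (fun k => x * vfield t a k) (24 * B ^+ 2 * D).
  refine (wbounded_le _ (wboundedZ x va)).
  apply: (@le_trans _ _ (D / B * (3 * (2 * B) ^+ 3))).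
    by rewrite ler_wpM2r// mulr_ge0// exprn_ge0// mulr_ge0// ltW.
  by apply: eq_ler; field; rewrite gt_eqF.
have h2 : wbounded w (fun k => y * (vfield t a k - vfield t b k)) (12 * B ^+ 2 * D).
  have K0 : 0 <= 12 * B ^+ 2 * D by rewrite !mulr_ge0 ?(ltW B0).
  have [big|sb] := leP (2 * B) (wnorm w b).
    rewrite (_ : (fun k => _) = fun=> 0); first exact: wbounded_le K0 (wbounded0 w).
    by apply/funext => k; rewrite /y cutoff0// mul0r.
  have hb := wbounded_le (ltW sb) (wbounded_wnorm lb).
  have := vfield_lip (@wt_ge1 R n) (@wt_mul R n) t ha hb hD.
  have -> : 3 * (2 * B) ^+ 2 * D = 12 * B ^+ 2 * D by ring.
  apply: wbounded_dom => // k; rewrite Normc.normcM normc_real.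
  by rewrite ger0_norm ?cutoff_ge0// ler_piMl ?normc_ge0 ?cutoff_le1.
have -> : 36 * B ^+ 2 * D = 24 * B ^+ 2 * D + 12 * B ^+ 2 * D by ring.
by move=> A uA; have := wboundedD w0 h1 h2 uA; congr (_ <= _); apply: eq_bigr => k _; rewrite E.
Qed.

End Truncated.
End InteractionPicture.

(** * Global solutions of the truncated equation *)

Section LocalLipschitz.
Variable R : realType.
Implicit Types f g : R -> R[i].

(** Continuity in time with a rate, which is convenient for products; the rate is
only required at distance at most 1. *)
Definition loc_lip f (u : R) : Prop := exists K, forall t, `|t - u| <= 1 ->
  normc (f t - f u) <= K * `|t - u|.

Lemma loc_lip_continuous f : (forall u, loc_lip f u) ->
  continuous (fun t => Re (f t)) /\ continuous (fun t => Im (f t)).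
Proof.
move=> h; suff H u e : 0 < e -> \forall t \near u, normc (f u - f t) <= e.
  split=> u; apply/cvgrPdist_le => e /(H u); apply: filterS => t; apply: le_trans;
    by rewrite -?ReB -?ImB ?ler_Re_normc ?ler_Im_normc.
move=> e0; have [K hK] := h u; pose d := Num.min 1 (e / (`|K| + 1)).
have K1 : 0 < `|K| + 1 by rewrite ltr_wpDl.
have d0 : 0 < d by rewrite lt_min ltr01 divr_gt0.
apply/nbhs_ballP; exists d => //= t; rewrite /ball/= distrC lt_min => /andP[t1 te].
rewrite normcBC; apply: le_trans (hK t (ltW t1)) _.
apply: (@le_trans _ _ ((`|K| + 1) * `|t - u|)).
  by rewrite ler_wpM2r// (le_trans (ler_norm K))// lerDl.
by rewrite mulrC -ler_pdivlMr// ltW.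
Qed.

Lemma loc_lipM f g u : loc_lip f u -> loc_lip g u -> loc_lip (fun t => f t * g t) u.
Proof.
move=> [K hK] [M hM]; exists (K * (normc (g u) + M) + normc (f u) * M) => t tu.
have alg (a b c d : R[i]) : a * b - c * d = (a - c) * b + c * (b - d) by ring.
have h1 := hK t tu; have h2 := hM t tu; rewrite alg.
apply: le_trans (ler_normcD _ _) _; rewrite !Normc.normcM mulrDl; apply: lerD; last first.
  by rewrite -mulrA ler_wpM2l ?normc_ge0.
have M0 : 0 <= M * `|t - u| := le_trans (normc_ge0 _) h2.
have h3 : normc (g t) <= normc (g u) + M.
  have [->|ntu] := eqVneq t u; last first.
    have M1 : 0 <= M by rewrite -(pmulr_lge0 _ (_ : 0 < `|t - u|))// normr_gt0 subr_eq0.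
    have := ler_normcD (g t - g u) (g u); rewrite subrK => /le_trans; apply.
    by rewrite addrC lerD2l (le_trans h2)// ler_piMr.
  have := hM (u + 1); rewrite addrAC subrr add0r normr1 mulr1 => /(_ (lexx 1)) h.
  by rewrite lerDl (le_trans (normc_ge0 _) h).
by rewrite mulrAC; apply: ler_pM; rewrite ?normc_ge0.
Qed.

End LocalLipschitz.

Section TruncatedSolution.
Variables (R : realType) (omega : R * R).
Hypotheses (o1 : 0 < omega.1) (o2 : 0 < omega.2).
Notation lam := (eigenvalue2 omega).

(** The eigenvalues grow quadratically, so differentiating the phases in time costs
two powers of the weight. *)
Lemma lflow_time_lip (n m : nat) t u (a b : lattice -> R[i]) e B : (m + 2 <= n)%N ->
  wbounded (@wt R n) (fun k => a k - b k) e -> wbounded (@wt R n) b B ->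
  wbounded (@wt R m) (fun k => lflow omega t a k - lflow omega u b k)
    (e + 2 * (omega.1 + omega.2) * B * `|t - u|).
Proof.
move=> mn he hB A uA; have o0 : 0 <= omega.1 + omega.2 by rewrite addr_ge0 ?ltW.
have h1 := he A uA; have h2 := hB A uA.
apply: (@le_trans _ _ (wsum (@wt R n) (fun k => a k - b k) A +
    2 * (omega.1 + omega.2) * `|t - u| * wsum (@wt R n) b A)); last first.
  apply: lerD => //; have -> : 2 * (omega.1 + omega.2) * B * `|t - u| =
    2 * (omega.1 + omega.2) * `|t - u| * B by ring.
  by rewrite ler_wpM2l// !mulr_ge0.
rewrite /wsum mulr_sumr -big_split/=; apply: ler_sum => k _.
have wm : wt R m k <= wt R n k by apply: wt_le; lia.
have wm2 : wt R m k * wt R 2 k <= wt R n k by rewrite /wt -exprD; exact: (@wt_le R).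
have alg (p q x y : R[i]) : p * x - q * y = p * (x - y) + (p - q) * y by ring.
rewrite /lflow alg; apply: le_trans (ler_wpM2l (wt_ge0 R m k) (ler_normcD _ _)) _.
rewrite !Normc.normcM normc_expi mul1r mulrDr; apply: lerD.
  by rewrite ler_wpM2r ?normc_ge0.
have h3 : normc (expi (lam k * t) - expi (lam k * u)) <=
    2 * ((omega.1 + omega.2) * wt R 2 k * `|t - u|).
  apply: le_trans (expi_lip _ _) _; rewrite ler_wpM2l// -mulrBr normrM ler_wpM2r//.
  exact: eigenvalue2_bound.
apply: (@le_trans _ _ (wt R m k *
    (2 * ((omega.1 + omega.2) * wt R 2 k * `|t - u|) * normc (b k)))).
  by rewrite ler_wpM2l ?wt_ge0// ler_wpM2r ?normc_ge0.
have -> : wt R m k * (2 * ((omega.1 + omega.2) * wt R 2 k * `|t - u|) * normc (b k)) =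
  2 * (omega.1 + omega.2) * `|t - u| * (wt R m k * wt R 2 k * normc (b k)) by ring.
by rewrite ler_wpM2l ?mulr_ge0// ler_wpM2r ?normc_ge0.
Qed.

Variables (n : nat) (B : R).
Hypothesis n2 : (2 <= n)%N.
Hypothesis B0 : 0 < B.
Notation w := (@wt R n).

(** Each component is only asked to be continuous, so the two powers of the weight
lost by the phases do no harm: the nonlinearity is estimated in plain l^1. *)
Lemma tfield_continuous (a : R -> lattice -> R[i]) C : (forall t, wl1 w (a t)) ->
  (forall t u, wbounded w (fun k => a t k - a u k) (C * `|t - u|)) ->
  forall k, continuous (fun t => Re (tfield omega n B t (a t) k)) /\
            continuous (fun t => Im (tfield omega n B t (a t) k)).
Proof.
move=> la lip k; apply: loc_lip_continuous => u.
have w0 := @wt_ge0 R n.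
have C0 : 0 <= C by have := wbounded_ge0 (lip 1 0); rewrite subr0 normr1 mulr1.
have hu := wbounded_wnorm (la u); set N := wnorm w (a u) in hu.
have N0 : 0 <= N := wbounded_ge0 hu.
apply: loc_lipM; last apply: loc_lipM; last 1 first.
- pose K := C + 2 * (omega.1 + omega.2) * N.
  have K0 : 0 <= K by rewrite addr_ge0// !mulr_ge0// addr_ge0 ?ltW.
  exists (3 * (N + C) ^+ 2 * K) => t tu.
  have he := lflow_time_lip (m := 0) t u n2 (lip t u) hu.
  have h1 : wbounded (@wt R 0) (lflow omega u (a u)) (N + C).
    apply: (@wbounded_le _ _ _ _ N); first by rewrite lerDl.
    apply: lflow_bounded => [j|]; first exact: wt_ge0.
    move=> A uA; apply: le_trans (hu A uA); apply: ler_sum => j _.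
    by rewrite ler_wpM2r ?normc_ge0 ?wt_le.
  have h2 : wbounded (@wt R 0) (lflow omega t (a t)) (N + C).
    apply: lflow_bounded => [j|]; first exact: wt_ge0.
    move=> A uA; apply: (@le_trans _ _ (wsum w (a t) A)).
      by apply: ler_sum => j _; rewrite ler_wpM2r ?normc_ge0 ?wt_le.
    have := wbounded_wnorm (la t) uA; move/le_trans; apply.
    apply: le_trans (wnorm_le_dist w0 (la u) (lip t u)) _.
    by rewrite lerD2l ler_piMr.
  have := wbounded_term k (nonlin_lip (@wt_ge1 R 0) (@wt_mul R 0) h2 h1 he).
  rewrite /wt expr0 mul1r => /le_trans; apply.
  by rewrite /K; apply: eq_ler; ring.
- exists (C / B) => t tu; rewrite -rmorphB normc_real.
  apply: le_trans (cutoff_lip _ _ B0) _.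
  have h1 := wnorm_le_dist w0 (la u) (lip t u).
  have h2 := wnorm_le_dist w0 (la t) (lip u t); rewrite (distrC u) in h2.
  rewrite mulrAC ler_wpM2r ?invr_ge0 ?(ltW B0)//.
  by rewrite ler_norml; apply/andP; split; lra.
- exists (2 * `|lam k|) => t tu; rewrite -mulrBr Normc.normcM normci mul1r.
  apply: le_trans (expi_lip _ _) _.
  have -> : - (lam k * t) - - (lam k * u) = - lam k * (t - u) by ring.
  by rewrite normrM normrN mulrA.
Qed.

(** The truncated field is bounded and Lipschitz on all of the weighted space,
so that its solutions are global. *)
Lemma truncated_solution (a0 : lattice -> R[i]) : wl1 w a0 ->
  exists a : R -> lattice -> R[i],
  [/\ forall k, a 0 k = a0 k, forall t, wl1 w (a t),
      forall t u, wbounded w (fun k => a t k - a u k) (24 * B ^+ 3 * `|t - u|) &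
      forall (t : R) k, 0 < t -> is_cderive (fun u => a u k) t (tfield omega n B t (a t) k)].
Proof.
move=> l0; apply: (@picard R _ w (tfield omega n B) (36 * B ^+ 2)) => //.
- by move=> k; exact: wt_gt0.
- by rewrite mulr_gt0// exprn_gt0.
- by move=> t a la; exact: tfield_bounded.
- by move=> t a b D la lb; exact: tfield_lip.
- exact: tfield_continuous.
Qed.

End TruncatedSolution.

(** * Nonresonance and normal form *)

Section NormalForm.
Variables (R : realType) (omega : R * R).
Hypothesis irr : irrational_vector omega.
Notation lam := (eigenvalue2 omega).
Implicit Types (k : lattice).

(** The frequency at which the triple forces the mode [k1 + k2 - k3] in the
interaction picture. *)
Definition freq k1 k2 k3 : R := lam k1 + lam k2 - lam k3 - lam (k1 + k2 - k3).

(** Resonant quadruples are axis-parallel rectangles, so that three corners in a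
centred square force the fourth one to lie in that square. *)
Lemma freq_neq0 m k1 k2 k3 : k1 \in box m -> k2 \in box m -> k3 \in box m ->
  k1 + k2 - k3 \notin box m -> freq k1 k2 k3 != 0.
Proof.
case: irr => _ _ irr_; move=> h1 h2 h3; apply: contraNneq => f0.
case: k1 k2 k3 h1 h2 h3 f0 => [a1 b1] [a2 b2] [a3 b3].
rewrite !mem_box !ge_max /= => /andP[? ?] /andP[? ?] /andP[? ?] f0.
pose p : int * int := ((a1 - a3) * (a2 - a3), (b1 - b3) * (b2 - b3)).
have fE : freq (a1, b1) (a2, b2) (a3, b3) =
    - 2 * (omega.1 * p.1%:~R + omega.2 * p.2%:~R).
  by rewrite /freq /eigenvalue2 /p /= !rmorphM /= !rmorphB /= !rmorphD /=; ring.
have p0 : p = (0, 0).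
  apply/eqP/negPn/negP => /eqP /irr_ /eqP; apply; move: f0; rewrite fE => /eqP.
  by rewrite mulf_eq0 oppr_eq0 pnatr_eq0 /= => /eqP.
case: p0 => /eqP + /eqP; rewrite !mulf_eq0 !subr_eq0.
move=> /orP[/eqP ->|/eqP ->] /orP[/eqP ->|/eqP ->]; apply/andP; split;
  rewrite ?[a3 + a2]addrC ?[b3 + b2]addrC ?addrK //.
Qed.

Variables (n m : nat).
Notation w := (@wt R n).
Notation Q := (box m).

(** The inverse of 0 is 0, so resonant triples do not contribute; by [freq_neq0] they
never force a mode outside the box. *)
Definition small_divisors : R := \sum_(k1 <- Q) \sum_(k2 <- Q) \sum_(k3 <- Q)
  w (k1 + k2 - k3) * `|(freq k1 k2 k3)^-1|.

Lemma small_divisors_ge0 : 0 <= small_divisors.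
Proof.
by do 3 (apply: sumr_ge0 => ? _); rewrite mulr_ge0// wt_ge0.
Qed.

Lemma triple_bounded (X : lattice -> lattice -> lattice -> R[i]) M :
  (forall k1 k2 k3, normc (X k1 k2 k3) <= `|(freq k1 k2 k3)^-1| * M) ->
  wbounded w (fun k => \sum_(k1 <- Q) \sum_(k2 <- Q) \sum_(k3 <- Q)
    X k1 k2 k3 * (k1 + k2 - k3 == k)%:R) (small_divisors * M).
Proof.
move=> hX A uA.
have step1 k : w k * normc (\sum_(k1 <- Q) \sum_(k2 <- Q) \sum_(k3 <- Q)
    X k1 k2 k3 * (k1 + k2 - k3 == k)%:R) <= \sum_(k1 <- Q)
    \sum_(k2 <- Q) \sum_(k3 <- Q) w k * (normc (X k1 k2 k3) * (k1 + k2 - k3 == k)%:R).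
  under [leRHS]eq_bigr do (under eq_bigr do rewrite -mulr_sumr; rewrite -mulr_sumr).
  rewrite -mulr_sumr ler_wpM2l ?wt_ge0//.
  apply: le_trans (ler_normc_sum _ _ _) _; apply: ler_sum => k1 _.
  apply: le_trans (ler_normc_sum _ _ _) _; apply: ler_sum => k2 _.
  apply: le_trans (ler_normc_sum _ _ _) _; apply: ler_sum => k3 _.
  rewrite Normc.normcM ler_wpM2l ?normc_ge0//.
  by case: (_ == _); rewrite ?Normc.normc1 ?Normc.normc0.
apply: le_trans (ler_sum _ (fun k _ => step1 k)) _; rewrite /small_divisors.
rewrite exchange_big mulr_suml; apply: ler_sum => k1 _.
rewrite exchange_big mulr_suml; apply: ler_sum => k2 _.
rewrite exchange_big mulr_suml; apply: ler_sum => k3 _.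
apply: le_trans (wsum_delta _ (@wt_ge0 R n) uA (normc_ge0 _)) _.
by rewrite mulrC -mulrA ler_wpM2l ?wt_ge0.
Qed.

Implicit Types (a v : lattice -> R[i]) (t : R).

Definition monomial a k1 k2 k3 : R[i] := a k1 * a k2 * (a k3)^*%C.

Definition dmonomial a v k1 k2 k3 : R[i] := v k1 * a k2 * (a k3)^*%C +
  a k1 * v k2 * (a k3)^*%C + a k1 * a k2 * (v k3)^*%C.

Definition high a k : R[i] := if k \in Q then 0 else a k.

(** The time integral of the oscillating low-frequency forcing of the high modes. *)
Definition correction t a k : R[i] := if k \in Q then 0 else
  \sum_(k1 <- Q) \sum_(k2 <- Q) \sum_(k3 <- Q)
    ((freq k1 k2 k3)^-1%:C)%C * expi (freq k1 k2 k3 * t) *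
    monomial a k1 k2 k3 * (k1 + k2 - k3 == k)%:R.

(** What is left of the field on the high modes after one integration by parts in
time: the interactions involving a high mode, and the forcing by low modes with
one factor differentiated. *)
Definition residual t a v k : R[i] := if k \in Q then 0 else
  vfield omega t a k - vfield omega t (truncation m a) k -
  \sum_(k1 <- Q) \sum_(k2 <- Q) \sum_(k3 <- Q)
    ((freq k1 k2 k3)^-1%:C)%C * expi (freq k1 k2 k3 * t) *
    dmonomial a v k1 k2 k3 * (k1 + k2 - k3 == k)%:R.

Lemma vfield_low t a k : vfield omega t (truncation m a) k =
  \sum_(k1 <- Q) \sum_(k2 <- Q) \sum_(k3 <- Q)
    'i%C * expi (freq k1 k2 k3 * t) * monomial a k1 k2 k3 * (k1 + k2 - k3 == k)%:R.
Proof.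
rewrite /vfield (@nonlin_box _ m); last first.
  by move=> j jQ; rewrite /lflow /truncation (negbTE jQ) mulr0.
rewrite /fcub mulr_sumr; apply: eq_big_seq => k1 q1.
rewrite mulr_sumr; apply: eq_big_seq => k2 q2.
rewrite mulr_sumr; apply: eq_big_seq => k3 q3.
rewrite /lflow /truncation q1 q2 q3 /monomial; case: eqP => [<-|_]; last by rewrite !mulr0.
rewrite !mulr1 conjcM expiJ.
have -> : expi (freq k1 k2 k3 * t) = expi (- (lam (k1 + k2 - k3) * t)) *
    expi (lam k1 * t) * expi (lam k2 * t) * expi (- (lam k3 * t)).
  by rewrite -!expiD; congr expi; rewrite /freq; ring.
by ring.
Qed.

(** Differentiating the phase of [correction] cancels its divisor and reproduces the
forcing of the high modes by the low ones; this needs the divisors to be nonzero. *)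
Lemma correction_cderive (a : R -> lattice -> R[i]) v t k :
  (forall k, is_cderive (fun u => a u k) t (v k)) -> v = vfield omega t (a t) ->
  is_cderive (fun u => high (a u) k - correction u (a u) k) t
    (residual t (a t) v k).
Proof.
move=> dv vE; rewrite /high /correction /residual; case: ifPn => kQ.
  apply: is_cderive_eq; first exact: is_cderiveB (is_cderive_cst _ _) (is_cderive_cst _ _).
  by rewrite subrr.
pose D k1 k2 k3 : R[i] := ((freq k1 k2 k3)^-1%:C)%C *
  ('i%C * (freq k1 k2 k3)%:C%C * expi (freq k1 k2 k3 * t)) * monomial (a t) k1 k2 k3 +
  ((freq k1 k2 k3)^-1%:C)%C * expi (freq k1 k2 k3 * t) * dmonomial (a t) v k1 k2 k3.
apply: (@is_cderive_eq _ _ _ (v k - \sum_(k1 <- Q) \sum_(k2 <- Q) \sum_(k3 <- Q)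
    D k1 k2 k3 * (k1 + k2 - k3 == k)%:R)).
  apply: is_cderiveB => //; apply: is_cderive_sum => k1; apply: is_cderive_sum => k2.
  apply: is_cderive_sum => k3.
  have dm : is_cderive (fun u => monomial (a u) k1 k2 k3) t (dmonomial (a t) v k1 k2 k3).
    apply: is_cderive_eq.
      exact: is_cderiveM (is_cderiveM (dv k1) (dv k2)) (is_cderiveJ (dv k3)).
    by rewrite /dmonomial; ring.
  apply: is_cderive_eq.
    exact: is_cderiveM (is_cderiveM (is_cderiveM (is_cderive_cst _ _)
      (is_cderive_expi _ _)) dm) (is_cderive_cst _ _).
  by rewrite /D; ring.
rewrite vE -addrA; congr (_ + _); rewrite -opprD; congr (- _).
rewrite vfield_low -big_split/=; apply: eq_big_seq => k1 q1.
rewrite -big_split/=; apply: eq_big_seq => k2 q2.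
rewrite -big_split/=; apply: eq_big_seq => k3 q3.
rewrite -mulrDl; case: eqP => [kE|_]; last by rewrite !mulr0.
congr (_ * _); rewrite /D; congr (_ + _); last by rewrite vE.
congr (_ * _).
have f0 : freq k1 k2 k3 != 0 by apply: (@freq_neq0 m) => //; rewrite kE.
have -> : ((freq k1 k2 k3)^-1%:C)%C * ('i%C * (freq k1 k2 k3)%:C%C * expi (freq k1 k2 k3 * t))
  = ((freq k1 k2 k3)^-1%:C)%C * (freq k1 k2 k3)%:C%C * ('i%C * expi (freq k1 k2 k3 * t)) by ring.
by rewrite -rmorphM /= mulVf// mul1r.
Qed.

Section Bounds.
Variables (a : lattice -> R[i]) (B : R).
Hypothesis hB : wbounded w a B.

Let a1 k : normc (a k) <= B.
Proof.
have := wbounded_term k hB; apply: le_trans.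
by rewrite ler_peMl ?normc_ge0// wt_ge1.
Qed.

Let B0 : 0 <= B. Proof. exact: wbounded_ge0 hB. Qed.

Lemma correction_bounded t : wbounded w (correction t a) (small_divisors * B ^+ 3).
Proof.
have h := @triple_bounded (fun k1 k2 k3 => ((freq k1 k2 k3)^-1%:C)%C *
  expi (freq k1 k2 k3 * t) * monomial a k1 k2 k3) (B ^+ 3) _.
apply: wbounded_dom (h _) => [k|k|k1 k2 k3]; first exact: wt_ge0.
  by rewrite /correction; case: ifP => _//; rewrite Normc.normc0 normc_ge0.
rewrite !Normc.normcM normc_real normc_expi mulr1 normcJ ler_wpM2l//.
by rewrite !exprSr expr0 mul1r; apply: ler_pM; rewrite ?mulr_ge0 ?normc_ge0//;
  apply: ler_pM; rewrite ?normc_ge0.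
Qed.

Lemma high_bounded : wbounded w (high a) B.
Proof.
apply: wbounded_dom hB => k; first exact: wt_ge0.
by rewrite /high; case: ifP => _//; rewrite Normc.normc0 normc_ge0.
Qed.

Lemma truncation_bounded : wbounded w (truncation m a) B.
Proof.
apply: wbounded_dom hB => k; first exact: wt_ge0.
by rewrite /truncation; case: ifP => _//; rewrite Normc.normc0 normc_ge0.
Qed.

(** The truncation differs from [a] by its high modes only. *)
Lemma vfield_high t : wbounded w
  (fun k => vfield omega t a k - vfield omega t (truncation m a) k)
  (3 * B ^+ 2 * wnorm w (high a)).
Proof.
apply: vfield_lip; [exact: wt_ge1|exact: wt_mul|exact: hB|exact: truncation_bounded|].
have := wbounded_wnorm (wbounded_wl1 high_bounded).
apply: wbounded_dom => k; first exact: wt_ge0.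
by rewrite /high /truncation; case: ifP => _; rewrite ?subrr ?subr0.
Qed.

Lemma residual_bounded t : wbounded w (residual t a (vfield omega t a))
  (3 * B ^+ 2 * wnorm w (high a) + small_divisors * (9 * B ^+ 5)).
Proof.
have v1 k : normc (vfield omega t a k) <= 3 * B ^+ 3.
  have := wbounded_term k (vfield_bounded omega (@wt_ge1 R n) (@wt_mul R n) t hB).
  by apply: le_trans; rewrite ler_peMl ?normc_ge0// wt_ge1.
have C0 : 0 <= 3 * B ^+ 3 by rewrite mulr_ge0 ?exprn_ge0.
have := @triple_bounded (fun k1 k2 k3 => ((freq k1 k2 k3)^-1%:C)%C *
  expi (freq k1 k2 k3 * t) * dmonomial a (vfield omega t a) k1 k2 k3) (9 * B ^+ 5) _.
move=> h; apply: wbounded_dom (wboundedB _ (vfield_high t) (h _)).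
- exact: wt_ge0.
- by move=> k; rewrite /residual; case: ifP => _//; rewrite Normc.normc0 normc_ge0.
- exact: wt_ge0.
move=> k1 k2 k3; rewrite !Normc.normcM normc_real normc_expi mulr1 ler_wpM2l//.
rewrite /dmonomial; move: (vfield omega t a) v1 => v v1.
have p3 (x y z p q r : R) : 0 <= x <= p -> 0 <= y <= q -> 0 <= z <= r -> x * y * z <= p * q * r.
  by move=> /andP[? ?] /andP[? ?] /andP[? ?]; apply: ler_pM; rewrite ?mulr_ge0//; apply: ler_pM.
have na k : 0 <= normc (a k) <= B by rewrite normc_ge0 a1.
have nv k : 0 <= normc (v k) <= 3 * B ^+ 3 by rewrite normc_ge0 v1.
apply: le_trans (ler_normcD _ _) _.
apply: le_trans (lerD (ler_normcD _ _) (lexx _)) _.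
rewrite !Normc.normcM !normcJ.
have h1 := p3 _ _ _ _ _ _ (nv k1) (na k2) (na k3).
have h2 := p3 _ _ _ _ _ _ (na k1) (nv k2) (na k3).
have h3 := p3 _ _ _ _ _ _ (na k1) (na k2) (nv k3).
by apply: le_trans (lerD (lerD h1 h2) h3) _; apply: eq_ler; ring.
Qed.

(** The energy of the low modes is invariant under the low-mode interaction, so
only interactions with a high mode contribute. *)
Lemma low_energy_rate t :
  2 * \sum_(k <- Q) Re ((a k)^*%C * vfield omega t a k) <= 6 * B ^+ 3 * wnorm w (high a).
Proof.
have E : \sum_(k <- Q) Re ((a k)^*%C * vfield omega t (truncation m a) k) = 0.
  rewrite -Re_sum; have := fcub_energy m (lflow omega t (truncation m a)) => Im0.
  transitivity (Re ('i%C * \sum_(k <- Q) (lflow omega t (truncation m a) k)^*%C *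
    fcub m (lflow omega t (truncation m a)) k)); last first.
    by rewrite ReM Im0 /= mul0r mulr0 subr0.
  congr (Re _); rewrite mulr_sumr; apply: eq_big_seq => k kQ.
  rewrite /vfield (@nonlin_box _ m); last first.
    by move=> j jQ; rewrite /lflow /truncation (negbTE jQ) mulr0.
  have -> : lflow omega t (truncation m a) k = expi (lam k * t) * a k.
    by rewrite /lflow /truncation kQ.
  by rewrite conjcM expiJ; move: (fcub _ _ _) => z; ring.
have -> : \sum_(k <- Q) Re ((a k)^*%C * vfield omega t a k) = \sum_(k <- Q)
    Re ((a k)^*%C * (vfield omega t a k - vfield omega t (truncation m a) k)).
  transitivity (\sum_(k <- Q) Re ((a k)^*%C * vfield omega t a k) -
      \sum_(k <- Q) Re ((a k)^*%C * vfield omega t (truncation m a) k)).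
    exact: (esym (etrans (congr1 (fun z => _ - z) E) (subr0 _))).
  rewrite -sumrB; apply: eq_bigr => k _.
  by rewrite -ReB -mulrBr.
have hv := vfield_high t (box_uniq m); rewrite /wsum in hv.
have h : \sum_(k <- Q) Re ((a k)^*%C * (vfield omega t a k - vfield omega t (truncation m a) k))
    <= B * \sum_(k <- Q) w k * normc (vfield omega t a k - vfield omega t (truncation m a) k).
  rewrite mulr_sumr; apply: ler_sum => k _.
  apply: le_trans (le_trans (ler_norm _) (ler_Re_normc _)) _.
  rewrite Normc.normcM normcJ; apply: ler_pM; rewrite ?normc_ge0//.
  by rewrite ler_peMl ?normc_ge0// wt_ge1.
have := le_trans h (ler_wpM2l B0 hv); move: (\sum_(k <- Q) _) => s hs.
apply: le_trans (ler_wpM2l _ hs) _ => //.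
by apply: eq_ler; ring.
Qed.

End Bounds.
End NormalForm.

(** * Long-time solutions for small low-frequency data *)

Section LongTime.
Variables (R : realType) (omega : R * R).
Hypothesis irr : irrational_vector omega.
Variables (n m : nat).
Hypothesis n2 : (2 <= n)%N.
Notation w := (@wt R n).
Notation Q := (box m).
Notation lam := (eigenvalue2 omega).
Implicit Types (a : R -> lattice -> R[i]) (t u eps : R).

Definition energy (b : lattice -> R[i]) : R := \sum_(k <- Q) normc (b k) ^+ 2.

Definition low_weight : R := \sum_(k <- Q) w k.

(** The radius of the ball in the continuity argument is [ball_factor * eps]. Each
low mode is at most [2 * eps], which uses up half of it. *)
Definition ball_factor : R := 4 * low_weight.

Definition high_factor : R := (2 * (small_divisors omega n m * ball_factor ^+ 3) +
  small_divisors omega n m * (9 * ball_factor ^+ 5)) * expR (3 * ball_factor ^+ 2).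

Definition eps_threshold : R :=
  ((2 * ball_factor ^+ 3 + 1) * (high_factor + 1))^-1.

Lemma low_weight_ge1 : 1 <= low_weight.
Proof.
have q0 : (0, 0) \in Q by rewrite mem_box.
rewrite /low_weight (bigD1_seq (0, 0)) ?box_uniq//= -[leLHS]addr0; apply: lerD.
  exact: wt_ge1.
by apply: sumr_ge0 => k _; exact: wt_ge0.
Qed.

Lemma ball_factor_ge0 : 0 <= ball_factor.
Proof. by rewrite mulr_ge0// (le_trans ler01 low_weight_ge1). Qed.

Lemma high_factor_ge0 : 0 <= high_factor.
Proof.
have K0 := ball_factor_ge0; have S0 := small_divisors_ge0 omega n m.
by rewrite mulr_ge0 ?expR_ge0// addr_ge0// mulr_ge0// mulr_ge0// exprn_ge0.
Qed.

Lemma eps_threshold_gt0 : 0 < eps_threshold.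
Proof.
have K0 := ball_factor_ge0; have C0 := high_factor_ge0.
by rewrite invr_gt0 mulr_gt0// ltr_wpDl// mulr_ge0// exprn_ge0.
Qed.

Lemma eps_small eps : 0 < eps < eps_threshold ->
  2 * ball_factor ^+ 3 * high_factor * eps ^+ 2 <= 1 /\ high_factor * eps ^+ 2 <= 1.
Proof.
have K0 := ball_factor_ge0; have C0 := high_factor_ge0.
have K3 : 0 <= ball_factor ^+ 3 by rewrite exprn_ge0.
have D1 : 1 <= (2 * ball_factor ^+ 3 + 1) * (high_factor + 1).
  by rewrite -[leLHS]mulr1 ler_pM// lerDr// mulr_ge0.
rewrite /eps_threshold => /andP[e0 eD]; have D0 := lt_le_trans ltr01 D1.
have h : eps * ((2 * ball_factor ^+ 3 + 1) * (high_factor + 1)) <= 1.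
  by rewrite -ler_pdivlMr// mul1r ltW.
have e1 : eps <= 1 by apply: le_trans h; rewrite ler_peMr// ltW.
have ee : eps ^+ 2 <= eps by rewrite expr2 ler_piMl// ltW.
move: (ball_factor ^+ 3) (high_factor) K3 C0 h {K0 D1 D0 eD} => K C K0 C0 h.
have KC := mulr_ge0 K0 C0.
have h1 : 2 * K * C * eps + C * eps <= 1.
  apply: le_trans h; have -> : eps * ((2 * K + 1) * (C + 1)) =
    2 * K * C * eps + C * eps + (2 * K * eps + eps) by ring.
  by rewrite lerDl addr_ge0 ?mulr_ge0// ltW.
have h2 : 0 <= 2 * K * C * eps by rewrite !mulr_ge0// ltW.
have h3 : 0 <= C * eps by rewrite mulr_ge0// ltW.
have h4 : 2 * K * C * eps ^+ 2 <= 2 * K * C * eps by rewrite ler_wpM2l// !mulr_ge0.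
have h5 : C * eps ^+ 2 <= C * eps by rewrite ler_wpM2l.
by split; lra.
Qed.

Section APriori.
Variables (a : R -> lattice -> R[i]) (Lam eps t : R).
Let B := ball_factor * eps.
Hypothesis eps0 : 0 < eps.
Hypothesis t_ge0 : 0 <= t.
Hypothesis t_le : t * eps ^+ 2 <= 1.
Hypothesis lip : forall u v, wbounded w (fun k => a u k - a v k) (Lam * `|u - v|).
Hypothesis aB : forall u, 0 <= u <= t -> wbounded w (a u) B.
Hypothesis da : forall u k, 0 < u < t ->
  is_cderive (fun v => a v k) u (vfield omega u (a u) k).
Hypothesis low0 : forall k, k \notin Q -> a 0 k = 0.

Let B0 : 0 <= B. Proof. by rewrite mulr_ge0 ?ball_factor_ge0// ltW. Qed.

Lemma lip_wctn (z : R -> lattice -> R[i]) T : (forall u v k, normc (z u k - z v k) <=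
  normc (a u k - a v k)) -> wctn w T z.
Proof.
move=> hz u _ e e0; pose d := e / (`|Lam| + 1).
have K1 : 0 < `|Lam| + 1 by rewrite ltr_wpDl.
exists d; first by rewrite divr_gt0.
move=> r _ ru; apply: (wbounded_dom _ (fun k => hz r u k)); first exact: wt_ge0.
apply: wbounded_le (lip r u); apply: (@le_trans _ _ ((`|Lam| + 1) * `|r - u|)).
  by rewrite ler_wpM2r// (le_trans (ler_norm Lam))// lerDl.
by rewrite mulrC -ler_pdivlMr// ltW.
Qed.

Lemma lip_continuous k A : ccontinuous (fun u => a u k) A.
Proof.
have [|c1 c2] := @loc_lip_continuous R (fun u => a u k).
  move=> u; exists Lam => r _; have := wbounded_term k (lip r u).
  by apply: le_trans; rewrite ler_peMl ?normc_ge0// wt_ge1.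
by split; apply: continuous_subspaceT.
Qed.

Lemma correction_continuous k A :
  ccontinuous (fun u => high m (a u) k - correction omega m u (a u) k) A.
Proof.
rewrite /high /correction; case: (k \in Q).
  by apply: ccontinuousB; exact: ccontinuous_cst.
apply: ccontinuousB; first exact: lip_continuous.
do 3 (apply: ccontinuous_sum => ?).
apply: ccontinuousM; last exact: ccontinuous_cst.
apply: ccontinuousM.
  apply: ccontinuousM; first exact: ccontinuous_cst.
  exact: is_cderive_ccontinuous (is_cderive_expi _).
by rewrite /monomial; apply: ccontinuousM; [apply: ccontinuousM|apply: ccontinuousJ];
  exact: lip_continuous.
Qed.

(** Gronwall's inequality with the correction of order [B ^ 3], the remainder of order
[B ^ 5] acting for a time [eps ^- 2], and the rate [3 B ^ 2], whose product with
the time stays bounded. *)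
Lemma high_estimate u : 0 <= u <= t -> wnorm w (high m (a u)) <= high_factor * eps ^+ 3.
Proof.
move=> ut; have S0 := small_divisors_ge0 omega n m.
have K0 := ball_factor_ge0.
have be0 : 0 <= small_divisors omega n m * (9 * B ^+ 5).
  by rewrite mulr_ge0// mulr_ge0// exprn_ge0.
have ga0 : 0 <= small_divisors omega n m * B ^+ 3 by rewrite mulr_ge0// exprn_ge0.
have L0 : 0 <= 3 * B ^+ 2 by rewrite mulr_ge0// exprn_ge0.
have := @seq_gronwall R _ w (@wt_ge0 R n) (fun u => high m (a u))
  (fun u => correction omega m u (a u))
  (fun u => residual omega m u (a u) (vfield omega u (a u)))
  (3 * B ^+ 2) (small_divisors omega n m * (9 * B ^+ 5))
  (small_divisors omega n m * B ^+ 3) t L0 be0 ga0 _ _ _ _ _ _ u ut.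
move=> G; apply: le_trans (G _ _ _ _ _ _) _.
- apply: wctn_wnorm; first exact: wt_ge0.
    by move=> v vt; exact: wbounded_wl1 (high_bounded m (aB vt)).
  apply: lip_wctn => v1 v2 k; rewrite /high; case: ifP => _ //.
  by rewrite subrr Normc.normc0 normc_ge0.
- by move=> k; rewrite /high; case: ifPn => // /low0.
- move=> k v vt; apply: (correction_cderive irr) => // j; exact: da.
- by move=> k; exact: correction_continuous.
- by move=> v vt; apply: correction_bounded; exact: aB.
- move=> v /andP[v0 vt]; apply: residual_bounded; apply: aB.
  by rewrite (ltW v0) (ltW vt).
have hE : expR (3 * B ^+ 2 * u) <= expR (3 * ball_factor ^+ 2).
  rewrite ler_expR; have -> : 3 * B ^+ 2 * u = 3 * ball_factor ^+ 2 * (u * eps ^+ 2).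
    by rewrite /B; ring.
  have K2 : 0 <= 3 * ball_factor ^+ 2 by rewrite mulr_ge0// sqr_ge0.
  rewrite ler_piMr//; apply: le_trans t_le.
  by rewrite ler_wpM2r ?sqr_ge0//; case/andP: ut.
have hA : 2 * (small_divisors omega n m * B ^+ 3) + small_divisors omega n m * (9 * B ^+ 5) * t
    <= (2 * (small_divisors omega n m * ball_factor ^+ 3) +
    small_divisors omega n m * (9 * ball_factor ^+ 5)) * eps ^+ 3.
  rewrite [leRHS]mulrDl; apply: lerD.
    by rewrite /B; apply: eq_ler; ring.
  have -> : small_divisors omega n m * (9 * B ^+ 5) * t =
      small_divisors omega n m * (9 * ball_factor ^+ 5) * eps ^+ 3 * (t * eps ^+ 2).
    by rewrite /B; ring.
  have P0 : 0 <= small_divisors omega n m * (9 * ball_factor ^+ 5) * eps ^+ 3.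
    apply: mulr_ge0; last by rewrite exprn_ge0// ltW.
    by rewrite mulr_ge0// mulr_ge0// exprn_ge0.
  by rewrite ler_piMr.
apply: le_trans (ler_pM _ _ hA hE) _.
- by rewrite addr_ge0// mulr_ge0.
- exact: expR_ge0.
- by rewrite /high_factor; apply: eq_ler; ring.
Qed.

Lemma energyE (b : lattice -> R[i]) : energy b = Re (\sum_(k <- Q) (b k)^*%C * b k).
Proof. by rewrite Re_sum; apply: eq_bigr => k _; rewrite normc_conjM. Qed.

(** The rate of change is at most [6 B ^ 3] times the high part, hence of order
[eps ^ 6]; over the time [eps ^- 2] this is small compared with [eps ^ 2]. *)
Lemma energy_estimate : energy (a 0) <= eps ^+ 2 ->
  2 * ball_factor ^+ 3 * high_factor * eps ^+ 2 <= 1 ->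
  energy (a t) <= 4 * eps ^+ 2.
Proof.
move=> E0 small; pose M := 6 * B ^+ 3 * (high_factor * eps ^+ 3).
pose Y u := \sum_(k <- Q) (a u k)^*%C * a u k.
pose dY u := \sum_(k <- Q) ((vfield omega u (a u) k)^*%C * a u k +
  (a u k)^*%C * vfield omega u (a u) k).
have dYY u : 0 < u < t -> is_cderive Y u (dY u).
  by move=> ut; apply: is_cderive_sum => k; apply: is_cderiveM;
    [apply: is_cderiveJ|]; exact: da.
have cY : ccontinuous Y `[0, t].
  by apply: ccontinuous_sum => k; apply: ccontinuousM; [apply: ccontinuousJ|];
    exact: lip_continuous.
have inc : Re (Y t) - Re (Y 0) <= M * t - M * 0.
  apply: (@derive_le_increment R (fun u => Re (Y u)) (fun u => Re (dY u))
    (fun u => M * u) (fun=> M * 1)) => //.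
  - by move=> u /dYY [].
  - by case: cY.
  - by apply/continuous_subspaceT => u; apply: cvgM; [exact: cvg_cst|exact: cvg_id].
  move=> u /andP[u0 ut]; have utt : 0 <= u <= t by rewrite (ltW u0) (ltW ut).
  have -> : Re (dY u) = 2 * \sum_(k <- Q) Re ((a u k)^*%C * vfield omega u (a u) k).
    rewrite /dY Re_sum mulr_sumr; apply: eq_bigr => k _.
    by move: (vfield _ _ _ _) => z; rewrite ReD !ReM !ReJ !ImJ; ring.
  rewrite mulr1; apply: le_trans (low_energy_rate omega m (aB utt) u) _.
  by rewrite ler_wpM2l ?high_estimate// mulr_ge0// exprn_ge0.
have MT : M * t <= 3 * eps ^+ 2.
  have -> : M * t = 6 * ball_factor ^+ 3 * high_factor * eps ^+ 4 * (t * eps ^+ 2).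
    by rewrite /M /B; ring.
  apply: (@le_trans _ _ (6 * ball_factor ^+ 3 * high_factor * eps ^+ 4)).
    have P0 : 0 <= 6 * ball_factor ^+ 3 * high_factor * eps ^+ 4.
      apply: mulr_ge0; last by rewrite exprn_ge0// ltW.
      by rewrite mulr_ge0 ?high_factor_ge0// mulr_ge0// exprn_ge0 ?ball_factor_ge0.
    by rewrite ler_piMr.
  have -> : 6 * ball_factor ^+ 3 * high_factor * eps ^+ 4 =
    3 * eps ^+ 2 * (2 * ball_factor ^+ 3 * high_factor * eps ^+ 2) by ring.
  by rewrite ler_piMr// mulr_ge0// sqr_ge0.
rewrite !energyE in E0 *; rewrite -/(Y t); rewrite -/(Y 0) in E0; lra.
Qed.

(** The low part is controlled by the energy, the high part by [high_estimate]; each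
uses at most half of the radius. *)
Lemma norm_estimate : energy (a 0) <= eps ^+ 2 ->
  2 * ball_factor ^+ 3 * high_factor * eps ^+ 2 <= 1 ->
  high_factor * eps ^+ 2 <= 1 -> wnorm w (a t) < B.
Proof.
move=> E0 small1 small2; have E := energy_estimate E0 small1.
have low k : k \in Q -> normc (a t k) <= 2 * eps.
  move=> kQ; have : normc (a t k) ^+ 2 <= (2 * eps) ^+ 2.
    have -> : (2 * eps) ^+ 2 = 4 * eps ^+ 2 by ring.
    apply: le_trans E; rewrite /energy (bigD1_seq k) ?box_uniq//= lerDl.
    by apply: sumr_ge0 => j _; exact: sqr_ge0.
  by rewrite ler_pXn2r ?nnegrE ?normc_ge0// mulr_ge0// ltW.
have tt : 0 <= t <= t by rewrite t_ge0 lexx.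
have hH := high_estimate tt.
have H1 := wbounded_wnorm (wbounded_wl1 (high_bounded m (aB tt))).
have tr0 k : k \notin Q -> truncation m (a t) k = 0.
  by move=> kQ; rewrite /truncation (negbTE kQ).
have H2 := wbounded_box (@wt_ge0 R n) tr0.
have low2 : wsum w (truncation m (a t)) Q <= 2 * (low_weight * eps).
  have -> : 2 * (low_weight * eps) = 2 * eps * low_weight by ring.
  rewrite /wsum mulr_sumr !big_seq; apply: ler_sum => k kQ.
  by rewrite /truncation kQ mulrC ler_wpM2r ?wt_ge0// low.
have h : wnorm w (a t) <= wsum w (truncation m (a t)) Q + wnorm w (high m (a t)).
  apply: wnorm_le => A uA; have := wboundedD (@wt_ge0 R n) H2 H1 uA; congr (_ <= _).
  apply: eq_bigr => k _; rewrite /truncation /high.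
  by case: ifP => _; rewrite ?addr0 ?add0r.
have W1 := low_weight_ge1.
have e3 : high_factor * eps ^+ 3 <= eps.
  by rewrite exprSr mulrA ler_piMl// ltW.
have We : eps <= low_weight * eps by rewrite ler_peMl// ltW.
rewrite /B /ball_factor -mulrA; apply: le_lt_trans h _.
have We0 : 0 < low_weight * eps by apply: lt_le_trans We.
lra.
Qed.

End APriori.

(** As long as the truncated solution stays in the ball it solves the original
equation, and the a priori bounds keep it strictly inside: the continuity argument
reaches the time [1 / eps ^ 2]. *)
Lemma long_time_solution (a0 : lattice -> R[i]) eps :
  0 < eps < eps_threshold -> (forall k, k \notin Q -> a0 k = 0) ->
  energy a0 <= eps ^+ 2 ->
  exists a : R -> lattice -> R[i], exists Lam,
  [/\ forall k, a 0 k = a0 k,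
      forall t, wl1 w (a t),
      forall u v, wbounded w (fun k => a u k - a v k) (Lam * `|u - v|),
      forall u k, 0 < u < 1 / eps ^+ 2 ->
        is_cderive (fun v => a v k) u (vfield omega u (a u) k) &
      forall u k, 0 <= u <= 1 / eps ^+ 2 -> k \notin Q ->
        normc (a u k) <= high_factor * eps ^+ 3].
Proof.
move=> epsI a00 E0; have [s1 s2] := eps_small epsI; have /andP[e0 _] := epsI.
have [p1 p2 _] := irr; have W1 := low_weight_ge1.
pose B := ball_factor * eps.
have B0 : 0 < B by rewrite !mulr_gt0// (lt_le_trans ltr01).
have l0 : wl1 w a0 by exists (wsum w a0 Q); apply: wbounded_box => //; exact: wt_ge0.
have [a [ai al lip da]] := truncated_solution p1 p2 n2 B0 l0.
have a0E : a 0 = a0 by apply/funext.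
pose T := 1 / eps ^+ 2.
have tT t : t <= T -> t * eps ^+ 2 <= 1.
  by move=> tT; rewrite -ler_pdivlMr// exprn_gt0.
have dav t : (forall u, 0 <= u <= t -> wbounded w (a u) B) -> forall u k, 0 < u < t ->
    is_cderive (fun v => a v k) u (vfield omega u (a u) k).
  move=> hB u k /andP[u0 ut]; apply: is_cderive_eq; first exact: da.
  have uu : 0 <= u <= t by rewrite (ltW u0) (ltW ut).
  by rewrite /tfield (cutoff1 B0 (wnorm_le (hB u uu))) mul1r.
have lowE k : k \notin Q -> a 0 k = 0 by rewrite a0E; exact: a00.
have E0' : energy (a 0) <= eps ^+ 2 by rewrite a0E.
have cu : ctn T (fun t => wnorm w (a t)).
  apply: wctn_wnorm; [exact: wt_ge0|by move=> *; exact: al|].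
  exact: (lip_wctn lip).
have init : wnorm w (a 0) <= B.
  have low k : k \in Q -> normc (a 0 k) <= eps.
    move=> kQ; have : normc (a 0 k) ^+ 2 <= eps ^+ 2.
      apply: le_trans E0'; rewrite /energy (bigD1_seq k) ?box_uniq//= lerDl.
      by apply: sumr_ge0 => j _; exact: sqr_ge0.
    by rewrite ler_pXn2r ?nnegrE ?normc_ge0// ltW.
  apply: le_trans (wnorm_le (wbounded_box (@wt_ge0 R n) lowE)) _.
  apply: (@le_trans _ _ (eps * low_weight)).
    rewrite /wsum mulr_sumr !big_seq; apply: ler_sum => k kQ.
    by rewrite mulrC ler_wpM2r ?wt_ge0// low.
  by rewrite /B /ball_factor; nra.
have main : forall t, 0 <= t <= T -> wnorm w (a t) < B.
  apply: (@continuity_bootstrap R T (fun t => wnorm w (a t)) (fun=> B)) => //.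
    by move=> t _ e e1; exists 1 => // r _ _; rewrite subrr normr0 ltW.
  move=> t tT' IH; have /andP[t0 tle] := tT'.
  have atB : wnorm w (a t) <= B.
    have [->//|tn0] := eqVneq t 0; have t1 : 0 < t by rewrite lt_neqAle eq_sym tn0.
    rewrite leNgt; apply/negP => Bt.
    have [|d d0 hd] := cu t tT' ((wnorm w (a t) - B) / 2).
      by rewrite divr_gt0// subr_gt0.
    pose r := Num.max 0 (t - d / 2).
    have r0 : 0 <= r by rewrite le_max lexx.
    have rt : r < t by rewrite gt_max t1/=; lra.
    have := hd r; rewrite r0 (le_trans (ltW rt) tle) => /(_ isT).
    have rd : `|r - t| < d.
      rewrite distrC ger0_norm ?subr_ge0 ?(ltW rt)// ltrBlDr -ltrBlDl lt_max.
      by apply/orP; right; lra.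
    move=> /(_ rd); have := IH r; rewrite r0 rt => /(_ isT) rB.
    by rewrite ler_norml => /andP[? ?]; lra.
  have hB u : 0 <= u <= t -> wbounded w (a u) B.
    move=> /andP[u0]; rewrite le_eqVlt => /predU1P[->|ut].
      exact: wbounded_le atB (wbounded_wnorm (al t)).
    by apply: wbounded_le (wbounded_wnorm (al u)); rewrite IH// u0.
  exact: (norm_estimate e0 t0 (tT t tle) lip hB (dav t hB) lowE E0' s1 s2).
have hB t : t <= T -> forall u, 0 <= u <= t -> wbounded w (a u) B.
  move=> tT' u /andP[u0 ut]; apply: wbounded_le (wbounded_wnorm (al u)).
  by rewrite ltW// main// u0 (le_trans ut).
exists a, (24 * B ^+ 3); split => //.
- by move=> u k uT; apply: (dav T) => //; exact: hB.
- move=> u k /andP[u0 uT] kQ.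
  have uu : 0 <= u <= u by rewrite u0 lexx.
  have := high_estimate e0 u0 (tT u uT) lip (hB u uT) (dav u (hB u uT)) lowE uu.
  apply: le_trans; have := wbounded_term k (wbounded_wnorm (wbounded_wl1
    (high_bounded m (hB u uT u uu)))).
  rewrite /high (negbTE kQ); apply: le_trans.
  by rewrite ler_peMl ?normc_ge0// wt_ge1.
Qed.

End LongTime.

(** * Sobolev norms and summable Fourier coefficients *)

Section Sobolev.
Variables (R : realType) (s : R).
Implicit Types (f : R * R -> R[i]) (k : lattice) (A : seq lattice).

Definition sobolev_weight k : R := japanese R k `^ (2 * s).

Lemma sobolev_weight_ge0 k : 0 <= sobolev_weight k. Proof. exact: powR_ge0. Qed.

Definition sobolev_sum f A : R :=
  \sum_(k <- A) normc (fourier f k) ^+ 2 * sobolev_weight k.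

Lemma sobolev_sum_le f A r : 0 <= r -> (sobolev_norm s f <= r%:E)%E -> uniq A ->
  sobolev_sum f A <= r ^+ 2.
Proof.
move=> r0 h uA; move: h; rewrite /sobolev_norm.
set E := esum _ _ => h.
have : ((sobolev_sum f A)%:E <= E)%E.
  apply: esum_ge; exists [set` A]; first by split => //; exact: finite_seq.
  by rewrite -fsbig_seq//= /sobolev_sum -sumEFin.
have E0 : (0 <= E)%E.
  by apply: esum_ge0 => k _; rewrite lee_fin mulr_ge0 ?sqr_ge0 ?sobolev_weight_ge0.
case: E E0 h => [e| |]//=; last first.
  by move=> _; rewrite invr_eq0 pnatr_eq0/= leye_eq.
rewrite !lee_fin => e0; rewrite powR12_sqrt// => h eA; apply: le_trans eA _.
by rewrite -(sqr_sqrtr e0) lerXn2r ?nnegrE ?sqrtr_ge0.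
Qed.

Lemma sobolev_norm_le f r : 0 <= r -> (forall A, uniq A -> sobolev_sum f A <= r ^+ 2) ->
  (sobolev_norm s f <= r%:E)%E.
Proof.
move=> r0 h; rewrite /sobolev_norm; set E := esum _ _.
have : (E <= (r ^+ 2)%:E)%E.
  apply: ge_ereal_sup => _ [X [fX _] <-]; rewrite fsbig_finite//= sumEFin lee_fin.
  exact/h/finmap.fset_uniq.
have E0 : (0 <= E)%E.
  by apply: esum_ge0 => k _; rewrite lee_fin mulr_ge0 ?sqr_ge0 ?sobolev_weight_ge0.
case: E E0 => [e| |]//=; rewrite !lee_fin => e0 he.
rewrite powR12_sqrt// -(sqr_sqrtr e0) in he *.
by rewrite -(ler_pXn2r (n := 2))// ?nnegrE ?sqrtr_ge0// sqr_sqrtr.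
Qed.

Lemma japanese_ge1 k : 1 <= japanese R k.
Proof. by rewrite -sqrtr1 ler_wsqrtr// lerDr addr_ge0 ?sqr_ge0. Qed.

Lemma sobolev_weight_ge1 k : 0 <= s -> 1 <= sobolev_weight k.
Proof.
by move=> s0; rewrite -(powRr0 (japanese R k)) ler_powR ?japanese_ge1 ?mulr_ge0.
Qed.

Lemma sobolev_weight_wt n k : s <= n%:R -> sobolev_weight k <= wt R n k ^+ 2.
Proof.
move=> sn; have j1 := japanese_ge1 k; rewrite /sobolev_weight.
apply: le_trans (ler_powR j1 (_ : _ <= (2 * n)%:R)) _.
  by rewrite natrM ler_wpM2l.
rewrite powR_mulrn ?(le_trans ler01)// /wt -exprM [X in _ <= _ ^+ X]mulnC !exprM.
rewrite lerXn2r ?nnegrE ?sqr_ge0// /japanese sqr_sqrtr ?addr_ge0 ?sqr_ge0//.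
by apply: le_trans (jw_sqr R k); rewrite [leLHS]addrC addrA.
Qed.

(** By [sum x ^ 2 <= B * sum x], an l^1 bound by [B] is also an l^2 bound by [B]. *)
Lemma sobolev_norm_wt f n B : s <= n%:R -> wbounded (wt R n) (fourier f) B ->
  (sobolev_norm s f <= B%:E)%E.
Proof.
move=> sn hB; have B0 := wbounded_ge0 hB.
apply: sobolev_norm_le => // A uA.
apply: (@le_trans _ _ (B * wsum (wt R n) (fourier f) A)); last first.
  by rewrite expr2 ler_wpM2l// hB.
rewrite /wsum mulr_sumr; apply: ler_sum => k _.
apply: le_trans (ler_wpM2l (sqr_ge0 _) (sobolev_weight_wt k sn)) _.
rewrite -exprMn mulrC expr2; have h := wbounded_term k hB.
by rewrite ler_wpM2r// mulr_ge0 ?normc_ge0 ?wt_ge0.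
Qed.

Lemma sobolev_energy f m r : 0 <= s -> 0 <= r -> (sobolev_norm s f <= r%:E)%E ->
  energy m (fourier f) <= r ^+ 2.
Proof.
move=> s0 r0 h; apply: le_trans (sobolev_sum_le r0 h (box_uniq m)).
by apply: ler_sum => k _; rewrite ler_peMr ?sqr_ge0 ?sobolev_weight_ge1.
Qed.

End Sobolev.

Lemma ler_sum_uniq_sub (R : numDomainType) (I : eqType) (A B : seq I) (F : I -> R) :
  uniq A -> uniq B -> {subset A <= B} -> (forall i, 0 <= F i) ->
  \sum_(i <- A) F i <= \sum_(i <- B) F i.
Proof.
move=> uA uB AB F0; rewrite [leRHS](bigID (mem A))/= -[leLHS]addr0.
apply: lerD; last exact: sumr_ge0.
rewrite -[leRHS]big_filter; apply: eq_ler; apply: perm_big; apply: uniq_perm; rewrite ?filter_uniq// => i.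
by rewrite mem_filter; case iA : (i \in A) => //=; rewrite AB.
Qed.

Section Embedding.
Variables (R : realType) (s : R).
Hypothesis s1 : 1 < s.
Implicit Types (f : R * R -> R[i]) (k : lattice) (A : seq lattice).

(** The one-variable factor of a summable majorant of [(sobolev_weight s k)^-1]. *)
Definition decay (j : nat) : R := (1 + j%:R) `^ (- s).

Let s10 : 0 < s - 1. Proof. by rewrite subr_gt0. Qed.

Lemma decay_ge0 j : 0 <= decay j. Proof. exact: powR_ge0. Qed.

(** The integral test, with the primitive [x `^ (1 - s) / (1 - s)] of [x `^ (- s)]. *)
Lemma decay_telescope j : decay j.+1 <=
  ((1 + j%:R) `^ (1 - s) - (1 + j.+1%:R) `^ (1 - s)) / (s - 1).
Proof.
set a : R := 1 + j%:R; have a0 : 0 < a by rewrite ltr_pwDl.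
have -> : (1 + j.+1%:R : R) = a + 1 by rewrite /a -addn1 natrD addrA.
have E : decay j.+1 = (a + 1) `^ (- s) by rewrite /decay -addn1 natrD addrA.
have D (x : R) : a < x < a + 1 ->
    is_derive x (1 : R) (fun y => y `^ (1 - s)) ((1 - s) * x `^ (- s)).
  case/andP=> ax _; have x0 : 0 < x by apply: lt_trans ax.
  have := is_derive1_powR (1 - s) x0; congr (is_derive _ _ _ (_ * _ `^ _)); ring.
have Dl (x : R) : a < x < a + 1 ->
    is_derive x (1 : R) (fun y => (1 - s) * decay j.+1 * y) ((1 - s) * decay j.+1).
  by move=> _; apply: is_derive_eq; rewrite /GRing.scale/= mulr1 ?mulr0 ?addr0.
have aa : a <= a + 1 by rewrite lerDl.
have C : {within `[a, a + 1], continuous (fun y => y `^ (1 - s))}.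
  apply: continuous_in_subspaceT => x; rewrite inE/= in_itv/= => /andP[ax _].
  have x0 : 0 < x by apply: lt_le_trans ax.
  by apply/differentiable_continuous/derivable1_diffP; apply: derivable_powR;
    rewrite in_itv/= x0.
have Cl : {within `[a, a + 1], continuous (fun y => (1 - s) * decay j.+1 * y)}.
  by apply: continuous_subspaceT => x; apply: cvgM; [exact: cvg_cst|exact: cvg_id].
have := derive_le_increment aa D Dl C Cl.
have -> : (1 - s) * decay j.+1 * (a + 1) - (1 - s) * decay j.+1 * a =
  (1 - s) * decay j.+1 by ring.
move=> h; rewrite ler_pdivlMr//.
have {h} : (a + 1) `^ (1 - s) - a `^ (1 - s) <= (1 - s) * decay j.+1.
  apply: h => x /andP[ax xa]; rewrite ler_wnM2l ?subr_le0 ?(ltW s1)// E.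
  have x0 : 0 < x by apply: lt_trans ax.
  rewrite !powRN lef_pV2 ?posrE ?powR_gt0 ?(lt_trans x0 xa)//.
  apply: ge0_ler_powR; rewrite ?nnegrE ?(ltW x0) ?(ltW xa)//.
    by rewrite (le_trans ler01) ?ltW.
  by rewrite (le_trans (ltW x0)) ?ltW.
move: (decay j.+1) ((a + 1) `^ (1 - s)) (a `^ (1 - s)) => d p q h.
have -> : d * (s - 1) = - ((1 - s) * d) by ring.
by rewrite lerNl opprB.
Qed.

Lemma decay_sum n : \sum_(0 <= j < n) decay j <= s / (s - 1).
Proof.
have s0 : 0 < s by apply: lt_trans s1.
suff h m : \sum_(0 <= j < m.+1) decay j <= (s - (1 + m%:R) `^ (1 - s)) / (s - 1).
  case: n => [|n]; first by rewrite big_nil divr_ge0 ?ltW.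
  by apply: le_trans (h n) _; rewrite ler_pM2r ?invr_gt0// gerBl powR_ge0.
elim: m => [|m IH].
  rewrite big_nat1 /decay addr0 powR1 divff//; by rewrite gt_eqF.
rewrite big_nat_recr//=; apply: le_trans (lerD IH (decay_telescope m)) _.
rewrite -mulrDl; apply/eq_ler; congr (_ / _); ring.
Qed.

Lemma decay_box n : \sum_(k <- box n) decay (absz k.1) * decay (absz k.2) <=
  (2 * s / (s - 1)) ^+ 2.
Proof.
rewrite /box; set r := map (fun m => Posz m - n%:Z) _; rewrite big_allpairs_dep/=.
have -> : \sum_(i <- r) \sum_(j <- r) decay (absz i) * decay (absz j) =
    (\sum_(i <- r) decay (absz i)) ^+ 2.
  by rewrite expr2 mulr_suml; apply: eq_bigr => i _; rewrite mulr_sumr.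
have C0 : 0 <= 2 * s / (s - 1).
  by rewrite divr_ge0 ?mulr_ge0 ?ltW// (lt_trans _ s1).
rewrite lerXn2r ?nnegrE//; first by apply: sumr_ge0 => i _; exact: decay_ge0.
rewrite /r big_map -[iota _ _]/(index_iota 0 (2 * n).+1).
rewrite (@big_cat_nat _ _ _ n)/=; [|by []|lia].
have h1 : \sum_(0 <= i < n) decay (absz (Posz i - n%:Z)) <= s / (s - 1).
  rewrite big_nat_rev/= add0n.
  have E : \sum_(0 <= i < n) decay (absz (Posz (n - i.+1)%N - n%:Z)) =
      \sum_(0 <= i < n) decay i.+1.
    apply: eq_big_nat => i /andP[_ lin]; congr decay; lia.
  rewrite E; apply: le_trans (decay_sum n.+1); rewrite big_nat_recl//.
  by rewrite lerDr decay_ge0.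
have h2 : \sum_(n <= i < (2 * n).+1) decay (absz (Posz i - n%:Z)) <= s / (s - 1).
  rewrite -[X in \sum_(X <= _ < _) _]add0n big_addn.
  have E : \sum_(0 <= i < (2 * n).+1 - n) decay (absz (Posz (i + n)%N - n%:Z)) =
      \sum_(0 <= i < (2 * n).+1 - n) decay i.
    apply: eq_big_nat => i _; congr decay; lia.
  by rewrite E decay_sum.
apply: le_trans (lerD h1 h2) _; rewrite -mulrDl.
by apply/eq_ler; congr (_ / _); ring.
Qed.

(** From (1 + a)(1 + b) <= 2 (1 + a^2 + b^2): the weight splits into one-variable
factors of exponent [s], summable because [s > 1]. *)
Lemma inv_sobolev_weight k : (sobolev_weight s k)^-1 <=
  2 `^ s * (decay (absz k.1) * decay (absz k.2)).
Proof.
have s0 : 0 < s by apply: lt_trans s1.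
pose a : R := (absz k.1)%:R; pose b : R := (absz k.2)%:R.
have a0 : 0 <= a by []. have b0 : 0 <= b by [].
have ab0 : 0 < (1 + a) * (1 + b) by rewrite mulr_gt0// ltr_pwDl.
have J2 : japanese R k ^+ 2 = a ^+ 2 + b ^+ 2 + 1.
  rewrite /japanese sqr_sqrtr ?addr_ge0 ?sqr_ge0//.
  by rewrite (sqr_abs_intr R k.1) (sqr_abs_intr R k.2) /a /b !natr_absz.
have h : (1 + a) * (1 + b) / 2 <= japanese R k ^+ 2 by
    rewrite J2; have := sqr_ge0 (a - 1); have := sqr_ge0 (b - 1); have := sqr_ge0 (a - b);
    have := sqr_ge0 a; have := sqr_ge0 b; nra.
have {h} : ((1 + a) * (1 + b) / 2) `^ s <= sobolev_weight s k.
  rewrite /sobolev_weight powRrM -[2]/(2%:R) powR_mulrn ?sqrtr_ge0//.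
  by rewrite ge0_ler_powR ?nnegrE ?sqr_ge0 ?divr_ge0 ?(ltW ab0) ?(ltW s0).
have p0 : 0 < ((1 + a) * (1 + b) / 2) `^ s by rewrite powR_gt0// divr_gt0.
move=> h; apply: (@le_trans _ _ (((1 + a) * (1 + b) / 2) `^ s)^-1).
  by rewrite lef_pV2 ?posrE// (lt_le_trans p0 h).
have h1 : 0 <= 1 + a by rewrite addr_ge0.
have h2 : 0 <= 1 + b by rewrite addr_ge0.
rewrite powRM ?(ltW ab0)// powRM// !invfM /decay !powRN -/a -/b.
have -> : (2^-1 `^ s)^-1 = 2 `^ s :> R.
  by rewrite -powRN -powR_inv1// -powRrM mulrNN mul1r.
by apply: eq_ler; ring.
Qed.

Definition embedding_factor : R := 2^-1 * (1 + 2 `^ s * (2 * s / (s - 1)) ^+ 2).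

Lemma embedding_factor_ge0 : 0 <= embedding_factor.
Proof. by rewrite mulr_ge0// addr_ge0// mulr_ge0 ?powR_ge0 ?sqr_ge0. Qed.

(** The Cauchy-Schwarz inequality against the summable [(sobolev_weight s k)^-1], in
the form [x <= x ^ 2 w / (2 r) + r / (2 w)] summed over [k]. *)
Lemma sobolev_l1 f r : 0 < r -> (sobolev_norm s f <= r%:E)%E ->
  wbounded (@one_weight R) (fourier f) (embedding_factor * r).
Proof.
move=> r0 h A uA; have W0 k : 0 < sobolev_weight s k.
  by rewrite powR_gt0// (lt_le_trans ltr01) ?japanese_ge1.
have step k : one_weight R k * normc (fourier f k) <=
    (2 * r)^-1 * (normc (fourier f k) ^+ 2 * sobolev_weight s k) +
    r / 2 * (sobolev_weight s k)^-1.
  rewrite mul1r; move: (W0 k) (normc_ge0 (fourier f k)).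
  move: (sobolev_weight s k) (normc _) => w x w0 x0.
  have -> : (2 * r)^-1 * (x ^+ 2 * w) + r / 2 * w^-1 =
      x + (2 * r * w)^-1 * (x * w - r) ^+ 2 by field; rewrite !gt_eqF.
  by rewrite lerDl mulr_ge0 ?sqr_ge0// invr_ge0 !mulr_ge0 ?ltW.
apply: le_trans (ler_sum _ (fun k _ => step k)) _.
rewrite big_split/= -!mulr_sumr.
have hA := sobolev_sum_le (ltW r0) h uA.
have hB : \sum_(k <- A) (sobolev_weight s k)^-1 <= 2 `^ s * (2 * s / (s - 1)) ^+ 2.
  have [n An] := seq_sub_box A.
  apply: (@le_trans _ _ (2 `^ s * \sum_(k <- box n) decay (absz k.1) * decay (absz k.2))).
    rewrite mulr_sumr.
    apply: le_trans (ler_sum _ (fun k _ => inv_sobolev_weight k)) _.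
    apply: (ler_sum_uniq_sub uA (box_uniq n) An) => k.
    by rewrite mulr_ge0 ?powR_ge0// mulr_ge0 ?decay_ge0.
  by rewrite ler_wpM2l ?powR_ge0 ?decay_box.
have r2 : 0 <= (2 * r)^-1 by rewrite invr_ge0 mulr_ge0 ?ltW.
have r3 : 0 <= r / 2 by rewrite divr_ge0 ?ltW.
apply: le_trans (lerD (ler_wpM2l r2 hA) (ler_wpM2l r3 hB)) _.
rewrite /embedding_factor; apply: eq_ler; field; by rewrite !gt_eqF.
Qed.

End Embedding.

(** * Smooth functions on the torus are bounded and measurable *)

Section ContinuousPlane.
Variable R : realType.
Implicit Types g : R * R -> R.

Definition grid_square (i : nat * lattice) : set (plane R) :=
  `[i.2.1%:~R / i.1.+1%:R, (i.2.1 + 1)%:~R / i.1.+1%:R[%classic `*`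
  `[i.2.2%:~R / i.1.+1%:R, (i.2.2 + 1)%:~R / i.1.+1%:R[%classic.

Lemma measurable_grid_square i : measurable (grid_square i).
Proof. by apply: measurableX; exact: measurable_itv. Qed.

(** [p] is the integer part of [n.+1 * x]. *)
Lemma grid_interval n (x : R) : exists p : int,
  [/\ p%:~R / n.+1%:R <= x, x < (p + 1)%:~R / n.+1%:R &
      forall y, p%:~R / n.+1%:R <= y < (p + 1)%:~R / n.+1%:R -> `|x - y| < n.+1%:R^-1].
Proof.
exists (Num.floor (x * n.+1%:R)).
have n0 : 0 < n.+1%:R :> R by [].
set p := Num.floor _.
have h1 : p%:~R / n.+1%:R <= x by rewrite ler_pdivrMr// floor_le.
have h2 : x < (p + 1)%:~R / n.+1%:R by rewrite ltr_pdivlMr// floorD1_gt.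
split => // y /andP[h3 h4].
have E : (p + 1)%:~R / n.+1%:R = p%:~R / n.+1%:R + n.+1%:R^-1 :> R.
  by rewrite intrD mulrDl mul1r.
have gen (a b : R) : a <= x -> x < a + b -> a <= y -> y < a + b -> `|x - y| < b.
  by move=> *; rewrite ltr_norml; apply/andP; split; lra.
by rewrite E in h2 h4; exact: gen h1 h2 h3 h4.
Qed.

(** An open set of the plane is a countable union of grid squares. *)
Lemma measurable_continuous_plane g : continuous g ->
  measurable_fun setT (g : plane R -> R).
Proof.
move=> cg; apply: (measurability _ (RGenOInfty.measurableE R)) => _ [_ [a ->] <-].
rewrite setTI; set U := _ @^-1` _.
pose S (i : nat * lattice) := [set x | grid_square i x /\ grid_square i `<=` U].
have mS i : measurable (S i).
  have [iU|iU] := pselect (grid_square i `<=` U).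
    rewrite (_ : S i = grid_square i); first exact: measurable_grid_square.
    by apply/seteqP; split => x //=; case.
  rewrite (_ : S i = set0); first exact: measurable0.
  by apply/seteqP; split => x //= [].
rewrite (_ : U = \bigcup_i S i); first exact: countable_bigcupT_measurable.
apply/seteqP; split => [x xU|x [i _ [ix iU]]]; last exact: iU.
have : nbhs (x : R * R) (g @^-1` `]a, +oo[%classic).
  by apply: cg; apply: open_nbhs_nbhs; split; [exact: interval_open|exact: xU].
case/nbhs_ballP => e /= e0 he.
have [n ne] : exists n : nat, n.+1%:R^-1 < e.
  exists (Num.truncn e^-1); rewrite invf_plt ?posrE//.
  exact: truncnS_gt.
have [p [p1 p2 hp]] := grid_interval n x.1; have [q [q1 q2 hq]] := grid_interval n x.2.
exists (n, (p, q)) => //; split; first by split; rewrite /= in_itv/=; apply/andP.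
move=> y [] /=; rewrite !in_itv/= => /hp yp /hq yq; apply: he; split => /=.
  exact: lt_trans yp ne.
exact: lt_trans yq ne.
Qed.

Lemma bounded_continuous_square g : continuous g ->
  exists B, forall x, @unit_square R x -> `|g x| <= B.
Proof.
move=> cg; have cK : compact ((`[0, 1] : set R) `*` (`[0, 1] : set R)).
  by apply: compact_setX; exact: segment_compact.
have [M [_ hM]] := compact_bounded (continuous_compact (continuous_subspaceT cg) cK).
exists (M + 1) => x xsq; apply: (hM (M + 1)); first by rewrite ltrDl.
by exists x => //; rewrite -unit_squareE.
Qed.

Lemma tbounded_smooth (f : R * R -> R[i]) : smooth_torus f ->
  tbounded (f : plane R -> R[i]).
Proof.
move=> [_ sm]; have [[c1 _] [c2 _]] := sm 0%N.
have [B1 h1] := bounded_continuous_square c1; have [B2 h2] := bounded_continuous_square c2.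
split; first by split; apply: measurable_funTS; exact: measurable_continuous_plane.
exists (B1 + B2) => x sx; apply: le_trans (normc_le_ReIm _) _.
by apply: lerD; [exact: h1|exact: h2].
Qed.

End ContinuousPlane.

(** * Uniqueness of solutions *)

Section Uniqueness.
Variables (R : realType) (s T : R) (omega : R * R).
Hypotheses (s1 : 1 < s) (T0 : 0 <= T).
Notation lam := (eigenvalue2 omega).
Notation ow := (@one_weight R).
Implicit Types (phi psi : R -> R * R -> R[i]) (k : lattice).

Lemma in_sobolev_cintegrable (f : R * R -> R[i]) : in_sobolev s f ->
  cintegrable (f : plane R -> R[i]).
Proof. by case=> /L2_cintegrable. Qed.

Lemma in_sobolev_l1 (f : R * R -> R[i]) : in_sobolev s f -> l1 (fourier f).
Proof.
move=> [_]; case E : (sobolev_norm s f) => [r| |]// _; last first.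
  by have := poweR_ge0 (\esum_(k in [set: lattice])
    ((normc (fourier f k)) ^+ 2 * japanese R k `^ (2 * s))%:E)%E 2^-1; rewrite -/(sobolev_norm s f) E.
exists (embedding_factor s * (`|r| + 1)).
have r0 : 0 < `|r| + 1 by rewrite ltr_wpDl.
by apply: (sobolev_l1 s1 r0); rewrite E lee_fin (le_trans (ler_norm r))// lerDl.
Qed.

Section OneSolution.
Variables (psi0 : R * R -> R[i]) (psi : R -> R * R -> R[i]).
Hypothesis sol : nls_solution omega s T psi0 psi.
Notation c := (fun t => fourier (psi t)).

(** The l^1 norm is unchanged by the phases, while the linear term disappears from
the time derivative. *)
Definition interaction t k : R[i] := expi (- (lam k * t)) * fourier (psi t) k.

Lemma lflow_interaction t : lflow omega t (interaction t) = c t.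
Proof.
apply/funext => k; rewrite /lflow /interaction mulrA.
by rewrite [expi _ * expi _]mulrC expiNK mul1r.
Qed.

Lemma solution_l1 t : 0 <= t <= T -> l1 (c t).
Proof. by move=> tT; case: sol => [[h _] _ _]; apply: in_sobolev_l1; exact: h. Qed.

(** The embedding of H^s in l^1, applied to differences of values of the solution. *)
Lemma solution_wctn : wctn ow T c.
Proof.
move=> t tT e e0; case: sol => [[hin hc] _ _]; pose C := embedding_factor s + 1.
have C0 : 0 < C by rewrite ltr_wpDl ?embedding_factor_ge0.
have := hc t tT => /(_ [set x | (x < (e / C)%:E)%E]) [|d /= d0 hd].
  by apply: open_nbhs_nbhs; split; [exact: open_ereal_lt_ereal|rewrite /= lte_fin divr_gt0].
exists d => // r rT rt; have := hd r; rewrite /= distrC => /(_ rt).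
rewrite in_itv/= => /(_ rT)/ltW h.
have eC : 0 < e / C by rewrite divr_gt0.
have := sobolev_l1 s1 eC h; have ir := in_sobolev_cintegrable (hin r rT).
have it := in_sobolev_cintegrable (hin t tT).
move=> H; apply: (@wbounded_le _ _ _ _ (embedding_factor s * (e / C))).
  by rewrite mulrCA ler_piMr ?(ltW e0)// ler_pdivrMr// mul1r lerDl.
by move=> A uA; rewrite /wsum; under eq_bigr do rewrite -fourierB//; exact: H.
Qed.

Lemma solution_bounded : exists B, forall t, 0 <= t <= T -> wbounded ow (c t) B.
Proof.
have := wctn_wnorm (fun=> ler01) solution_l1 solution_wctn.
move=> /ctn_within h; have [x _ hx] := EVT_max T0 h.
exists (wnorm ow (c x)) => t tT; apply: wbounded_le (wbounded_wnorm (solution_l1 tT)).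
by apply: hx; rewrite in_itv.
Qed.

Lemma interaction_ccontinuous k : ccontinuous (fun t => interaction t k) `[0, T].
Proof.
apply: ccontinuousM.
  apply: (@is_cderive_ccontinuous _ _ (fun t => 'i%C * ((- lam k)%:C)%C * expi (- lam k * t))).
  by move=> t; have := is_cderive_expi (- lam k) t; under eq_fun do rewrite mulNr.
have H t : 0 <= t <= T -> forall e, 0 < e -> exists2 d, 0 < d &
    forall r, 0 <= r <= T -> `|r - t| < d -> normc (c r k - c t k) <= e.
  move=> tT e e0; have [d d0 hd] := solution_wctn tT e0; exists d => // r rT rt.
  by have := wbounded_term k (hd r rT rt); rewrite mul1r.
split; apply/ctn_within => t tT e e0; have [d d0 hd] := H t tT e e0;
  exists d => // r rT rt; apply: le_trans (hd r rT rt).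
  by rewrite -ReB ler_Re_normc.
by rewrite -ImB ler_Im_normc.
Qed.

(** The solution has summable coefficients, so it is the sum of its Fourier
series and its cubic term is the one computed from the coefficients. *)
Lemma fourier_cub_solution t k : 0 <= t <= T ->
  fourier (fun x => cub (psi t x)) k = nonlin (c t) k.
Proof.
move=> tT; have [[hin _] _ _] := sol.
have it := in_sobolev_cintegrable (hin t tT).
have ae := synthesis_fourier it (solution_l1 tT).
have m1 : cmeasurable (psi t : plane R -> R[i]) by apply: L2_cmeasurable; case: (hin t tT).
have [m2 _] := tbounded_synthesis (solution_l1 tT).
have mc (f : plane R -> R[i]) : cmeasurable f -> cmeasurable (fun x => cub (f x)).
  move=> mf; under eq_fun do rewrite cubE.
  by apply: cmeasurableM; [exact: cmeasurableM|exact: cmeasurableJ].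
rewrite /nonlin; apply: fourier_ae; [exact: mc|exact: mc|].
by apply: filterS ae => x h sx; rewrite h.
Qed.

Lemma interaction_derive t k : 0 < t < T ->
  is_cderive (fun u => interaction u k) t (vfield omega t (interaction t) k).
Proof.
move=> tT; have tT' : 0 <= t <= T by case/andP: tT => t1 t2; rewrite !ltW.
have [_ _ /(_ t tT k)[d hd eqd]] := sol.
have he := is_cderive_expi (- lam k) t.
have he' : is_cderive (fun u => expi (- (lam k * u))) t
    ('i%C * ((- lam k)%:C)%C * expi (- lam k * t)).
  by under eq_fun do rewrite -mulNr.
apply: is_cderive_eq (is_cderiveM he' hd) _.
rewrite mulNr /vfield lflow_interaction -(fourier_cub_solution _ tT').
rewrite -/(cub _) in eqd.
set F := fourier (fun x => cub (psi t x)) k.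
have eqd' : 'i%C * d = - ((lam k)%:C)%C * fourier (psi t) k - F by exact: eqd.
have ii : 'i%C * 'i%C = -1 :> R[i] by rewrite -expr2 sqr_i.
have -> : d = 'i%C * (((lam k)%:C)%C * fourier (psi t) k + F).
  have -> : d = - ('i%C * ('i%C * d)) by rewrite mulrA ii mulN1r opprK.
  by rewrite eqd'; ring.
by rewrite rmorphN/=; ring.
Qed.

End OneSolution.

(** In the interaction picture both solutions solve an equation with a field that is
Lipschitz on bounded sets of l^1, and they start from the same coefficients:
Gronwall's inequality with no correction and no forcing. *)
Lemma nls_unique (psi0 : R * R -> R[i]) phi psi :
  nls_solution omega s T psi0 phi -> nls_solution omega s T psi0 psi ->
  forall t, 0 <= t <= T -> torus_ae_eq (phi t) (psi t).
Proof.
move=> sphi spsi t tT.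
have [[ip _] p0 _] := sphi; have [[iq _] q0 _] := spsi.
apply: fourier_inj; [exact/in_sobolev_cintegrable/ip|exact/in_sobolev_cintegrable/iq|].
pose z u k := interaction phi u k - interaction psi u k.
have [B1 hB1] := solution_bounded sphi; have [B2 hB2] := solution_bounded spsi.
pose B := Num.max B1 B2.
have ow0 k : 0 <= ow k by exact: ler01.
have nI (chi : R -> R * R -> R[i]) u k : normc (interaction chi u k) = normc (fourier (chi u) k).
  by rewrite Normc.normcM normc_expi mul1r.
have b1 u : 0 <= u <= T -> wbounded ow (interaction phi u) B.
  move=> uT; apply: (wbounded_dom ow0 (b := fourier (phi u))); first by move=> k; rewrite nI.
  by apply: wbounded_le (hB1 u uT); rewrite le_max lexx.
have b2 u : 0 <= u <= T -> wbounded ow (interaction psi u) B.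
  move=> uT; apply: (wbounded_dom ow0 (b := fourier (psi u))); first by move=> k; rewrite nI.
  by apply: wbounded_le (hB2 u uT); rewrite le_max lexx orbT.
have nz u k : normc (z u k) = normc (fourier (phi u) k - fourier (psi u) k).
  by rewrite /z /interaction -mulrBr Normc.normcM normc_expi mul1r.
have wz u : wnorm ow (z u) = wnorm ow (fun k => fourier (phi u) k - fourier (psi u) k).
  rewrite /wnorm; congr sup; apply/seteqP.
  by split => _ [A uA ->]; exists A => //; apply: eq_bigr => k _; rewrite nz.
(* the phases are not equicontinuous in the mode, but they drop out of the norm *)
have cz : ctn T (fun u => wnorm ow (z u)).
  under eq_fun do rewrite wz.
  apply: wctn_wnorm => // [u uT|u uT e e0].
    by apply: wl1B => //; [exact: (solution_l1 sphi)|exact: (solution_l1 spsi)].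
  have [|d1 d10 h1] := solution_wctn sphi uT (e := e / 2); first by rewrite divr_gt0.
  have [|d2 d20 h2] := solution_wctn spsi uT (e := e / 2); first by rewrite divr_gt0.
  exists (Num.min d1 d2); first by rewrite lt_min d10.
  move=> r rT; rewrite lt_min => /andP[r1 r2].
  have := wboundedB ow0 (h1 r rT r1) (h2 r rT r2); rewrite -splitr => H A uA.
  apply: le_trans (H A uA); apply: eq_ler; apply: eq_bigr => k _; congr (_ * normc _); ring.
have z0 k : z 0 k = 0.
  have T00 : 0 <= (0 : R) <= T by rewrite lexx.
  have m1 := L2_cmeasurable (ip 0 T00).1; have m2 := L2_cmeasurable (iq 0 T00).1.
  rewrite /z /interaction (fourier_ae (g := psi 0)) ?subrr//.
  by apply: filterS2 p0 q0 => x h1 h2 sx; rewrite h1// h2.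
have L0 : 0 <= 3 * B ^+ 2 by rewrite mulr_ge0// sqr_ge0.
have wge1 k : 1 <= ow k by [].
have wmul k1 k2 k3 : ow (k1 + k2 - k3) <= ow k1 * ow k2 * ow k3 by rewrite !mulr1.
have zl1 u : 0 <= u <= T -> wl1 ow (z u).
  by move=> uT; apply: wl1B => //; [exists B; exact: b1|exists B; exact: b2].
pose r u k := vfield omega u (interaction phi u) k - vfield omega u (interaction psi u) k.
have := @seq_gronwall R _ ow ow0 z (fun _ _ => 0) r (3 * B ^+ 2) 0 0 T L0 (lexx 0) (lexx 0)
  cz z0 _ _ _ _ t tT.
rewrite mulr0 mul0r addr0 mul0r => G.
have {G}zt : wnorm ow (z t) <= 0.
  apply: G => [k u uT|k|u _|u uT].
  - under eq_fun do rewrite subr0.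
    by apply: is_cderiveB; [exact: (interaction_derive sphi)|exact: (interaction_derive spsi)].
  - under eq_fun do rewrite subr0.
    by apply: ccontinuousB; [exact: (interaction_ccontinuous sphi)|
                             exact: (interaction_ccontinuous spsi)].
  - exact: wbounded0.
  - have uT' : 0 <= u <= T by case/andP: uT => u1 u2; rewrite !ltW.
    rewrite addr0; apply: vfield_lip => //; [exact: b1|exact: b2|].
    exact: wbounded_wnorm (zl1 u uT').
move=> k; apply/eqP; rewrite -subr_eq0 -normc_eq0 -nz eq_le normc_ge0 andbT.
have := wbounded_term k (wbounded_wnorm (zl1 t tT)); rewrite mul1r => /le_trans; exact.
Qed.

End Uniqueness.

(** * The solution built from its Fourier coefficients *)

Section SynthesizedSolution.
Variables (R : realType) (s T : R) (omega : R * R) (n : nat).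
Hypotheses (sn : s <= n%:R) (o1 : 0 < omega.1) (o2 : 0 < omega.2).
Notation lam := (eigenvalue2 omega).
Variables (a : R -> lattice -> R[i]) (K : R).
Hypothesis al : forall t, wl1 (wt R (n + 2)) (a t).
Hypothesis lip : forall u v,
  wbounded (wt R (n + 2)) (fun k => a u k - a v k) (K * `|u - v|).

Definition synthesized t : R * R -> R[i] := synthesis (lflow omega t (a t)).

Lemma lflow_wl1 t : wl1 (wt R (n + 2)) (lflow omega t (a t)).
Proof. by have [B hB] := al t; exists B; exact: lflow_bounded (@wt_ge0 R _) hB. Qed.

Lemma lflow_l1 t : l1 (lflow omega t (a t)).
Proof. by apply: wl1_l1 (lflow_wl1 t); exact: wt_ge1. Qed.

Lemma fourier_synthesized t k : fourier (synthesized t) k = lflow omega t (a t) k.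
Proof. exact/fourier_synthesis/lflow_l1. Qed.

(** The coefficients are Lipschitz in the weight of power [n + 2], hence those of the
linear flow are Lipschitz in the weight of power [n], which dominates H^s. *)
Lemma synthesized_dist t : exists C, forall u,
  (sobolev_norm s (synthesized u \- synthesized t)%R <= (C * `|u - t|)%:E)%E.
Proof.
have [B hB] := al t; exists (K + 2 * (omega.1 + omega.2) * B) => u.
apply: (sobolev_norm_wt sn); have := lflow_time_lip o1 o2 (m := n) u t (leqnn _) (lip u t) hB.
have -> : K * `|u - t| + 2 * (omega.1 + omega.2) * B * `|u - t| =
  (K + 2 * (omega.1 + omega.2) * B) * `|u - t| by ring.
congr wbounded; apply/funext => k.
have ci v := tbounded_cintegrable (tbounded_synthesis (lflow_l1 v)).
by rewrite -!fourier_synthesized -fourierB //; [exact: ci|exact: ci].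
Qed.

Lemma synthesized_continuous : continuous_in_sobolev s T synthesized.
Proof.
split=> [t _|t tT].
  split; first exact/L2_synthesis/lflow_l1.
  have [B hB] := lflow_wl1 t.
  have sn' : s <= (n + 2)%:R by apply: le_trans sn _; rewrite ler_nat leq_addr.
  apply: le_lt_trans (sobolev_norm_wt sn' _) (ltry B).
  suff -> : fourier (synthesized t) = lflow omega t (a t) by [].
  by apply/funext => k; exact: fourier_synthesized.
have [C hC] := synthesized_dist t.
apply: (@squeeze_cvge _ _ _ _ (fun=> 0%E) _ (fun u => (C * `|u - t|)%:E)).
- by apply: nearW => u; rewrite hC andbT poweR_ge0.
- exact: cvg_cst.
apply: cvg_within_filter; apply: cvg_EFin; first by apply: nearW.
have -> : 0 = C * `|t - t| by rewrite subrr normr0 mulr0.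
apply: cvgM; first exact: cvg_cst.
by apply: cvg_norm; apply: cvgB; [exact: cvg_id|exact: cvg_cst].
Qed.

Lemma synthesized_nls t : (forall k, is_cderive (fun v => a v k) t (vfield omega t (a t) k)) ->
  nls_at omega synthesized t.
Proof.
move=> da k.
exists ('i%C * ((lam k)%:C)%C * expi (lam k * t) * a t k + expi (lam k * t) * vfield omega t (a t) k).
  have -> : (fun u => fourier (synthesized u) k) = (fun u => expi (lam k * u) * a u k).
    by apply/funext => u; rewrite fourier_synthesized.
  by apply: is_cderiveM (da k); exact: is_cderive_expi.
rewrite fourier_synthesized -/(nonlin (lflow omega t (a t)) k) /vfield.
have ii : 'i%C * 'i%C = -1 :> R[i] by rewrite -expr2 sqr_i.
have := expiNK (lam k * t); rewrite [lflow omega t (a t) k]/lflow.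
move: (nonlin _ k) (expi _) (expi _) (a t k) => N e1 e2 c h.
have -> : 'i%C * ('i%C * ((lam k)%:C)%C * e1 * c + e1 * ('i%C * e2 * N)) =
  ('i%C * 'i%C) * (((lam k)%:C)%C * (e1 * c) + (e2 * e1) * N) by ring.
by rewrite ii h; ring.
Qed.

End SynthesizedSolution.

Lemma Qbox_truncn (R : realType) (M : R) k : 0 < M -> Qbox M k <-> k \in box (Num.truncn M).
Proof.
move=> M0; rewrite /Qbox /= mem_box.
have : 0 <= Num.max `|k.1| `|k.2| by rewrite le_max normr_ge0.
case: (Num.max _ _) => // j _.
by rewrite lez_nat; split=> [h|]; rewrite truncn_ge_nat// ltW.
Qed.

Lemma cubic_beats_power (R : realType) (C gamma eps : R) : 0 <= C -> gamma < 3 -> 0 < eps ->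
  eps < (C + 1)^-1 `^ (3 - gamma)^-1 -> C * eps ^+ 3 < eps `^ gamma.
Proof.
move=> C0 g3 e0 h; have g0 : 0 < 3 - gamma by rewrite subr_gt0.
have C1 : 0 < C + 1 by rewrite ltr_wpDl.
have h1 : eps `^ (3 - gamma) < (C + 1)^-1.
  have := gt0_ltr_powR g0 _ _ h; rewrite -powRrM mulVf ?gt_eqF// powRr1 ?invr_ge0 ?ltW//.
  by apply; rewrite nnegrE ?powR_ge0 ?ltW.
have -> : eps ^+ 3 = eps `^ (3 - gamma) * eps `^ gamma.
  by rewrite -powRD ?subrK ?powR_mulrn ?(ltW e0)//; apply/implyP => _; rewrite gt_eqF.
rewrite mulrA gtr_pMl ?powR_gt0//.
apply: le_lt_trans (ler_wpM2l C0 (ltW h1)) _.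
by rewrite ltr_pdivrMr// mul1r ltrDl.
Qed.
Theorem theorem1 (R : realType) (s gamma M : R) (omega : R * R)
    (hs : 1 < s) (hgamma : gamma < 3) (hM : 0 < M)
    (homega : irrational_vector omega) :
  exists eps0 : R, 0 < eps0 /\
    forall (psi0 : R * R -> R[i]) (eps : R),
      smooth_torus psi0 ->
      sobolev_norm s psi0 = eps%:E ->
      0 < eps < eps0 ->
      (forall k : int * int, fourier psi0 k != 0 -> Qbox M k) ->
      exists psi : R -> R * R -> R[i],
        [/\ nls_solution omega s (1 / eps ^+ 2) psi0 psi,
            forall phi : R -> R * R -> R[i],
              nls_solution omega s (1 / eps ^+ 2) psi0 phi ->
              forall t : R, 0 <= t <= 1 / eps ^+ 2 ->
                torus_ae_eq (phi t) (psi t) &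
            forall (t : R) (j : int * int),
              0 <= t <= 1 / eps ^+ 2 -> ~ Qbox M j ->
              Normc.normc (fourier (psi t) j) < eps `^ gamma].
Proof.
have [p1 p2 _] := homega.
have s0 : 0 <= s by rewrite ltW// (lt_trans _ hs).
(* the power [N] of the weight dominates the H^s norm; two more powers pay for
   the time derivative of the phases *)
pose N := (Num.truncn s).+1; pose n := (N + 2)%N; pose m := Num.truncn M.
have sN : s <= N%:R by rewrite ltW// truncnS_gt.
have n2 : (2 <= n)%N by rewrite leq_addl.
pose C := high_factor omega n m; have C0 : 0 <= C by exact: high_factor_ge0.
have C1 : 0 < C + 1 by rewrite ltr_wpDl.
exists (Num.min (eps_threshold omega n m) ((C + 1)^-1 `^ (3 - gamma)^-1)).
split; first by rewrite lt_min eps_threshold_gt0// powR_gt0// invr_gt0.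
move=> psi0 eps smooth0 norm0 /andP[e0]; rewrite lt_min => /andP[e1 e2] supp0.
have nle : (sobolev_norm s psi0 <= eps%:E)%E by rewrite norm0.
have supp k : k \notin box m -> fourier psi0 k = 0.
  by move=> km; apply: contra_notP (negP km) => /eqP/supp0/(Qbox_truncn _ hM).
have [|a [Lam [a0 al lip da high]]] := long_time_solution homega n2 _ supp
    (sobolev_energy m s0 (ltW e0) nle) (eps := eps).
  by rewrite e0.
set T := 1 / eps ^+ 2; have T0 : 0 <= T by rewrite divr_ge0 ?sqr_ge0.
have sol : nls_solution omega s T psi0 (synthesized omega a).
  split; first exact: (synthesized_continuous T sN p1 p2 al lip).
    apply: fourier_inj.
    - exact/tbounded_cintegrable/tbounded_synthesis/(lflow_l1 _ al 0).
    - exact/tbounded_cintegrable/tbounded_smooth.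
    - move=> k; rewrite (fourier_synthesized _ al) /lflow mulr0 expi0 mul1r; exact: a0.
  by move=> t tT; apply: (synthesized_nls al) => k; exact: da.
exists (synthesized omega a); split => //.
  by move=> phi sphi t tT; exact: (nls_unique hs T0 sphi sol tT).
move=> t j tT jM; rewrite (fourier_synthesized _ al) normc_lflow.
have jm : j \notin box m by apply/negP => /(Qbox_truncn _ hM).
apply: le_lt_trans (high t j tT jm) _.
exact: cubic_beats_power.
Qed.
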